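(* Let $X$ be an integer-valued random variable with $X\sim\mathrm{CO}(\mu;q)$, $q(j)=\delta j^2+\beta j+\gamma$, and suppose $X\in\mathcal X$, i.e. $\delta\le 0$ or the support $S$ of $X$ is finite. Let $M=|S|-1\in\{0,1,\ldots\}\cup\{\infty\}$ and fix non-negative integers $m,n$ with $1\le m+n\le M$. Let $g\colon S\to\mathbb R$ satisfy $\mathbb E\{q^{[n]}(X)[\Delta^n g(X)]^2\}<\infty$ and $\mathbb E[q^{[m]}(X)|\Delta^m g(X)|]<\infty$ (that is, $g\in\mathcal H^{m,n}(X)$). Put $$S_{m,n}(g)=\sum_{i=1}^{m}\kappa_i\,\Big(\mathbb E\big[q^{[i]}(X)\Delta^i g(X)\big]\Big)^2+\sum_{i=1}^{n}(-1)^{i-1}\nu_i\,\mathbb E\big\{q^{[i]}(X)[\Delta^i g(X)]^2\big\},$$ where $$\kappa_i=\frac{\binom{m}{i}\,\Pi_\delta^{[n]}(m+i)}{(m+n)_i\,\Pi_\delta^{[i]}(i-1)\,\Pi_\delta^{[n]}(m)\,\mathbb E[q^{[i]}(X)]},\qquad \nu_i=\frac{\binom{n}{i}}{(m+n)_i\,\Pi_\delta^{[i]}(m)}$$ are strictly positive constants, and an empty sum is zero. Then $$(-1)^n\{\mathrm{Var}[g(X)]-S_{m,n}(g)\}\ge 0.$$ Moreover, $S_{m,n}(g)=\mathrm{Var}[g(X)]$ if and only if there is a polynomial $H_{m+n}$ of degree at most $m+n$ such that $\mathbb P[g(X)=H_{m+n}(X)]=1$.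
   Context: An integer-valued random variable $X$ with finite mean $\mu$ and pmf $p(j)=\mathbb P(X=j)$, $j\in\mathbb Z$, belongs to the Cumulative Ord family, written $X\sim\mathrm{CO}(\mu;q)$ or $X\sim\mathrm{CO}(\mu;\delta,\beta,\gamma)$, if there is a real polynomial $q(j)=\delta j^2+\beta j+\gamma$ of degree at most two with $\sum_{k\le j}(\mu-k)p(k)=q(j)p(j)$ for all $j\in\mathbb Z$. Its support $S=\{j\in\mathbb Z: p(j)>0\}$ is a set of consecutive integers $\{\alpha,\ldots,\omega\}$ ($\alpha,\omega$ possibly infinite), and $q(\omega)=0$ if $\omega<\infty$. If $\delta\le0$ or $S$ is finite, all moments of $X$ are finite. Notation: $\Delta f(j)=f(j+1)-f(j)$, $\Delta^k=\Delta(\Delta^{k-1})$, $\Delta^0=I$; $f^{[k]}(x)=f(x)f(x+1)\cdots f(x+k-1)$, $f^{[0]}=1$; $(z)_k=z(z-1)\cdots(z-k+1)$, $(z)_0=1$; $\Pi_\delta^{[k]}(m)=\prod_{j=m}^{k+m-1}(1-j\delta)$, $\Pi_\delta^{[0]}(m)=1$. If $\omega<\infty$, $q^{[k]}(j)=0$ for $j\in S$, $j>\omega-k$, so the values of $g$ outside $S$ are irrelevant in $q^{[k]}(X)\Delta^kg(X)$ (e.g. set $g=0$ there). *)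

(* Defs.v *)
From HB Require Import structures.
From mathcomp Require Import all_boot all_order all_algebra.
From mathcomp Require Import all_classical all_reals all_analysis.

Set Implicit Arguments.
Unset Strict Implicit.
Unset Printing Implicit Defensive.

Import Order.TTheory GRing.Theory Num.Theory.
Import numFieldNormedType.Exports.

Local Open Scope classical_set_scope.
Local Open Scope ring_scope.

(* q(j) as a function on int. The coefficients are kept as parameters because
   they are not determined by the values of q on a support of at most two
   points, and delta enters the constants below. *)
Definition quad (R : realType) (delta beta gamma : R) (j : int) : R :=
  delta * j%:~R ^+ 2 + beta * j%:~R + gamma.

Definition fdiff (R : realType) (f : int -> R) (j : int) : R :=
  f (j + 1) - f j.

Definition fdiffn (R : realType) (k : nat) (f : int -> R) : int -> R :=
  iter k (@fdiff R) f.

(* f^{[k]}(j) = f(j) f(j+1) ... f(j+k-1) *)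
Definition rising (R : realType) (f : int -> R) (k : nat) (j : int) : R :=
  \prod_(0 <= i < k) f (j + i%:Z).

Definition PiDelta (R : realType) (delta : R) (k m : nat) : R :=
  \prod_(m <= j < k + m) (1 - j%:R * delta).

Section IntegerRV.
Context d (T : measurableType d) (R : realType) (P : probability T R).
Implicit Types (X : T -> int) (g : int -> R).

(* int carries no canonical measurableType; on a countable set the discrete
   sigma-algebra is generated by singletons. *)
Definition integer_rv X : Prop := forall j : int, measurable (X @^-1` [set j]).

Definition pmf X (j : int) : R := fine (P (X @^-1` [set j])).

Definition supp X : set int := [set j | 0 < pmf X j].

(* X ~ CO(mu; delta, beta, gamma).  The sum over k <= j is indexed by k = j - i,
   i = 0, 1, 2, ...; it converges absolutely because X is integrable. *)
Definition cumulative_ord X (mu delta beta gamma : R) : Prop :=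
  [/\ integer_rv X,
      P.-integrable setT (fun t => ((X t)%:~R : R)%:E),
      'E_P[fun t => (X t)%:~R]%E = mu%:E &
      forall j : int,
        series (fun i : nat => (mu - (j - i%:Z)%:~R) * pmf X (j - i%:Z)) @ \oo
          --> quad delta beta gamma j * pmf X j].

(* M = |S| - 1, equal to +oo when S is infinite *)
Definition supp_length X : \bar R := (counting (supp X) - 1)%E.

(* g in H^{m,n}(X); values of g off the support never contribute. *)
Definition in_H X (q : int -> R) (m n : nat) g : Prop :=
  ('E_P[fun t => (rising q n (X t) * fdiffn n g (X t) ^+ 2)%R] < +oo)%E /\
  ('E_P[fun t => (rising q m (X t) * `|fdiffn m g (X t)|)%R] < +oo)%E.

Definition kappa X (delta beta gamma : R) (m n i : nat) : R :=
  ('C(m, i)%:R * PiDelta delta n (m + i)) /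
  (((m + n) ^_ i)%:R * PiDelta delta i i.-1 * PiDelta delta n m *
   fine 'E_P[fun t => rising (quad delta beta gamma) i (X t)]%E).

Definition nu (delta : R) (m n i : nat) : R :=
  'C(n, i)%:R / (((m + n) ^_ i)%:R * PiDelta delta i m).

Definition Smn X (delta beta gamma : R) (m n : nat) g : R :=
  let q := quad delta beta gamma in
  \sum_(1 <= i < m.+1)
    kappa X delta beta gamma m n i *
    (fine 'E_P[fun t => (rising q i (X t) * fdiffn i g (X t))%R]%E) ^+ 2 +
  \sum_(1 <= i < n.+1)
    (-1) ^+ i.-1 * nu delta m n i *
    fine 'E_P[fun t => (rising q i (X t) * fdiffn i g (X t) ^+ 2)%R]%E.

(* Var[g(X)] and the expectations of g in Smn exist and are finite, so that
   fine (above and inside 'V_P) is only applied to finite values. *)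
Definition moments_finite X (q : int -> R) (m n : nat) g : Prop :=
  [/\ P.-integrable setT (fun t => (g (X t))%:E),
      ('V_P[fun t => g (X t)] < +oo)%E,
      forall i : nat, (1 <= i <= m)%N ->
        P.-integrable setT
          (fun t => (rising q i (X t) * fdiffn i g (X t))%:E) &
      forall i : nat, (1 <= i <= n)%N ->
        P.-integrable setT
          (fun t => (rising q i (X t) * fdiffn i g (X t) ^+ 2)%:E)].

End IntegerRV.

(* Main.v *)
Require Import Defs.
From HB Require Import structures.
From mathcomp Require Import all_boot all_order all_algebra.
From mathcomp Require Import all_classical all_reals all_analysis.
From mathcomp Require Import measurable_realfun zify ring lra.

Set Implicit Arguments.
Unset Strict Implicit.
Unset Printing Implicit Defensive.

Import Order.TTheory GRing.Theory Num.Theory.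
Import numFieldNormedType.Exports.

Local Open Scope classical_set_scope.
Local Open Scope ring_scope.

(* Put W_k = q^[k] p and <f, g>_k = sum_j W_k(j) f(j) g(j). The recursion satisfied by p
   makes D_k u (j) = (q(j) + j - mu) u(j - 1) - q(j + k) u(j) the adjoint of Delta from
   <., .>_k to <., .>_(k+1), and Delta D_k = D_(k+1) Delta + lam_(k+1) - lam_k with
   lam_k = k (1 - (k - 1) delta). Hence phi_k = D_0 ... D_(k-1) 1 are orthogonal
   eigenfunctions of D_0 Delta, and E q^[k] Delta^k g = <g, phi_k>_0.
   The nu_i are the Newton coefficients of the polynomial
   Q(x) = prod_(1 <= s <= n) (1 - x / lam_(m+s)), and kappa_k = Q(lam_k) / |phi_k|^2; so
   Var g - S(g) = B(r, r), where r is g minus its projection on phi_0, ..., phi_m and B is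
   the quadratic form of Q(D_0 Delta).
   If r has finite support, orthogonality lets us write r = D_0 ... D_m u with u finitely
   supported. Commuting the D_k past D_0 Delta turns B(r, r), up to the nonzero factor
   prod_s (- lam_(m+s)), into the form of prod_(j <= m) (D_K Delta + lam_K - lam_j),
   K = m + n + 1, evaluated at Delta^n u; this operator is positive. No completeness of
   the orthogonal polynomials is needed.
   A Hardy inequality bounding Delta^i g in W_i by Delta^(i+1) g in W_(i+1) gives all the
   integrability claims and the density of finitely supported functions. *)

(** * Sums over the integers *)

(** If the phi_k formed a basis, B(r, r) would be the sum over k > m of Q(lam_k) <r, phi_k>_0^2 /
    |phi_k|^2. Since lam increases, Q(lam_k) is zero for m < k <= m + n and has the sign (-1)^n
    beyond, which explains both claims. The detour through D_0 ... D_m replaces this expansion.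
    Solving f = D_k v uses up one orthogonality relation, hence m + 1 operators. Past them, the
    factors of Q with roots lam_(m+1), ..., lam_(m+n) become D_(m+1) ... D_(m+n) Delta^n, and the
    (-1)^n survives only in the constant prod_s (- lam_(m+s)). W_k is positive exactly at those j
    for which j and j + k lie in the support, so m + n <= M says that W_(m+n) is not identically
    zero. W_K may vanish identically: then the support has m + n + 1 points and every function on it
    is a polynomial of degree at most m + n. Every sign condition (eigenvalue gaps, Hardy rates 1 -
    2 k delta, the [PiDelta] factors) reduces to 1 - l * delta > 0 for suitable l; when delta > 0
    this is read off at the two endpoints of the support. *)

Section IntSum.
Context (R : realType).
Implicit Types (f g : int -> R) (N : nat) (j : int).

(** [Negz i] is -(i + 1), so the window is -N, ..., N - 1. The limit [isum] of these windows is used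
    as a sum only together with [isummable], which is absolute summability. *)
Definition winsum f N : R := \sum_(i < N) (f (Posz i) + f (Negz i)).

Definition isummable f := exists C, forall N, winsum (fun j => `|f j|) N <= C.

Definition isum f : R := limn (winsum f).

Lemma winsumS f N : winsum f N.+1 = winsum f N + (f (Posz N) + f (Negz N)).
Proof. by rewrite /winsum big_ord_recr. Qed.

Lemma winsum0 f : winsum f 0 = 0.
Proof. by rewrite /winsum big_ord0. Qed.

Lemma winsumD f g N : winsum (fun j => f j + g j) N = winsum f N + winsum g N.
Proof. by rewrite /winsum -big_split; apply: eq_bigr => i _ /=; ring. Qed.

Lemma winsumZ c f N : winsum (fun j => c * f j) N = c * winsum f N.
Proof. by rewrite /winsum mulr_sumr; apply: eq_bigr => i _ /=; ring. Qed.

Lemma ler_winsum f g N : (forall j, f j <= g j) -> winsum f N <= winsum g N.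
Proof. by move=> fg; apply: ler_sum => i _; apply: lerD. Qed.

Lemma winsum_ge0 f N : (forall j, 0 <= f j) -> 0 <= winsum f N.
Proof. by move=> f0; apply: sumr_ge0 => i _; apply: addr_ge0. Qed.

Lemma eq_winsum f g : f =1 g -> winsum f =1 winsum g.
Proof. by move=> fg N; apply: eq_bigr => i _; rewrite !fg. Qed.

Lemma winsum_series f :
  winsum f = series (fun i : nat => f (Posz i) + f (Negz i)) :> (nat -> R).
Proof. by apply/funext => N; rewrite /winsum /series /= big_mkord. Qed.

Lemma winsum_nd f : (forall j, 0 <= f j) -> nondecreasing_seq (winsum f).
Proof.
move=> f0; apply/nondecreasing_seqP => N.
by rewrite winsumS lerDl addr_ge0.
Qed.

Lemma isummable_ge0 f C : (forall j, 0 <= f j) ->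
  (forall N, winsum f N <= C) -> isummable f.
Proof.
move=> f0 fC; exists C => N.
by rewrite (@eq_winsum _ f)// => j; rewrite ger0_norm.
Qed.

Lemma isummable_ge0_le f : (forall j, 0 <= f j) -> isummable f ->
  exists C, forall N, winsum f N <= C.
Proof.
move=> f0 [C fC]; exists C => N.
by rewrite (@eq_winsum _ (fun j => `|f j|))// => j; rewrite ger0_norm.
Qed.

Lemma isummable_le f g :
  (forall j, `|f j| <= `|g j|) -> isummable g -> isummable f.
Proof.
by move=> fg [C gC]; exists C => N; apply: le_trans (gC N); apply: ler_winsum.
Qed.

Lemma isummable_abs f : isummable f -> isummable (fun j => `|f j|).
Proof. by apply: isummable_le => j; rewrite normr_id. Qed.

Lemma isummableD f g :
  isummable f -> isummable g -> isummable (fun j => f j + g j).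
Proof.
move=> [C fC] [C' gC]; exists (C + C') => N.
apply: le_trans (lerD (fC N) (gC N)); rewrite -winsumD.
by apply: ler_winsum => j; apply: ler_normD.
Qed.

Lemma isummableZ c f : isummable f -> isummable (fun j => c * f j).
Proof.
move=> [C fC]; exists (`|c| * C) => N.
apply: le_trans (ler_wpM2l (normr_ge0 c) (fC N)); rewrite -winsumZ.
by apply: ler_winsum => j; rewrite normrM.
Qed.

Lemma isummableN f : isummable f -> isummable (fun j => - f j).
Proof. by apply: isummable_le => j; rewrite normrN. Qed.

Lemma isummableB f g :
  isummable f -> isummable g -> isummable (fun j => f j - g j).
Proof. by move=> fs gs; apply: isummableD => //; apply: isummableN. Qed.

Lemma eq_isummable f g : f =1 g -> isummable f -> isummable g.
Proof. by move=> /funext ->. Qed.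

Lemma isummable0 : isummable (fun=> 0).
Proof.
exists 0 => N; rewrite /winsum big1// => i _.
by rewrite normr0 addr0.
Qed.

Lemma isummable_ler f g : (forall j, 0 <= f j) ->
  (forall j, f j <= g j) -> isummable g -> isummable f.
Proof.
move=> f0 fg; apply: isummable_le => j.
rewrite ger0_norm//; apply: le_trans (fg j) _; exact: ler_norm.
Qed.

Lemma cvg_winsum_ge0 f : (forall j, 0 <= f j) -> isummable f -> cvgn (winsum f).
Proof.
move=> f0 /(isummable_ge0_le f0)[C fC].
apply: nondecreasing_is_cvgn; first exact: winsum_nd.
by exists C => _ [N _ <-].
Qed.

Lemma cvg_winsum f : isummable f -> winsum f @ \oo --> isum f.
Proof.
move=> fs; rewrite /isum.
suff: cvgn (winsum f) by [].
have s1 : cvgn (winsum (fun j => `|f j|)).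
  by apply: cvg_winsum_ge0 => //; exact: isummable_abs.
have s2 : cvgn (winsum (fun j => `|f j| + f j)).
  apply: cvg_winsum_ge0 => [j|].
    by have := ler_norm (- f j); rewrite normrN; lra.
  by apply: isummableD => //; exact: isummable_abs.
have -> : winsum f = (winsum (fun j => `|f j| + f j) \- winsum (fun j => `|f j|)).
  by apply/funext => N /=; rewrite winsumD; ring.
exact: is_cvgB.
Qed.

Lemma isum_unique f l : winsum f @ \oo --> l -> isum f = l.
Proof. by move=> fl; apply: cvg_lim. Qed.

Lemma eq_isum f g : f =1 g -> isum f = isum g.
Proof. by move=> /funext ->. Qed.

Lemma isumD f g : isummable f -> isummable g ->
  isum (fun j => f j + g j) = isum f + isum g.
Proof.
move=> /cvg_winsum fs /cvg_winsum gs; apply: isum_unique.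
rewrite (_ : winsum _ = winsum f \+ winsum g); last first.
  by apply/funext => N; rewrite winsumD.
exact: cvgD.
Qed.

Lemma isumZ c f : isummable f -> isum (fun j => c * f j) = c * isum f.
Proof.
move=> /cvg_winsum fs; apply: isum_unique.
rewrite (_ : winsum _ = (fun N => c * winsum f N)); last first.
  by apply/funext => N; rewrite winsumZ.
by apply: cvgM => //; apply: cvg_cst.
Qed.

Lemma isumN f : isummable f -> isum (fun j => - f j) = - isum f.
Proof.
move=> fs; rewrite -mulN1r -isumZ//; apply: eq_isum => j; ring.
Qed.

Lemma isumB f g : isummable f -> isummable g ->
  isum (fun j => f j - g j) = isum f - isum g.
Proof. by move=> fs gs; rewrite isumD ?isumN//; apply: isummableN. Qed.

Lemma isum0 : isum (fun=> 0) = 0.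
Proof.
rewrite (@eq_isum _ (fun j : int => 0 * 0)); last by move=> j; rewrite mul0r.
by rewrite isumZ ?mul0r//; exact: isummable0.
Qed.

Lemma ler_isum f g : isummable f -> isummable g ->
  (forall j, f j <= g j) -> isum f <= isum g.
Proof.
move=> /cvg_winsum fs /cvg_winsum gs fg.
rewrite /isum; apply: ler_lim; [by apply: cvgP fs|by apply: cvgP gs|].
by apply: nearW => N; apply: ler_winsum.
Qed.

Lemma isum_ge0 f : isummable f -> (forall j, 0 <= f j) -> 0 <= isum f.
Proof. by move=> fs f0; rewrite -isum0; apply: ler_isum => //; exact: isummable0. Qed.

Lemma isum_le f C : isummable f -> (forall N, winsum f N <= C) -> isum f <= C.
Proof.
move=> /cvg_winsum fs fC; apply: limr_le; first exact: cvgP fs.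
by apply: nearW => N; apply: fC.
Qed.

Lemma winsum_le_isum f N :
  isummable f -> (forall j, 0 <= f j) -> winsum f N <= isum f.
Proof.
move=> /cvg_winsum fs f0; apply: nondecreasing_cvgn_le.
  exact: winsum_nd.
exact: cvgP fs.
Qed.

Lemma ler_winsum_term f j : (forall j, 0 <= f j) -> f j <= winsum f `|j|.+1.
Proof.
move=> f0; case: j => n.
  rewrite [`|_|%N]/= winsumS; have := winsum_ge0 n f0; have := f0 (Negz n); lra.
rewrite [`|_|%N]/= 2!winsumS; have := winsum_ge0 n f0.
have := f0 (Posz n); have := f0 (Posz n.+1); have := f0 (Negz n.+1); lra.
Qed.

Lemma ler_isum_term f j : isummable f -> (forall j, 0 <= f j) -> f j <= isum f.
Proof.
move=> fs f0; apply: le_trans (winsum_le_isum _ fs f0); exact: ler_winsum_term.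
Qed.

Lemma isum_eq0 f : isummable f -> (forall j, 0 <= f j) -> isum f = 0 ->
  forall j, f j = 0.
Proof.
move=> fs f0 fE j; apply/eqP; rewrite eq_le f0 andbT -fE; exact: ler_isum_term.
Qed.

Lemma isum_tail f : isummable f -> (forall j, 0 <= f j) ->
  (fun N : nat => isum f - winsum f N) @ \oo --> (0 : R).
Proof.
move=> /cvg_winsum fs f0; rewrite -(subrr (isum f)).
by apply: cvgB => //; apply: cvg_cst.
Qed.

Lemma isummable_cvg0 f : isummable f ->
  (fun N : nat => f (Posz N)) @ \oo --> (0 : R) /\
  (fun N : nat => f (Negz N)) @ \oo --> (0 : R).
Proof.
move=> /isummable_abs fs.
have /cvgP := cvg_winsum fs; rewrite winsum_series => /cvg_series_cvg_0 c0.
by split; apply/norm_cvg0P; apply: squeeze_cvgr (cvg_cst (0 : R)) c0;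
   apply: nearW => N /=; rewrite normr_ge0 /= ?lerDl ?lerDr.
Qed.

Lemma winsum_telescope f N :
  winsum (fun j => f (j - 1) - f j) N = f (Negz N) - f (Posz N - 1).
Proof.
elim: N => [|N IH]; first by rewrite winsum0 (_ : 0%:Z - 1 = Negz 0)// subrr.
rewrite winsumS IH (_ : Negz N - 1 = Negz N.+1); last by lia.
rewrite (_ : N.+1%:Z - 1 = N%:Z); last by lia.
ring.
Qed.

(** Summability of f itself makes the two boundary terms f(-N - 1) and f(N - 1) vanish in the limit.
    All summation by parts below rests on this. *)
Lemma isum_telescope f : isummable f -> isum (fun j => f (j - 1) - f j) = 0.
Proof.
move=> /isummable_cvg0[fp fn]; apply: isum_unique.
rewrite (_ : winsum _ = (fun N : nat => f (Negz N) - f (Posz N - 1))); last first.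
  by apply/funext => N; rewrite winsum_telescope.
rewrite -(subrr (0 : R)); apply: cvgB => //.
rewrite -cvg_shiftS; apply: cvg_trans fp; apply: near_eq_cvg.
by apply: nearW => N /=; congr f; lia.
Qed.

Definition fin_supp f := exists N, forall j, (N <= `|j|)%N -> f j = 0.

Lemma isummable_fin_supp f : fin_supp f -> isummable f.
Proof.
move=> [N fN]; exists (winsum (fun j => `|f j|) N) => M.
have nd := winsum_nd (fun j => normr_ge0 (f j)).
have [MN|/ltnW NM] := leqP M N; first exact: nd.
rewrite -(subnK NM); elim: (M - N)%N => [|k IH]; first by rewrite add0n.
rewrite addSn winsumS !fN ?normr0 ?addr0//; lia.
Qed.

Lemma fin_supp_mull f g : fin_supp f -> fin_supp (fun j => g j * f j).
Proof. by move=> [N fN]; exists N => j /fN ->; rewrite mulr0. Qed.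

Lemma fin_suppD f g : fin_supp f -> fin_supp g -> fin_supp (fun j => f j + g j).
Proof.
move=> [N fN] [M gM]; exists (maxn N M) => j; rewrite geq_max => /andP[Nj Mj].
by rewrite fN// gM// addr0.
Qed.

Lemma fin_supp_shift f k : fin_supp f -> fin_supp (fun j => f (j + k)).
Proof. by move=> [N fN]; exists (N + `|k|)%N => j Nj; apply: fN; lia. Qed.

Lemma fin_supp_fdiff f : fin_supp f -> fin_supp (fdiff f).
Proof.
move=> fs; have := fin_suppD (fin_supp_shift 1 fs) (fin_supp_mull (fun=> -1) fs).
by congr fin_supp; apply/funext => j; rewrite /fdiff mulN1r.
Qed.

Lemma fin_supp_fdiffn n f : fin_supp f -> fin_supp (fdiffn n f).
Proof. by elim: n => //= n IH fs; apply: fin_supp_fdiff; apply: IH. Qed.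

End IntSum.

(** * Newton expansions and Stein operators *)

Section NewtonExpansion.
Context (R : realType) (V : lmodType R) (A : V -> V).
Hypothesis Alin : forall c f g, A (c *: f + g) = c *: A f + A g.

(** The monic polynomial in A with list of roots s. Keeping the roots, rather than coefficients,
    lets factors be split off and cancelled one at a time. *)
Definition popl (s : seq R) (f : V) : V :=
  foldr (fun a v => A v - a *: v) f s.

Lemma lin0 : A 0 = 0.
Proof. by have := Alin (-1) 0 0; rewrite scaler0 addr0 scaleN1r addNr. Qed.

Lemma linZ c f : A (c *: f) = c *: A f.
Proof. by rewrite -[c *: f]addr0 Alin lin0 addr0. Qed.

Lemma lin_sum n (c : nat -> R) (F : nat -> V) :
  A (\sum_(i < n) c i *: F i) = \sum_(i < n) c i *: A (F i).
Proof.
elim: n => [|n IH]; first by rewrite !big_ord0 lin0.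
by rewrite !big_ord_recr /= addrC Alin IH addrC.
Qed.

Lemma popl_linear s c f g : popl s (c *: f + g) = c *: popl s f + popl s g.
Proof.
elim: s => //= a s ->; rewrite Alin scalerDr !scalerBr opprD addrACA.
by rewrite !scalerA mulrC.
Qed.

Lemma popl0 s : popl s 0 = 0.
Proof. by elim: s => //= a s ->; rewrite lin0 scaler0 subr0. Qed.

Lemma poplZ s c f : popl s (c *: f) = c *: popl s f.
Proof. by rewrite -[c *: f]addr0 popl_linear popl0 addr0. Qed.

Lemma poplD s f g : popl s (f + g) = popl s f + popl s g.
Proof. by rewrite -[f]scale1r popl_linear !scale1r. Qed.

Lemma poplB s f g : popl s (f - g) = popl s f - popl s g.
Proof. by rewrite poplD -scaleN1r poplZ scaleN1r. Qed.

Lemma popl_A s f : popl s (A f) = A (popl s f).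
Proof.
elim: s => //= a s ->.
by rewrite [in RHS]addrC -[in RHS]scaleNr Alin scaleNr addrC.
Qed.

Lemma popl_rcons s a f : popl (rcons s a) f = A (popl s f) - a *: popl s f.
Proof. by rewrite -cats1 /popl foldr_cat -!/(popl _ _) /= poplB poplZ popl_A. Qed.

End NewtonExpansion.

(** * Eigenvalue gaps and the recursion for the coefficients nu *)

Section Eigenvalues.
Context (R : realType) (delta : R).

Definition lam (k : nat) : R := k%:R * (1 - (k%:R - 1) * delta).

Definition lams (k i : nat) : seq R := [seq lam j | j <- iota k i].

Lemma lam0 : lam 0 = 0.
Proof. by rewrite /lam mul0r. Qed.

(** This factorization reduces sign and nonvanishing questions about eigenvalue gaps to factors 1 -
    l * delta with l = k + j - 1. *)
Lemma lamB k j : (j <= k)%N ->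
  lam k - lam j = (k - j)%:R * (1 - ((k + j)%:R - 1) * delta).
Proof. by move=> jk; rewrite /lam natrB// natrD; ring. Qed.

Lemma lamS k : lam k.+1 = k.+1%:R * (1 - k%:R * delta).
Proof. by rewrite /lam -natr1; ring. Qed.

Lemma lamSB k : lam k.+1 - lam k = 1 - (k + k)%:R * delta.
Proof. by rewrite lamB// subSnn mul1r addSn -natr1 addrK. Qed.

Lemma lams_rcons k n : lams k n.+1 = rcons (lams k n) (lam (k + n)).
Proof. by rewrite /lams -addn1 iotaD map_cat cats1. Qed.

Lemma nu0 m n : nu delta m n 0 = 1.
Proof. by rewrite /nu bin0 ffactn0 /PiDelta big_geq// !mulr1 divr1. Qed.

Lemma nu_gt m n i : (n < i)%N -> nu delta m n i = 0.
Proof. by move=> ni; rewrite /nu bin_small// mul0r. Qed.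

Lemma PiDeltaS k m :
  PiDelta delta k.+1 m = PiDelta delta k m * (1 - (k + m)%:R * delta).
Proof. by rewrite /PiDelta addSn big_nat_recr//= leq_addl. Qed.

Lemma PiDelta0 m : PiDelta delta 0 m = 1.
Proof. by rewrite /PiDelta big_geq. Qed.

(** Comparison of Newton coefficients when the product with n factors is multiplied by 1 - x / L, L
    = lam (m + n + 1): in the Newton basis N_i one has x N_i = N_(i+1) + lam_i N_i. *)
Lemma nu_rec m n i :
  (forall j, (j <= m + n)%N -> 1 - j%:R * delta != 0) ->
  lam (m + n.+1) * nu delta m n.+1 i.+1 =
  (lam (m + n.+1) - lam i.+1) * nu delta m n i.+1 + nu delta m n i.
Proof.
move=> nz.
have Pnz k l : (k + l <= (m + n).+1)%N -> PiDelta delta k l != 0.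
  elim: k => [|k IH] kl; first by rewrite PiDelta0 oner_neq0.
  by rewrite PiDeltaS mulf_neq0 ?nz ?IH//; lia.
have [ni|ni] := ltnP n i.
  by rewrite !nu_gt ?mulr0 ?addr0//; lia.
have ff1 : ((m + n.+1) ^_ i.+1)%:R = (m + n.+1)%:R * ((m + n) ^_ i)%:R :> R.
  by rewrite addnS ffactSS natrM.
(* The top coefficient is treated apart: the factor m + n - i split off below is m when i = n, and
   may vanish. *)
have [nE|ni'] := eqVneq n i.
  subst n.
  rewrite (@nu_gt m i i.+1)// mulr0 add0r /nu !binn ff1 PiDeltaS addnS lamS.
  have := Pnz i m; have := nz (m + i)%N.
  rewrite [(i + m)%N]addnC leqnn leqnSn => /(_ isT) h1 /(_ isT) h2.
  have h3 : ((m + i) ^_ i)%:R != 0 :> R by rewrite pnatr_eq0 -lt0n ffact_gt0; lia.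
  have h4 : (m + i).+1%:R != 0 :> R by rewrite pnatr_eq0.
  move: h1 h2 h3 h4.
  move: (PiDelta delta i m) (1 - _) ((_ ^_ _)%:R) (_.+1%:R) => x y z w h1 h2 h3 h4.
  by field; rewrite h1 h2 h3 h4.
have iln : (i < n)%N by lia.
have ff2 : ((m + n) ^_ i.+1)%:R = ((m + n) ^_ i)%:R * (m + n - i)%:R :> R.
  by rewrite ffactnSr natrM.
rewrite lamB; last by lia.
rewrite /nu binS natrD ff1 ff2 PiDeltaS.
have cb : 'C(n, i.+1)%:R * i.+1%:R = 'C(n, i)%:R * (n - i)%:R :> R.
  by rewrite -!natrM mulnC mul_bin_left mulnC.
have -> : (m + n.+1 - i.+1)%N = (m + n - i)%N by lia.
have h1 : 1 - (i + m)%:R * delta != 0 by apply: nz; lia.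
have h2 : PiDelta delta i m != 0 by apply: Pnz; lia.
have h3 : ((m + n) ^_ i)%:R != 0 :> R by rewrite pnatr_eq0 -lt0n ffact_gt0; lia.
have h4 : (m + n - i)%:R != 0 :> R by rewrite pnatr_eq0; lia.
have h5 : (m + n.+1)%:R != 0 :> R by rewrite pnatr_eq0; lia.
rewrite addnS lamS -addnS.
(* What remains after clearing denominators; the two sides differ by delta times the absorption
   identity [cb]. *)
have key : ('C(n, i.+1)%:R + 'C(n, i)%:R) * (1 - (m + n)%:R * delta) =
   (1 - ((m + n.+1 + i.+1)%:R - 1) * delta) * 'C(n, i.+1)%:R
   + 'C(n, i)%:R * (1 - (i + m)%:R * delta).
  rewrite natrB// in cb.
  move: cb; rewrite !natrD -!natr1.
  set b := 'C(n, i)%:R; set b' := 'C(n, i.+1)%:R; move=> cb.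
  have E : b * n%:R - b * i%:R = b' * (i%:R + 1) by rewrite cb mulrBr.
  apply/eqP; rewrite -subr_eq0; apply/eqP.
  transitivity (delta * (b' * (i%:R + 1) - (b * n%:R - b * i%:R))); first by ring.
  by rewrite E subrr mulr0.
apply: (mulIf (mulf_neq0 (mulf_neq0 h3 h2) h1)).
transitivity (('C(n, i.+1)%:R + 'C(n, i)%:R) * (1 - (m + n)%:R * delta)).
  move: h1 h2 h3 h5; move: (PiDelta delta i m) (1 - (i + m)%:R * delta).
  move: ((_ ^_ i)%:R) (m + n.+1)%:R => x y z w h1 h2 h3 h5.
  by field; rewrite h1 h2 h3 h5.
rewrite key; move: h1 h2 h3 h4.
move: (PiDelta delta i m) (1 - (i + m)%:R * delta) ((_ ^_ i)%:R) (m + n - i)%:R.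
move=> x y z w h1 h2 h3 h4; by field; rewrite h1 h2 h3 h4.
Qed.

End Eigenvalues.

Section NewtonNu.
Context (R : realType) (delta : R) (V : lmodType R) (A : V -> V).
Hypothesis Alin : forall c f g, A (c *: f + g) = c *: A f + A g.

(* Newton expansion of prod_(1 <= s <= n) (1 - x / lam (m + s)) with nodes
   lam 0, lam 1, ..., evaluated at x = A; this is where nu comes from. *)
Lemma popl_newton m n f :
  (forall j, (j < m + n)%N -> 1 - j%:R * delta != 0) ->
  popl A (lams delta m.+1 n) f =
  (\prod_(s < n) - lam delta (m + s.+1)) *:
    \sum_(i < n.+1) ((-1) ^+ i * nu delta m n i) *: popl A (lams delta 0 i) f.
Proof.
elim: n => [|n IH] nz.
  by rewrite big_ord0 big_ord1 nu0 expr0 mulr1 !scale1r.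
rewrite lams_rcons popl_rcons// IH; last by move=> j jmn; apply: nz; lia.
rewrite [\prod_(s < n.+1) _]big_ord_recr /= -scalerA.
set c := \prod_(i < n) _; set S := \sum_(i < n.+1) _.
rewrite linZ// [_ *: (c *: S)]scalerA [_ * c]mulrC -[_ *: S]scalerA -scalerBr; congr (_ *: _).
rewrite addSnnS; set L := lam delta _.
pose G i := popl A (lams delta 0 i) f.
(* The rule x N_i = N_(i+1) + lam_i N_i for the Newton basis, at x = A. *)
have AG i : A (G i) = G i.+1 + lam delta i *: G i.
  by rewrite /G lams_rcons popl_rcons// add0n subrK.
pose e k i : R := (-1) ^+ i * nu delta m k i.
have e0 : e n n.+1 = 0 by rewrite /e nu_gt// mulr0.
have AS : A S = \sum_(i < n.+1) e n i *: (G i.+1 + lam delta i *: G i).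
  by rewrite /S (lin_sum Alin _ (e n) G); apply: eq_bigr => i _; rewrite AG.
have -> : L *: S = L *: G 0%N + \sum_(i < n.+1) (L * e n i.+1) *: G i.+1.
  transitivity (L *: \sum_(i < n.+2) e n i *: G i).
    by rewrite [in RHS]big_ord_recr /= e0 scale0r addr0.
  rewrite big_ord_recl /= /e nu0 expr0 mulr1 scale1r scalerDr; congr (_ + _).
  by rewrite scaler_sumr; apply: eq_bigr => i _; rewrite scalerA.
have -> : A S = \sum_(i < n.+1) (e n i + lam delta i.+1 * e n i.+1) *: G i.+1.
  rewrite AS; under eq_bigr do rewrite scalerDr.
  rewrite big_split /=; under [RHS]eq_bigr do rewrite scalerDl.
  rewrite [RHS]big_split /=; congr (_ + _).
  rewrite [LHS]big_ord_recl lam0 scale0r scaler0 add0r.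
  rewrite [RHS]big_ord_recr /= e0 mulr0 scale0r addr0.
  by apply: eq_bigr => i _; rewrite scalerA mulrC.
rewrite [in RHS]big_ord_recl /= nu0 expr0 mulr1 scale1r scalerDr scaleNr.
rewrite opprD addrCA; congr (_ + _).
rewrite -sumrB scaler_sumr; apply: eq_bigr => i _.
rewrite -scalerBl scalerA -[bump 0 i]/(i.+1); congr (_ *: _).
have := @nu_rec R delta m n i (fun j jmn => nz j ltac:(lia)).
rewrite -/L /e exprS => E.
transitivity ((-1) ^+ i * (L * nu delta m n.+1 i.+1)); last by ring.
by rewrite E; ring.
Qed.

End NewtonNu.

(** * Stein operators and their commutation rules *)

Section SteinOperators.
Context (R : realType) (mu delta beta gamma : R).
Implicit Types (f g u v : int -> R) (s : seq R).
Local Notation q := (quad delta beta gamma).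
Local Notation lam := (lam delta).
Local Notation lams := (lams delta).

(* The adjoint of the forward difference between the weights q^[k] p and
   q^[k+1] p; the factor q j + j - mu turns p j into q (j - 1) * p (j - 1). *)
Definition steinD (k : nat) u : int -> R := fun j =>
  (q j + j%:~R - mu) * u (j - 1) - q (j + k%:Z) * u j.

(** The added constant lam_k makes the intertwining exact: Delta sop_k = sop_(k+1) Delta and sop_k
    D_k = D_k sop_(k+1), so polynomials in sop change level with their roots unchanged. *)
Definition sop (k : nat) f : int -> R := steinD k (fdiff f) + lam k *: f.

Definition sops k s : (int -> R) -> (int -> R) := popl (sop k) s.

(** The product D_i ... D_(i+k-1), which maps functions of level i + k to functions of level i. *)
Definition steinDn := fix loop i k u : int -> R :=
  if k is k'.+1 then steinD i (loop i.+1 k' u) else u.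

(* Rodrigues formula for the orthogonal polynomials of p *)
Definition phi (k : nat) : int -> R := steinDn 0 k (fun=> 1).

Lemma fdiff_linear c f g : fdiff (c *: f + g) = c *: fdiff f + fdiff g.
Proof. by apply/funext => j; rewrite /fdiff !fctE /GRing.scale/=; ring. Qed.

Lemma fdiffn_linear n c f g :
  fdiffn n (c *: f + g) = c *: fdiffn n f + fdiffn n g.
Proof. by elim: n => //= n ->; rewrite fdiff_linear. Qed.

Lemma steinD_linear k c f g :
  steinD k (c *: f + g) = c *: steinD k f + steinD k g.
Proof. by apply/funext => j; rewrite /steinD !fctE /GRing.scale/=; ring. Qed.

Lemma sop_linear k c f g : sop k (c *: f + g) = c *: sop k f + sop k g.
Proof.
rewrite /sop fdiff_linear steinD_linear !scalerDr !scalerA mulrC.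
by rewrite addrACA.
Qed.

Lemma steinDn_linear i k c f g :
  steinDn i k (c *: f + g) = c *: steinDn i k f + steinDn i k g.
Proof. by elim: k i => //= k IH i; rewrite IH steinD_linear. Qed.

Lemma sops_cons k a s f : sops k (a :: s) f =
  fun j => steinD k (fdiff (sops k s f)) j + (lam k - a) * sops k s f j.
Proof.
by apply/funext => j; rewrite /sops /= /sop !fctE /GRing.scale/=; ring.
Qed.

(** The commutator is multiplication by the slope of q(j) + j - mu - q(j + k), which is affine in j
    because q is at most quadratic; the slope is 1 - 2 k delta. *)
Lemma fdiff_steinD k u : fdiff (steinD k u) =
  fun j => steinD k.+1 (fdiff u) j + (lam k.+1 - lam k) * u j.
Proof.
apply/funext => j; rewrite lamSB /fdiff /steinD /quad subrK addrK.
by rewrite -[k.+1]addn1 !PoszD !natrD !rmorphD/= !rmorph1; ring.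
Qed.

Lemma fdiff_sops k s f : fdiff (sops k s f) = sops k.+1 s (fdiff f).
Proof.
elim: s => [//|a s IH]; rewrite !sops_cons -IH.
set h := sops k s f.
have -> : (fun j => steinD k (fdiff h) j + (lam k - a) * h j) =
    (lam k - a) *: h + steinD k (fdiff h).
  by apply/funext => j; rewrite !fctE addrC.
rewrite fdiff_linear fdiff_steinD; apply/funext => j.
by rewrite !fctE /GRing.scale/=; ring.
Qed.

Lemma sops_steinD k s v : sops k s (steinD k v) = steinD k (sops k.+1 s v).
Proof.
elim: s => [//|a s IH]; rewrite !sops_cons IH fdiff_steinD.
set h := sops k.+1 s v.
have -> : (fun j => steinD k.+1 (fdiff h) j + (lam k.+1 - lam k) * h j) =
    (lam k.+1 - lam k) *: h + steinD k.+1 (fdiff h).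
  by apply/funext => j; rewrite !fctE addrC.
have -> : (fun j => steinD k.+1 (fdiff h) j + (lam k.+1 - a) * h j) =
    (lam k.+1 - a) *: h + steinD k.+1 (fdiff h).
  by apply/funext => j; rewrite !fctE addrC.
rewrite !steinD_linear; apply/funext => j.
by rewrite !fctE /GRing.scale/=; ring.
Qed.

Lemma fdiffnS n f : fdiffn n.+1 f = fdiffn n (fdiff f).
Proof. by rewrite /fdiffn iterSr. Qed.

Lemma fdiffn_sops i k s f : fdiffn i (sops k s f) = sops (k + i) s (fdiffn i f).
Proof.
elim: i k f => [|i IH] k f; first by rewrite addn0.
by rewrite !fdiffnS fdiff_sops IH addSnnS.
Qed.

Lemma sops_steinDn k s i v : sops k s (steinDn k i v) = steinDn k i (sops (k + i) s v).
Proof.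
elim: i k => [|i IH] k /=; first by rewrite addn0.
by rewrite sops_steinD IH addSnnS.
Qed.

(** The factor with root lam_k is exactly D_k Delta. Its Delta carries the other factors to level k
    + 1, where the next root acts in the same way. *)
Lemma sops_lams k i f : sops k (lams k i) f = steinDn k i (fdiffn i f).
Proof.
elim: i k f => [//|i IH] k f.
rewrite [lams k i.+1]/= sops_cons; apply/funext => j.
by rewrite subrr mul0r addr0 /= fdiff_sops -/(lams k.+1 i) IH -fdiffnS.
Qed.

Lemma sops_cat k s1 s2 f : sops k (s1 ++ s2) f = sops k s1 (sops k s2 f).
Proof. by rewrite /sops /popl foldr_cat. Qed.

Lemma fdiff_steinD_sops k w : fdiff (steinD k w) = sops k.+1 [:: lam k] w.
Proof. by rewrite fdiff_steinD sops_cons. Qed.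

(** Dual to [sops_lams]: with the differences outermost the same roots lam_k, ..., lam_(k+i-1)
    occur, but at the level k + i, where none of them cancels. *)
Lemma fdiffn_steinDn i k u :
  fdiffn i (steinDn k i u) = sops (k + i) (lams k i) u.
Proof.
elim: i k u => [|i IH] k u; first by rewrite addn0.
rewrite fdiffnS [steinDn _ _ _]/= fdiff_steinD_sops fdiffn_sops IH addSnnS.
by rewrite -sops_cat.
Qed.

Lemma sops_linear k s c f g : sops k s (c *: f + g) = c *: sops k s f + sops k s g.
Proof. by apply: popl_linear => *; apply: sop_linear. Qed.

Lemma sops_cst1 k s : sops k s (fun=> 1) = fun=> \prod_(a <- s) (lam k - a).
Proof.
elim: s => [|a s IH]; first by rewrite big_nil.
rewrite sops_cons IH big_cons; apply/funext => j.
by rewrite /steinD /fdiff !subrr !mulr0 subrr add0r.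
Qed.

(** Delta kills constants, so they are eigenfunctions of [sop] at level k + i with eigenvalue
    lam_(k+i); the intertwining transports this to level k. *)
Lemma sops_steinDn1 k s i : sops k s (steinDn k i (fun=> 1)) =
  (\prod_(a <- s) (lam (k + i) - a)) *: steinDn k i (fun=> 1).
Proof.
rewrite sops_steinDn sops_cst1; set c := \prod_(_ <- _) _.
rewrite -[RHS]addr0 -[0](_ : steinDn k i 0 = 0); last first.
  by have := steinDn_linear k i (-1) 0 0; rewrite scaler0 addr0 scaleN1r addNr.
rewrite -steinDn_linear addr0; congr (steinDn _ _ _).
by apply/funext => j; rewrite fctE /GRing.scale /= mulr1.
Qed.

Lemma fdiff_steinDn1 k i : fdiff (steinDn k i.+1 (fun=> 1)) =
  (lam (k + i.+1) - lam k) *: steinDn k.+1 i (fun=> 1).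
Proof. by rewrite /= fdiff_steinD_sops sops_steinDn1 big_seq1 addSnnS. Qed.

(** This plays the part of a leading coefficient: phi_k has exact degree k as long as lam_k differs
    from lam_0, ..., lam_(k-1). *)
Lemma fdiffn_phi k :
  fdiffn k (phi k) = fun=> \prod_(j < k) (lam k - lam j).
Proof.
rewrite /phi fdiffn_steinDn sops_cst1 add0n /lams big_map.
apply/funext => _; have -> : iota 0 k = index_iota 0 k by rewrite /index_iota subn0.
by rewrite big_mkord.
Qed.

End SteinOperators.

(** * Hardy inequalities *)

Section Antidifference.
Context (R : realType).
Implicit Types (f w : int -> R).

Definition asum w (j : int) : R :=
  match j with
  | Posz n => \sum_(i < n) w (Posz i)
  | Negz n => - \sum_(i < n.+1) w (Negz i)
  end.

Lemma fdiff_asum w : fdiff (asum w) = w.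
Proof.
apply/funext; case=> n; rewrite /fdiff.
  by rewrite -PoszD addn1 /= big_ord_recr /= addrAC subrr add0r.
case: n => [|n].
  by rewrite (_ : Negz 0 + 1 = 0)//= big_ord0 big_ord1 sub0r opprK.
have -> : Negz n.+1 + 1 = Negz n by lia.
by rewrite /= opprK [X in - _ + X]big_ord_recr /= addrA addNr add0r.
Qed.

Lemma int_ind_between (P : int -> Prop) (a : int) :
  P a -> (forall j, a <= j -> P j -> P (j + 1)) ->
  (forall j, j < a -> P (j + 1) -> P j) -> forall j, P j.
Proof.
move=> Pa up dn j; have [aj|ja] := leP a j.
  have -> : j = a + `|(j - a)%R|%N by lia.
  elim: `|(j - a)%R|%N => [|n IH]; first by rewrite addr0.
  by rewrite -addn1 PoszD addrA; apply: up => //; lia.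
have -> : j = a - `|(j - a)%R|%N%:Z by lia.
elim: `|(j - a)%R|%N => [|n IH]; first by rewrite subr0.
apply: dn; first by lia.
by rewrite (_ : a - n.+1%:Z + 1 = a - n%:Z)//; lia.
Qed.

(** Cauchy-Schwarz along the |j - c| steps between c and j, with F accumulating the squared steps.
    It converts a Hardy inequality for |F| into one for h^2. *)
Lemma fdiff_sqr_le h (F : int -> R) (c j : int) :
  fdiff F = (fun j => fdiff h j ^+ 2) ->
  (h j - h c) ^+ 2 <= (`|(j - c)%R|%N)%:R * `|F j - F c|.
Proof.
move=> dF; have FE l : F (l + 1) = F l + fdiff h l ^+ 2.
  by have := congr1 (@^~ l) dF => /= <-; rewrite /fdiff; ring.
have hE l : h (l + 1) = h l + fdiff h l by rewrite /fdiff; ring.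
(* After multiplication by N = n + 1 the slack in one more step is the square of x - N d. *)
have step (n : nat) (x y d : R) : 0 <= y -> x ^+ 2 <= n%:R * y ->
    (x + d) ^+ 2 <= n.+1%:R * (y + d ^+ 2).
  move=> y0; case: n => [|n] xy.
    have -> : x = 0.
      by apply/eqP; rewrite -sqrf_eq0 eq_le sqr_ge0 andbT; rewrite mul0r in xy.
    by rewrite add0r mul1r lerDr.
  have n0 : 0 < n.+1%:R :> R by rewrite ltr0n.
  rewrite -(ler_pM2l n0) -[n.+2%:R]natr1; set N := n.+1%:R in n0 xy *.
  have := sqr_ge0 (x - N * d); have : 0 <= N * (N * y - x ^+ 2) + (N * y - x ^+ 2).
    by rewrite addr_ge0// ?mulr_ge0 ?subr_ge0// ltW.
  nra.
suff : (c <= j -> F c <= F j /\ (h j - h c) ^+ 2 <= (`|(j - c)%R|%N)%:R * (F j - F c)) /\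
       (j < c -> F j <= F c /\ (h c - h j) ^+ 2 <= (`|(j - c)%R|%N)%:R * (F c - F j)).
  have [cj|jc] := leP c j => -[].
    by move=> /(_ isT)[Fc H] _; rewrite ger0_norm ?subr_ge0.
  by move=> _ /(_ isT)[Fc H]; rewrite distrC ger0_norm ?subr_ge0// -sqrrN opprB.
move: j; apply: (@int_ind_between _ c) => [|j cj|j jc].
- by rewrite ltxx lexx !subrr expr0n mulr0.
- move=> [+ _]; rewrite cj => /(_ isT)[Fcj H]; split; last by lia.
  move=> _; split; first by rewrite FE (le_trans Fcj)// lerDl sqr_ge0.
  rewrite hE FE addrAC [_ + _ ^+ 2 - _]addrAC.
  have -> : (`|(j + 1 - c)%R| = `|(j - c)%R|.+1)%N by lia.
  by apply: step => //; rewrite subr_ge0.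
- move=> IH; split; first by lia.
  move=> _; have {IH} : F (j + 1) <= F c /\
      (h c - h (j + 1)) ^+ 2 <= (`|(j + 1 - c)%R|%N)%:R * (F c - F (j + 1)).
    have [jc1|jc1] := ltP (j + 1) c; first by case: IH => _ /(_ jc1).
    by rewrite (_ : j + 1 = c) ?lexx ?subrr ?expr0n ?mulr0//; lia.
  move=> [Fjc H]; have Fj := FE j; have hj := hE j.
  split; first by rewrite (le_trans _ Fjc)// Fj lerDl sqr_ge0.
  have -> : h c - h j = h c - h (j + 1) + fdiff h j by rewrite hj; ring.
  have -> : F c - F j = F c - F (j + 1) + fdiff h j ^+ 2 by rewrite Fj; ring.
  have -> : (`|(j - c)%R| = `|(j + 1 - c)%R|.+1)%N by lia.
  by apply: step => //; rewrite subr_ge0.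
Qed.

End Antidifference.

Section CenteredWindows.
Context (R : realType).
Implicit Types (f : int -> R).

(** The window c - n, ..., c + n - 1. The Hardy inequality is proved outwards from a centre c,
    whereas [isum] is built on windows around 0. *)
Definition cwin (c : int) f (n : nat) : R :=
  \sum_(k < n) (f (c + k%:Z) + f (c - 1 - k%:Z)).

Lemma cwin0 f n : cwin 0 f n = winsum f n.
Proof.
apply: eq_bigr => k _; rewrite add0r; congr (_ + f _); lia.
Qed.

Lemma cwinS c f n : cwin c f n.+1 = cwin c f n + (f (c + n%:Z) + f (c - 1 - n%:Z)).
Proof. by rewrite /cwin big_ord_recr. Qed.

Lemma cwin_succ c f n :
  cwin (c + 1) f n.+1 = cwin c f n + f (c + n%:Z) + f (c + n.+1%:Z).
Proof.
elim: n => [|n IH].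
  by rewrite cwinS /cwin !big_ord0 !add0r addrC; congr (f _ + f _); lia.
rewrite cwinS IH cwinS.
have -> : c + 1 + n.+1%:Z = c + n.+2%:Z by lia.
have -> : c + 1 - 1 - n.+1%:Z = c - 1 - n%:Z by lia.
ring.
Qed.

Lemma cwin_pred c f n :
  cwin c f n.+1 = cwin (c + 1) f n + f (c - n%:Z) + f (c - 1 - n%:Z).
Proof.
elim: n => [|n IH].
  by rewrite cwinS /cwin !big_ord0 !add0r; congr (f _ + f _); lia.
rewrite cwinS IH cwinS.
have -> : c + 1 + n%:Z = c + n.+1%:Z by lia.
have -> : c + 1 - 1 - n%:Z = c - n%:Z by lia.
have -> : c - n.+1%:Z = c - 1 - n%:Z by lia.
ring.
Qed.

Lemma cwin_le_recenter c c' f n : (forall j, 0 <= f j) ->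
  cwin c f n <= cwin c' f (n + `|(c - c')%R|).
Proof.
move=> f0; move: c'; apply: (@int_ind_between _ c) => [|c' cc IH|c' cc IH].
- by rewrite subrr addn0.
- have -> : (n + `|(c - (c' + 1))%R| = (n + `|(c - c')%R|).+1)%N by lia.
  by rewrite cwin_succ -addrA (le_trans IH)// lerDl addr_ge0.
- have -> : (n + `|(c - c')%R| = (n + `|(c - (c' + 1))%R|).+1)%N by lia.
  by rewrite cwin_pred -addrA (le_trans IH)// lerDl addr_ge0.
Qed.

Lemma cwin_le_isum c f n : (forall j, 0 <= f j) -> isummable f ->
  cwin c f n <= isum f.
Proof.
move=> f0 fs; apply: le_trans (cwin_le_recenter c 0 n f0) _.
by rewrite cwin0; apply: winsum_le_isum.
Qed.

Lemma winsum_le_cwin c f C : (forall j, 0 <= f j) ->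
  (forall n, cwin c f n <= C) -> forall n, winsum f n <= C.
Proof.
move=> f0 fC n; rewrite -cwin0.
exact: le_trans (cwin_le_recenter 0 c n f0) (fC _).
Qed.

End CenteredWindows.

Section Hardy.
Context (R : realType).

(** 1 + |j|: being at least 1, its powers increase with the exponent and dominate polynomials
    without an exception at 0. *)
Definition rho (j : int) : R := `|j|%N.+1%:R.

Lemma rho_ge1 j : 1 <= rho j.
Proof. by rewrite ler1n. Qed.

Lemma rho_gt0 j : 0 < rho j.
Proof. exact: lt_le_trans (rho_ge1 j). Qed.

Lemma rho_ge0 j : 0 <= rho j.
Proof. exact: ltW (rho_gt0 j). Qed.

Lemma abs_le_rho j : `|j%:~R : R| <= rho j.
Proof. by rewrite -intr_norm -abszE /rho -natr1 pmulrn lerDl. Qed.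

Lemma rho_shift j (k : nat) : rho (j + k%:Z) <= k.+1%:R * rho j.
Proof. by rewrite /rho -natrM ler_nat; nia. Qed.

Lemma rho_exp_diff a : exists2 C, 0 <= C &
  forall j, `|rho (j + 1) ^+ a.+1 - rho j ^+ a.+1| <= C * rho j ^+ a.
Proof.
have d1 j : `|rho (j + 1) - rho j| <= 1.
  rewrite /rho ler_norml -!natr1.
  have [e|e] : (`|(j + 1)%R| = `|j|.+1 \/ `|j| = `|(j + 1)%R|.+1)%N by lia.
    by rewrite e -natr1; apply/andP; split; lra.
  by rewrite e -natr1; apply/andP; split; lra.
have d2 j : rho (j + 1) <= 2 * rho j by exact: rho_shift j 1.
elim: a => [|a [C C0 IH]].
  by exists 1 => // j; rewrite expr0 mulr1 !expr1.
exists (2 * C + 1) => [|j]; first by lra.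
have -> : rho (j + 1) ^+ a.+2 - rho j ^+ a.+2 =
  rho (j + 1) * (rho (j + 1) ^+ a.+1 - rho j ^+ a.+1)
  + rho j ^+ a.+1 * (rho (j + 1) - rho j) by rewrite [_ ^+ a.+2]exprS [rho j ^+ a.+2]exprS; ring.
apply: le_trans (ler_normD _ _) _; rewrite mulrDl mul1r; apply: lerD.
  rewrite normrM (ger0_norm (rho_ge0 _)).
  have -> : 2 * C * rho j ^+ a.+1 = (2 * rho j) * (C * rho j ^+ a).
    by rewrite exprS; ring.
  by apply: ler_pM => //; apply: rho_ge0.
rewrite normrM ger0_norm ?exprn_ge0 ?rho_ge0//.
by rewrite ler_piMr// exprn_ge0 ?rho_ge0.
Qed.

Variables (w w' : int -> R) (r s : R).
Hypotheses (w0 : forall j, 0 <= w j) (w'0 : forall j, 0 <= w' j) (r0 : 0 < r).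
Hypothesis ww' : forall j, w' (j - 1) - w' j = w j * (r * j%:~R - s).

(* Summation by parts: the centre c is chosen so that the affine function
   r * j - s changes sign between c - 1 and c *)
Lemma hardy1 : exists c K, [/\ 0 <= K &
  forall h : int -> R, isummable (fun j => w' j * `|fdiff h j|) ->
    isummable (fun j => w j * rho j * `|h j - h c|) /\
    isum (fun j => w j * rho j * `|h j - h c|) <=
      K * isum (fun j => w' j * `|fdiff h j|)].
Proof.
pose c := Num.ceil (s / r).
have cs : s <= r * c%:~R by rewrite mulrC -ler_pdivrMr// Num.Theory.ceil_ge.
have cs1 : r * (c - 1)%:~R < s.
  by rewrite mulrC -ltr_pdivlMr// Num.Theory.ceilB1_lt.
(* With this t one has |r j - s| >= t |j - c| on both sides of c. On the left the first gap is s - r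
   (c - 1), which may be smaller than r. *)
pose t := Num.min r (s - r * (c - 1)%:~R).
have t0 : 0 < t by rewrite lt_min r0 subr_gt0.
have tr : t <= r by rewrite ge_min lexx.
have ts : t <= s - r * (c - 1)%:~R by rewrite ge_min lexx orbT.
have rc j : j != c -> rho j <= (`|c| + 2)%:R * (`|(j - c)%R|%N)%:R.
  by move=> jc; rewrite /rho -natrM ler_nat; nia.
exists c, ((`|c| + 2)%:R / t); split; first by rewrite divr_ge0// ltW.
move=> h hs.
pose F j := w j * (`|(j - c)%R|%N)%:R * `|h j - h c|.
pose G j := w' j * `|fdiff h j|.
have F0 j : 0 <= F j by rewrite !mulr_ge0.
have G0 j : 0 <= G j by rewrite mulr_ge0.
(* The boundary term is carried along so that the induction closes: w' drops by w (r j - s) at each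
   step, and this drop pays for the next term of F. *)
have right n : t * (\sum_(k < n) F (c + k.+1%:Z)) + w' (c + n%:Z) * `|h (c + n%:Z) - h c|
    <= \sum_(k < n) G (c + k%:Z).
  elim: n => [|n IH]; first by rewrite !big_ord0 mulr0 addr0 subrr normr0 mulr0 addr0.
  rewrite !big_ord_recr /=.
  suff : t * F (c + n.+1%:Z) + w' (c + n.+1%:Z) * `|h (c + n.+1%:Z) - h c| <=
     w' (c + n%:Z) * `|h (c + n%:Z) - h c| + G (c + n%:Z) by lra.
  have e1 : c + n.+1%:Z - 1 = c + n%:Z by lia.
  have := ww' (c + n.+1%:Z); rewrite e1 => E.
  have -> : w' (c + n.+1%:Z) = w' (c + n%:Z) - w (c + n.+1%:Z) * (r * (c + n.+1%:Z)%:~R - s).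
    by rewrite -E; ring.
  have tri : `|h (c + n.+1%:Z) - h c| <= `|h (c + n%:Z) - h c| + `|fdiff h (c + n%:Z)|.
    rewrite /fdiff (_ : c + n%:Z + 1 = c + n.+1%:Z); last by lia.
    by rewrite [leRHS]addrC; apply: ler_distD.
  have := ler_wpM2l (w'0 (c + n%:Z)) tri; rewrite /F /G.
  rewrite (_ : `|(c + n.+1%:Z - c)%R|%N = n.+1); last by lia.
  have : t * n.+1%:R <= r * (c + n.+1%:Z)%:~R - s.
    have := ler_wpM2r (ler0n R n.+1) tr.
    by rewrite rmorphD /= mulrDr -[n.+1%:~R]pmulrn; lra.
  have := mulr_ge0 (w0 (c + n.+1%:Z)) (normr_ge0 (h (c + n.+1%:Z) - h c)).
  set X := w _ * _; set Y := `|h (c + n.+1%:Z) - h c| in X *.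
  move=> X0 /(ler_wpM2r X0); rewrite /X; lra.
have left n : t * (\sum_(k < n) F (c - 1 - k%:Z)) + w' (c - 1 - n%:Z) * `|h (c - n%:Z) - h c|
    <= \sum_(k < n) G (c - 1 - k%:Z).
  elim: n => [|n IH]; first by rewrite !big_ord0 mulr0 !subr0 subrr normr0 mulr0 addr0.
  rewrite !big_ord_recr /=.
  have e1 : c - 1 - n.+1%:Z = c - 1 - n%:Z - 1 by lia.
  have e2 : c - n.+1%:Z = c - 1 - n%:Z by lia.
  rewrite e1 e2; move: IH; set j := c - 1 - n%:Z => IH.
  have e3 : c - n%:Z = j + 1 by rewrite /j; lia.
  rewrite e3 in IH.
  suff : t * F j + w' (j - 1) * `|h j - h c| <= w' j * `|h (j + 1) - h c| + G j by lra.
  have -> : w' (j - 1) = w' j + w j * (r * j%:~R - s) by rewrite -ww'; ring.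
  have tri : `|h j - h c| <= `|h (j + 1) - h c| + `|fdiff h j|.
    rewrite /fdiff [`|h (j + 1) - h j|]distrC.
    by rewrite [leRHS]addrC; apply: ler_distD.
  have := ler_wpM2l (w'0 j) tri; rewrite /F /G.
  rewrite (_ : `|(j - c)%R|%N = n.+1); last by rewrite /j; lia.
  have : t * n.+1%:R <= s - r * j%:~R.
    have := ler_wpM2r (ler0n R n) tr.
    rewrite /j rmorphB /= -[n%:~R]pmulrn -natr1; lra.
  have := mulr_ge0 (w0 j) (normr_ge0 (h j - h c)).
  set X := w _ * _; set Y := `|h j - h c| in X *.
  move=> X0 /(ler_wpM2r X0); rewrite /X; lra.
have Fwin n : t * cwin c F n <= cwin c G n.
  rewrite /cwin !big_split /= mulrDr; apply: lerD.
    case: n => [|n]; first by rewrite !big_ord0 mulr0.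
    have Fc : F (c + 0%:Z) = 0.
      by rewrite /F (_ : c + 0%:Z = c) ?subrr ?normr0 ?mulr0//; lia.
    rewrite big_ord_recl Fc add0r.
    apply: le_trans (_ : \sum_(k < n) G (c + k%:Z) <= _).
      by apply: le_trans (right n); rewrite lerDl mulr_ge0.
    by rewrite big_ord_recr /= lerDl.
  by apply: le_trans (left n); rewrite lerDl mulr_ge0.
have Fb n : winsum F n <= t^-1 * isum G.
  apply: (@winsum_le_cwin _ c) => // k; rewrite ler_pdivlMl//.
  exact: le_trans (Fwin k) (cwin_le_isum _ _ G0 hs).
have Fs : isummable F := isummable_ge0 F0 Fb.
have FH j : w j * rho j * `|h j - h c| <= (`|c| + 2)%:R * F j.
  rewrite /F; have [->|jc] := eqVneq j c; first by rewrite subrr normr0 !mulr0.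
  have -> : (`|c| + 2)%:R * (w j * (`|(j - c)%R|%N)%:R * `|h j - h c|) =
    w j * ((`|c| + 2)%:R * (`|(j - c)%R|%N)%:R) * `|h j - h c| by ring.
  by rewrite ler_wpM2r// ler_wpM2l// rc.
have H0 j : 0 <= w j * rho j * `|h j - h c| by rewrite !mulr_ge0// rho_ge0.
have cFs := isummableZ (`|c| + 2)%:R Fs.
have Hs := isummable_ler H0 FH cFs.
split=> //; apply: le_trans (ler_isum Hs cFs FH) _.
rewrite isumZ// -mulrA ler_wpM2l//; exact: isum_le.
Qed.

(** [hardy1] is applied to an antidifference F of the squared differences; the weight rho gained
    there absorbs the factor |j - c| of [fdiff_sqr_le]. *)
Lemma hardy2 : exists c K, [/\ 0 <= K &
  forall h : int -> R, isummable (fun j => w' j * fdiff h j ^+ 2) ->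
    isummable (fun j => w j * (h j - h c) ^+ 2) /\
    isum (fun j => w j * (h j - h c) ^+ 2) <=
      K * isum (fun j => w' j * fdiff h j ^+ 2)].
Proof.
have [c [K [K0 HK]]] := hardy1.
exists c, ((`|c| + 1)%:R * K); split=> [|h hs]; first by rewrite mulr_ge0.
pose F := asum (fun j => fdiff h j ^+ 2).
have FE : (fun j => w' j * `|fdiff F j|) = (fun j => w' j * fdiff h j ^+ 2).
  by apply/funext => j; rewrite fdiff_asum ger0_norm ?sqr_ge0.
have [Fs Fle] := HK F (eq_isummable (fun j => esym (congr1 (@^~ j) FE)) hs).
have HF j : w j * (h j - h c) ^+ 2 <= (`|c| + 1)%:R * (w j * rho j * `|F j - F c|).
  have -> : (`|c| + 1)%:R * (w j * rho j * `|F j - F c|) =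
    w j * ((`|c| + 1)%:R * rho j * `|F j - F c|) by ring.
  rewrite ler_wpM2l//; apply: le_trans (fdiff_sqr_le c j (fdiff_asum _)) _.
  rewrite ler_wpM2r//.
  by rewrite /rho -natrM ler_nat; nia.
have H0 j : 0 <= w j * (h j - h c) ^+ 2 by rewrite mulr_ge0 ?sqr_ge0.
have cFs := isummableZ (`|c| + 1)%:R Fs.
have Hs := isummable_ler H0 HF cFs.
split=> //; apply: le_trans (ler_isum Hs cFs HF) _.
by rewrite isumZ// -mulrA ler_wpM2l// -FE.
Qed.

End Hardy.

(** * Weights of a Cumulative Ord distribution *)

HB.lock Definition wgt (R : realType) (delta beta gamma : R) (p : int -> R)
  (k : nat) (j : int) : R := rising (quad delta beta gamma) k j * p j.

Section Weights.
Context (R : realType) (mu delta beta gamma : R).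
Implicit Types (p f g h : int -> R).
Local Notation q := (quad delta beta gamma).

(** All that the analysis takes from the distribution. [co_rec] is the difference of the defining
    cumulative identity at j and j - 1; the sign conditions on q p are what differencing loses. *)
Record co_pmf p : Prop := CoPmf {
  co_ge0 : forall j, 0 <= p j;
  co_rec : forall j, (q j + j%:~R - mu) * p j = q (j - 1) * p (j - 1);
  co_qp_ge0 : forall j, 0 <= q j * p j;
  co_qp_gt0 : forall x y j, 0 < p x -> 0 < p y -> x <= j -> j < y -> 0 < q j * p j;
  co_moment1 : isummable (fun j => rho R j * p j);
  co_bounded : delta <= 0 \/ exists N : nat, forall j, (N <= `|j|)%N -> p j = 0
}.

Variables (p : int -> R) (hp : co_pmf p).

Local Notation wgt := (wgt delta beta gamma p).

Lemma wgtE k j : wgt k j = rising q k j * p j.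
Proof. by rewrite wgt.unlock. Qed.

Lemma wgt0 j : wgt 0 j = p j.
Proof. by rewrite !wgtE /rising big_geq// mul1r. Qed.

Lemma risingS f k j : rising f k.+1 j = rising f k j * f (j + k%:Z).
Proof. by rewrite /rising big_nat_recr. Qed.

Lemma wgtS k j : wgt k.+1 j = wgt k j * q (j + k%:Z).
Proof. by rewrite !wgtE risingS mulrAC. Qed.

Lemma wgt_pred k j : wgt k.+1 (j - 1) = wgt k j * (q j + j%:~R - mu).
Proof.
rewrite !wgtE /rising big_nat_recl//= addr0 mulrAC -(co_rec hp).
have -> : \prod_(0 <= i < k) q (j - 1 + i.+1%:Z) = \prod_(0 <= i < k) q (j + i%:Z).
  by apply: eq_bigr => i _; congr (q _); lia.
ring.
Qed.

Lemma wgt_succ k j : wgt k.+1 j = wgt k (j + 1) * (q (j + 1) + (j + 1)%:~R - mu).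
Proof. by rewrite -wgt_pred addrK. Qed.

(** The two halves need each other: the sign of the next factor q(j + k) is known only where p(j +
    k) is positive, and the second half provides that. *)
Lemma wgt_ge0_end k j : 0 <= wgt k j /\ (wgt k j != 0 -> 0 < p (j + k%:Z)).
Proof.
elim: k => [|k [IH1 IH2]].
  by rewrite wgt0 addr0; split; [exact: co_ge0|rewrite lt_def co_ge0// andbT].
have qpos : wgt k j != 0 -> q (j + k%:Z) != 0 ->
    0 < q (j + k%:Z) /\ 0 < p (j + k.+1%:Z).
  move=> /IH2 pk qk.
  have qp : 0 < q (j + k%:Z) * p (j + k%:Z).
    by rewrite lt_def co_qp_ge0// andbT mulf_neq0// gt_eqF.
  split; first by rewrite -(pmulr_lgt0 _ pk).
  have := co_rec hp (j + k.+1%:Z).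
  rewrite (_ : j + k.+1%:Z - 1 = j + k%:Z); last by lia.
  move=> E; rewrite lt_def (co_ge0 hp) andbT; apply/eqP => p0.
  by move: qp; rewrite -E p0 mulr0 ltxx.
split.
  rewrite wgtS; have [->|w0] := eqVneq (wgt k j) 0; first by rewrite mul0r.
  have [->|q0] := eqVneq (q (j + k%:Z)) 0; first by rewrite mulr0.
  by case: (qpos w0 q0) => qk _; rewrite mulr_ge0// ltW.
by rewrite wgtS mulf_eq0 negb_or => /andP[w0 q0]; case: (qpos w0 q0).
Qed.

Lemma wgt_ge0 k j : 0 <= wgt k j. Proof. by case: (wgt_ge0_end k j). Qed.

Lemma wgt_gt0_start k j : 0 < wgt k j -> 0 < p j.
Proof.
move=> w0; rewrite lt_def (co_ge0 hp) andbT; apply/eqP => p0.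
by move: w0; rewrite wgtE p0 mulr0 ltxx.
Qed.

Lemma wgt_gt0_end k j : 0 < wgt k j -> 0 < p (j + k%:Z).
Proof. by move=> w0; case: (wgt_ge0_end k j) => _; apply; rewrite gt_eqF. Qed.

Lemma q_gt0_between x y j : 0 < p x -> 0 < p y -> x <= j -> j < y -> 0 < q j.
Proof.
move=> px py xj jy; have := co_qp_gt0 hp px py xj jy.
by have := co_ge0 hp j; rewrite le_eqVlt => /predU1P[<-|/pmulr_lgt0 ->//]; rewrite mulr0 ltxx.
Qed.

Lemma p_gt0_between x y j : 0 < p x -> 0 < p y -> x <= j -> j <= y -> 0 < p j.
Proof.
move=> px py xj; rewrite le_eqVlt => /predU1P[->//|jy].
have := co_qp_gt0 hp px py xj jy; rewrite lt_def mulf_eq0 negb_or => /andP[/andP[_ pj] _].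
by rewrite lt_def pj co_ge0.
Qed.

(** Together with [wgt_gt0_start] and [wgt_gt0_end]: W_k is positive exactly where both j and j + k
    belong to the support of p. *)
Lemma wgt_gt0 x y k j : 0 < p x -> 0 < p y -> x <= j -> j + k%:Z <= y -> 0 < wgt k j.
Proof.
move=> px py xj jy; rewrite wgtE; apply: mulr_gt0; last by apply: (p_gt0_between px py); lia.
rewrite /rising big_mkord; apply: prodr_gt0 => i _.
by apply: (q_gt0_between px py); have := ltn_ord i; lia.
Qed.

Lemma wgt_gt0_between k x y j : 0 < wgt k x -> 0 < wgt k y -> x <= j -> j < y ->
  0 < wgt k.+1 j.
Proof.
move=> /wgt_gt0_start px /wgt_gt0_end py xj jy.
by apply: (wgt_gt0 px py) => //; lia.
Qed.

(* If delta > 0, let x and y be the endpoints of the support: q (y) = 0 and q (x) + x = mu,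
   whereas q (y - 1) and q (x + 1) + (x + 1) - mu are positive; their sum is
   1 - 2 (y - x - 1) delta *)
Lemma delta_bound k j (l : nat) : 0 < wgt k j -> (l.+2 <= k.*2)%N -> 0 < 1 - l%:R * delta.
Proof.
move=> w0 lk; case: (co_bounded hp) => [d0|[N Nfin]].
  by rewrite subr_gt0 (le_lt_trans _ (@ltr01 R))// mulr_ge0_le0.
have [d0|d0] := leP delta 0.
  by rewrite subr_gt0 (le_lt_trans _ (@ltr01 R))// mulr_ge0_le0.
have pj := wgt_gt0_start w0; have pjk := wgt_gt0_end w0.
have ext (e x : int) : `|e|%N = 1%N -> 0 < p x ->
    exists n : nat, 0 < p (x + e * n%:Z) /\ p (x + e * n.+1%:Z) = 0.
  move=> e1 px; have : exists n : nat, p (x + e * n.+1%:Z) == 0.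
    exists (N + `|x|)%N; apply/eqP; apply: Nfin.
    have [->|->] : e = 1 \/ e = -1 by lia.
      lia.
    lia.
  move=> /ex_minnP[n /eqP pn nmin]; exists n; split=> //.
  case: n pn nmin => [|n] pn nmin; first by rewrite mulr0 addr0.
  rewrite lt_def (co_ge0 hp) andbT; apply/negP => /nmin; lia.
have [a [pa pa0]] := ext (-1) j erefl pj.
have [b [pb pb0]] := ext 1 (j + k%:Z) erefl pjk.
set x := j + -1 * a%:Z in pa; set y := j + k%:Z + 1 * b%:Z in pb.
have xE : j + -1 * a.+1%:Z = x - 1 by rewrite /x; lia.
have yE : j + k%:Z + 1 * b.+1%:Z = y + 1 by rewrite /y; lia.
rewrite xE in pa0; rewrite yE in pb0.
have qx : q x + x%:~R - mu = 0.
  have := co_rec hp x; rewrite pa0 mulr0 => /eqP.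
  by rewrite mulf_eq0 (gt_eqF pa) orbF => /eqP.
have qy : q y = 0.
  have := co_rec hp (y + 1); rewrite addrK pb0 mulr0 => /esym/eqP.
  by rewrite mulf_eq0 (gt_eqF pb) orbF => /eqP.
have xy : x < y by rewrite /x /y; lia.
have q1 : 0 < q (y - 1) by apply: (q_gt0_between pa pb); lia.
have q2 : 0 < q (x + 1) + (x + 1)%:~R - mu.
  have : 0 < q x * p x by apply: (co_qp_gt0 hp pa pb); lia.
  have := co_rec hp (x + 1); rewrite addrK => <-.
  by rewrite pmulr_lgt0//; apply: (p_gt0_between pa pb); lia.
have E : q (y - 1) + (q (x + 1) + (x + 1)%:~R - mu) = 1 - (2 * (y - x - 1)%:~R) * delta.
  have -> : q (y - 1) = q (y - 1) - q y by rewrite qy subr0.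
  have -> : q (x + 1) + (x + 1)%:~R - mu =
    q (x + 1) + (x + 1)%:~R - mu - (q x + x%:~R - mu) by rewrite qx subr0.
  by rewrite /quad !rmorphB !rmorphD /= !rmorphN /= !rmorph1; ring.
have : 0 < 1 - (2 * (y - x - 1)%:~R) * delta by rewrite -E addr_gt0.
(* Since y - x >= k, the hypothesis on l gives l <= 2 k - 2 <= 2 (y - x - 1). *)
rewrite !subr_gt0; apply: le_lt_trans; rewrite ler_pM2r//.
have -> : l%:R = (l%:Z)%:~R :> R by rewrite -pmulrn.
have -> : 2 * (y - x - 1)%:~R = (2 * (y - x - 1))%:~R :> R by rewrite rmorphM.
by rewrite ler_int /x /y; lia.
Qed.

(** One level costs one power of rho although q is quadratic. Only an upper bound on q is needed, as
    W_k is nonnegative: for delta <= 0 the quadratic term helps, and otherwise the support is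
    bounded. *)
Lemma q_growth k : exists2 C, 0 <= C & forall j, wgt k.+1 j <= C * rho R j * wgt k j.
Proof.
have [A A0 HA] : exists2 A, 0 <= A & forall j, p j != 0 ->
    delta * (j + k%:Z)%:~R ^+ 2 <= A * rho R j.
  case: (co_bounded hp) => [d0|[N Nfin]].
    exists 0 => // j _; rewrite mul0r mulr_le0_ge0//; exact: sqr_ge0.
  exists (`|delta| * (N + k)%:R ^+ 2); first by rewrite mulr_ge0 ?exprn_ge0.
  move=> j pj; have jN : (`|j| < N)%N.
    by rewrite ltnNge; apply: contra pj => /Nfin ->.
  apply: le_trans (_ : `|delta| * (N + k)%:R ^+ 2 <= _); last first.
    by rewrite ler_peMr ?rho_ge1// mulr_ge0 ?exprn_ge0.
  apply: le_trans (ler_norm _) _; rewrite normrM ler_wpM2l// normrX.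
  rewrite lerXn2r ?nnegrE// -intr_norm -abszE -pmulrn ler_nat; lia.
exists (A + (`|beta| + `|gamma|) * k.+1%:R) => [|j].
  by rewrite addr_ge0// mulr_ge0// addr_ge0.
have [p0|p0] := eqVneq (p j) 0; first by rewrite !wgtE p0 !mulr0.
rewrite wgtS mulrC ler_wpM2r ?wgt_ge0// /quad mulrDl -addrA lerD ?HA//.
have r1 : `|(j + k%:Z)%:~R : R| <= k.+1%:R * rho R j.
  exact: le_trans (abs_le_rho _ _) (rho_shift _ _ _).
have r2 : 1 <= k.+1%:R * rho R j by rewrite mulr_ege1 ?rho_ge1// ler1n.
rewrite -mulrA mulrDl; apply: lerD.
  by apply: le_trans (ler_norm _) _; rewrite normrM ler_wpM2l.
by apply: le_trans (ler_norm _) _; rewrite ler_peMr.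
Qed.

End Weights.

(** * Moments, Hardy descent between levels, and summation by parts *)

Section Integrability.
Context (R : realType) (mu delta beta gamma : R) (p : int -> R).
Hypothesis hp : co_pmf mu delta beta gamma p.
Implicit Types (f g h u v : int -> R).
Local Notation q := (quad delta beta gamma).
Local Notation W := (wgt delta beta gamma p).
Local Notation D := (steinD mu delta beta gamma).
Local Notation Dn := (steinDn mu delta beta gamma).

Let W_ge0 k j : 0 <= W k j. Proof. exact: wgt_ge0 hp k j. Qed.

(** Adjointness before summation: weighted by W_k, D_k v is a backward difference of W_(k+1) v up to
    sign, so sums by parts telescope. *)
Lemma wgt_steinD k v j :
  W k j * D k v j = W k.+1 (j - 1) * v (j - 1) - W k.+1 j * v j.
Proof. by rewrite (wgt_pred hp) wgtS /steinD; ring. Qed.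

(** The hypothesis [ww'] of the Hardy inequalities for w = W_k and w' = W_(k+1), with r = 1 - 2 k
    delta. *)
Lemma wgt_slope k j : W k.+1 (j - 1) - W k.+1 j =
  W k j * ((1 - (k + k)%:R * delta) * j%:~R - (mu + delta * k%:R ^+ 2 + beta * k%:R)).
Proof. by rewrite (wgt_pred hp) wgtS /quad rmorphD /= -pmulrn natrD; ring. Qed.

Lemma level_hardy1 k : 0 < 1 - (k + k)%:R * delta -> exists c K, [/\ 0 <= K &
  forall h : int -> R, isummable (fun j => W k.+1 j * `|fdiff h j|) ->
    isummable (fun j => W k j * rho R j * `|h j - h c|) /\
    isum (fun j => W k j * rho R j * `|h j - h c|) <=
      K * isum (fun j => W k.+1 j * `|fdiff h j|)].
Proof. by move=> r0; apply: hardy1 r0 (wgt_slope k) => j; exact: W_ge0. Qed.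

Lemma level_hardy2 k : 0 < 1 - (k + k)%:R * delta -> exists c K, [/\ 0 <= K &
  forall h : int -> R, isummable (fun j => W k.+1 j * fdiff h j ^+ 2) ->
    isummable (fun j => W k j * (h j - h c) ^+ 2) /\
    isum (fun j => W k j * (h j - h c) ^+ 2) <=
      K * isum (fun j => W k.+1 j * fdiff h j ^+ 2)].
Proof. by move=> r0; apply: hardy2 r0 (wgt_slope k) => j; exact: W_ge0. Qed.

Lemma ler_rhoX (j : int) (a b : nat) : (a <= b)%N -> rho R j ^+ a <= rho R j ^+ b.
Proof. by move=> ab; apply: ler_weXn2l => //; apply: rho_ge1. Qed.

(** Bootstrapping with the Hardy inequality at level 0, whose rate is 1 for every delta. For h =
    rho^(a+1), Delta loses a power and W_1 costs one, so W_1 |Delta h| is controlled by p rho^(a+1),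
    while the conclusion controls p rho^(a+2). *)
Lemma moments a : isummable (fun j => p j * rho R j ^+ a).
Proof.
have p0 j : 0 <= p j by exact: co_ge0 hp j.
have m1 : isummable (fun j => p j * rho R j ^+ 1).
  by apply: eq_isummable (co_moment1 hp) => j; rewrite expr1 mulrC.
have X0 b j : 0 <= p j * rho R j ^+ b by rewrite mulr_ge0// ?exprn_ge0 ?rho_ge0 ?W_ge0.
case: a => [|a].
  apply: isummable_ler (X0 _) _ m1 => j.
  by rewrite ler_wpM2l// ler_rhoX.
elim: a => [//|a IH].
have r0 : 0 < 1 - (0 + 0)%:R * delta by rewrite mul0r subr0.
have [c [K [K0 HK]]] := level_hardy1 r0.
have [C C0 HC] := rho_exp_diff R a.
have [B B0 HB] := q_growth hp 0.
have [|s _] := HK (fun j => rho R j ^+ a.+1).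
  apply: isummable_ler (isummableZ (B * C) IH) => j; first by rewrite mulr_ge0.
  apply: le_trans (ler_pM (W_ge0 _ _) (normr_ge0 _) (HB j) (HC j)) _.
  by rewrite wgt0 exprS le_eqVlt; apply/orP; left; apply/eqP; ring.
apply: isummable_ler (X0 _) _ (isummableD s (isummableZ (rho R c ^+ a.+1) m1)) => j.
rewrite wgt0 exprS.
have -> : rho R c ^+ a.+1 * (p j * rho R j ^+ 1) = p j * rho R j * rho R c ^+ a.+1.
  by rewrite expr1; ring.
rewrite mulrA -mulrDr ler_wpM2l ?mulr_ge0 ?rho_ge0//.
by rewrite -lerBlDr ler_norm.
Qed.

Lemma wgt_growth k : exists2 C, 0 <= C &
  forall j, W k j <= C * rho R j ^+ k * p j.
Proof.
elim: k => [|k [C C0 IH]].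
  by exists 1 => // j; rewrite wgt0 expr0 !mul1r.
have [B B0 HB] := q_growth hp k.
exists (B * C) => [|j]; first by rewrite mulr_ge0.
apply: le_trans (HB j) _.
have -> : B * C * rho R j ^+ k.+1 * p j = B * rho R j * (C * rho R j ^+ k * p j).
  by rewrite exprS; ring.
by rewrite ler_wpM2l// mulr_ge0// rho_ge0.
Qed.

Lemma wgt_moments k a : isummable (fun j => W k j * rho R j ^+ a).
Proof.
have [C C0 HC] := wgt_growth k.
apply: isummable_ler (isummableZ C (moments (k + a))) => j.
  by rewrite mulr_ge0// ?exprn_ge0 ?rho_ge0 ?W_ge0.
have -> : C * (p j * rho R j ^+ (k + a)) = C * rho R j ^+ k * p j * rho R j ^+ a.
  by rewrite exprD; ring.
by rewrite ler_wpM2r// ?exprn_ge0 ?rho_ge0 ?W_ge0.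
Qed.

Lemma wgt_summable k : isummable (W k).
Proof.
by apply: eq_isummable (wgt_moments k 0) => j; rewrite expr0 mulr1.
Qed.

(* f integrates polynomials of degree a against the weight W k *)
Definition wint1 k a f := isummable (fun j => W k j * rho R j ^+ a * `|f j|).

Definition wint2 k f := isummable (fun j => W k j * f j ^+ 2).

Lemma wint1_le k a b f : (a <= b)%N -> wint1 k b f -> wint1 k a f.
Proof.
move=> ab; apply: isummable_ler => j.
  by rewrite !mulr_ge0// ?exprn_ge0 ?rho_ge0 ?W_ge0.
by rewrite ler_wpM2r// ler_wpM2l// ler_rhoX.
Qed.

Lemma wint2_int1 k a f : wint2 k f -> wint1 k a f.
Proof.
move=> f2; apply: isummable_ler (isummableD (wgt_moments k (a + a)) f2) => j.
  by rewrite !mulr_ge0// ?exprn_ge0 ?rho_ge0 ?W_ge0.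
rewrite -mulrA -mulrDr ler_wpM2l// exprD -[f j ^+ 2]real_normK ?num_real//.
have := sqr_ge0 (rho R j ^+ a - `|f j|).
have := sqr_ge0 (rho R j ^+ a + `|f j|).
set x := rho R j ^+ a; set y := `|f j|; nra.
Qed.

Lemma wint1_fin k a f : fin_supp f -> wint1 k a f.
Proof.
move=> [N fN]; apply: isummable_fin_supp; exists N => j /fN ->.
by rewrite normr0 mulr0.
Qed.

Lemma wint2_fin k f : fin_supp f -> wint2 k f.
Proof.
by move=> [N fN]; apply: isummable_fin_supp; exists N => j /fN ->; rewrite expr0n mulr0.
Qed.

Lemma wint1_raise k a f : wint1 k a.+1 f -> wint1 k.+1 a f.
Proof.
have [B B0 HB] := q_growth hp k.
move=> /(isummableZ B); apply: isummable_ler => j.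
  by rewrite !mulr_ge0// ?exprn_ge0 ?rho_ge0 ?W_ge0.
have -> : B * (W k j * rho R j ^+ a.+1 * `|f j|) = B * rho R j * W k j * rho R j ^+ a * `|f j|.
  by rewrite exprS; ring.
by rewrite ler_wpM2r// ler_wpM2r// ?exprn_ge0 ?rho_ge0 ?W_ge0.
Qed.

(** Induction on a: the Hardy inequality is applied to rho^(a+1) f. The product rule leaves a term
    with W_(k+1) rho^a |f|, which the previous case bounds through [wint1_raise]. *)
Lemma wint1_descent k a f : 0 < 1 - (k + k)%:R * delta ->
  wint1 k.+1 a (fdiff f) -> wint1 k a.+1 f.
Proof.
move=> r0; have [c [K [K0 HK]]] := level_hardy1 r0.
have rX0 j b : 0 <= rho R j ^+ b by rewrite ?exprn_ge0 ?rho_ge0 ?W_ge0.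
elim: a => [|a IH] fs.
  have [|s _] := HK f; first by apply: eq_isummable fs => j; rewrite expr0 mulr1.
  apply: isummable_ler (isummableD s (isummableZ `|f c| (wgt_moments k 1))) => j.
    by rewrite !mulr_ge0 ?rho_ge0.
  have -> : `|f c| * (W k j * rho R j ^+ 1) = W k j * rho R j * `|f c|.
    by rewrite expr1; ring.
  rewrite expr1 -mulrDr ler_wpM2l ?mulr_ge0 ?rho_ge0//.
  by rewrite -{1}(subrK (f c) (f j)) ler_normD.
have fa : wint1 k a.+1 f by apply: IH; apply: wint1_le fs.
have fa' := wint1_raise fa.
have [C C0 HC] := rho_exp_diff R a.
pose H j := rho R j ^+ a.+1 * f j.
have dH j : `|fdiff H j| <= 2 ^+ a.+1 * rho R j ^+ a.+1 * `|fdiff f j| + C * rho R j ^+ a * `|f j|.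
  have -> : fdiff H j = rho R (j + 1) ^+ a.+1 * fdiff f j
      + (rho R (j + 1) ^+ a.+1 - rho R j ^+ a.+1) * f j by rewrite /fdiff /H; ring.
  apply: le_trans (ler_normD _ _) _; rewrite !normrM; apply: lerD.
    rewrite ler_wpM2r// ger0_norm// -exprMn lerXn2r ?nnegrE ?mulr_ge0 ?rho_ge0//.
    exact: rho_shift j 1.
  by rewrite ler_wpM2r.
have [|s _] := HK H.
  apply: isummable_ler (isummableD (isummableZ (2 ^+ a.+1) fs) (isummableZ C fa')) => j.
    by rewrite mulr_ge0.
  apply: le_trans (ler_wpM2l (W_ge0 _ _) (dH j)) _.
  by rewrite le_eqVlt; apply/orP; left; apply/eqP; ring.
apply: isummable_ler (isummableD s (isummableZ `|H c| (wgt_moments k 1))) => j.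
  by rewrite mulr_ge0// mulr_ge0.
have -> : `|H c| * (W k j * rho R j ^+ 1) = W k j * rho R j * `|H c|.
  by rewrite expr1; ring.
have -> : W k j * rho R j ^+ a.+2 * `|f j| = W k j * rho R j * `|H j|.
  by rewrite /H normrM (ger0_norm (rX0 _ _)) exprS; ring.
rewrite -mulrDr ler_wpM2l ?mulr_ge0 ?rho_ge0//.
by rewrite -{1}(subrK (H c) (H j)) ler_normD.
Qed.

Lemma sqr_le2 (x y : R) : x ^+ 2 <= 2 * (x - y) ^+ 2 + 2 * y ^+ 2.
Proof. have := sqr_ge0 (x - y - y); nra. Qed.

Lemma wint2_descent k f : 0 < 1 - (k + k)%:R * delta ->
  wint2 k.+1 (fdiff f) -> wint2 k f.
Proof.
move=> r0 fs; have [c [K [K0 HK]]] := level_hardy2 r0.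
have [s _] := HK f fs.
apply: isummable_ler (isummableD (isummableZ 2 s)
  (isummableZ (2 * f c ^+ 2) (wgt_summable k))) => j.
  by rewrite mulr_ge0 ?sqr_ge0.
apply: le_trans (ler_wpM2l (W_ge0 _ _) (sqr_le2 (f j) (f c))) _.
by rewrite le_eqVlt; apply/orP; left; apply/eqP; ring.
Qed.

Lemma wint2_linear k c f g : wint2 k f -> wint2 k g -> wint2 k (c *: f + g).
Proof.
move=> f2 g2.
apply: isummable_ler (isummableD (isummableZ (2 * c ^+ 2) f2) (isummableZ 2 g2)) => j.
  by rewrite mulr_ge0 ?sqr_ge0.
rewrite !fctE /GRing.scale /=.
apply: le_trans (ler_wpM2l (W_ge0 _ _) (_ : _ <= 2 * (c * f j) ^+ 2 + 2 * g j ^+ 2)) _.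
  by have := sqr_ge0 (c * f j - g j); nra.
by rewrite le_eqVlt; apply/orP; left; apply/eqP; ring.
Qed.

Lemma wint2_mul k f g : wint2 k f -> wint2 k g ->
  isummable (fun j => W k j * (f j * g j)).
Proof.
move=> f2 g2; apply: isummable_le (isummableD f2 g2) => j.
rewrite normrM (ger0_norm (W_ge0 _ _)) -mulrDr.
rewrite [leRHS]ger0_norm; last by rewrite mulr_ge0// addr_ge0 ?sqr_ge0.
rewrite ler_wpM2l// ler_norml; have := sqr_ge0 (f j - g j).
by have := sqr_ge0 (f j + g j); nra.
Qed.

(* v has degree at most a where W k does not vanish *)
Definition wbound k a v := exists2 C, 0 <= C &
  forall j, W k j * `|v j| <= C * rho R j ^+ a * W k j.

Lemma wbound1 k : wbound k 0 (fun=> 1).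
Proof. by exists 1 => // j; rewrite normr1 expr0 !mulr1 mul1r. Qed.

Lemma wgt_growth_pred k : exists2 C, 0 <= C &
  forall j, W k.+1 (j - 1) <= C * rho R j * W k j.
Proof.
have [B B0 HB] := q_growth hp k.
pose A := `|1 - (k + k)%:R * delta| + `|mu + delta * k%:R ^+ 2 + beta * k%:R|.
exists (B + A) => [|j]; first by rewrite addr_ge0// addr_ge0.
have -> : W k.+1 (j - 1) = W k.+1 j + (W k.+1 (j - 1) - W k.+1 j) by ring.
rewrite wgt_slope; set x := 1 - _; set y := mu + _ + _.
have -> : (B + A) * rho R j * W k j = B * rho R j * W k j + W k j * (A * rho R j) by ring.
rewrite lerD// ler_wpM2l// /A -/x -/y [leRHS]mulrDl.
apply: le_trans (ler_norm _) _; apply: le_trans (ler_normB _ _) _.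
rewrite normrM; apply: lerD; first by rewrite ler_wpM2l ?abs_le_rho.
by rewrite ler_peMr ?rho_ge1.
Qed.

(** The coefficients of D_k may be quadratic, yet the degree rises by one only: in the form
    [wgt_steinD] each weight W_(k+1), shifted or not, costs a single power of rho against W_k. *)
Lemma wbound_steinD k a v : wbound k.+1 a v -> wbound k a.+1 (D k v).
Proof.
move=> [C C0 HC]; have [A A0 HA] := wgt_growth_pred k.
have [B B0 HB] := q_growth hp k.
exists (C * 2 ^+ a * A + C * B) => [|j].
  by rewrite addr_ge0// mulr_ge0// mulr_ge0// exprn_ge0.
rewrite -{1}(ger0_norm (W_ge0 k j)) -normrM wgt_steinD.
apply: le_trans (ler_normB _ _) _; rewrite !normrM !(ger0_norm (W_ge0 _ _)) !mulrDl.
have rX0 i b : 0 <= rho R i ^+ b by rewrite ?exprn_ge0 ?rho_ge0 ?W_ge0.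
apply: lerD.
  apply: le_trans (HC _) _.
  have -> : C * 2 ^+ a * A * rho R j ^+ a.+1 * W k j =
    (C * (2 * rho R j) ^+ a) * (A * rho R j * W k j) by rewrite exprS exprMn; ring.
  apply: ler_pM => //; first by rewrite mulr_ge0.
  rewrite ler_wpM2l// lerXn2r ?nnegrE ?mulr_ge0 ?rho_ge0//.
  by rewrite /rho -natrM ler_nat; lia.
apply: le_trans (HC _) _.
have -> : C * B * rho R j ^+ a.+1 * W k j =
    (C * rho R j ^+ a) * (B * rho R j * W k j) by rewrite exprS; ring.
by rewrite ler_wpM2l// mulr_ge0.
Qed.

Lemma wbound_steinDn k a i v : wbound (k + i) a v -> wbound k (a + i) (Dn k i v).
Proof.
elim: i k => [|i IH] k /=; first by rewrite !addn0.
by rewrite -addSnnS addnS => /IH /wbound_steinD.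
Qed.

Lemma wint1_bound k a f v : wint1 k a f -> wbound k a v ->
  isummable (fun j => W k j * (f j * v j)).
Proof.
move=> fs [C C0 HC]; apply: isummable_le (isummableZ C fs) => j.
have rX0 i b : 0 <= rho R i ^+ b by rewrite ?exprn_ge0 ?rho_ge0 ?W_ge0.
rewrite [leRHS]ger0_norm; last by rewrite !mulr_ge0.
rewrite !normrM (ger0_norm (W_ge0 _ _)).
have -> : W k j * (`|f j| * `|v j|) = `|f j| * (W k j * `|v j|) by ring.
have -> : C * (W k j * rho R j ^+ a * `|f j|) = `|f j| * (C * rho R j ^+ a * W k j).
  by ring.
by rewrite ler_wpM2l.
Qed.

Lemma wbound_wint2 k a v : wbound k a v -> wint2 k v.
Proof.
move=> [C C0 HC].
have rX0 i b : 0 <= rho R i ^+ b by rewrite ?exprn_ge0 ?rho_ge0 ?W_ge0.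
apply: isummable_ler (isummableZ (C ^+ 2) (wgt_moments k (a + a))) => j.
  by rewrite mulr_ge0 ?sqr_ge0.
have [->|w0] := eqVneq (W k j) 0; first by rewrite !mul0r mulr0.
have w1 : 0 < W k j by rewrite lt_def w0 W_ge0.
have := HC j; rewrite mulrC ler_pM2r// => vC.
have -> : C ^+ 2 * (W k j * rho R j ^+ (a + a)) = W k j * (C * rho R j ^+ a) ^+ 2.
  by rewrite exprD; ring.
rewrite ler_wpM2l// -[v j ^+ 2]real_normK ?num_real// lerXn2r ?nnegrE//.
by rewrite mulr_ge0.
Qed.

Definition ip k f g : R := isum (fun j => W k j * (f j * g j)).

Lemma ibp k f v :
  isummable (fun j => W k j * (f j * D k v j)) ->
  isummable (fun j => W k.+1 j * (fdiff f j * v j)) ->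
  isummable (fun j => W k.+1 j * (f j * v j)) ->
  ip k f (D k v) = ip k.+1 (fdiff f) v.
Proof.
move=> s1 s2 s3; apply/eqP; rewrite -subr_eq0 -isumB//; apply/eqP.
rewrite -[RHS](isum_telescope (isummableD s3 s2)); apply: eq_isum => j.
have -> : W k j * (f j * D k v j) = f j * (W k j * D k v j) by ring.
by rewrite wgt_steinD /fdiff subrK; ring.
Qed.

Lemma ibp_wint k a f v : 0 < 1 - (k + k)%:R * delta ->
  wint1 k.+1 a (fdiff f) -> wbound k.+1 a v -> ip k f (D k v) = ip k.+1 (fdiff f) v.
Proof.
move=> r0 fs vb; have f1 := wint1_descent r0 fs; apply: ibp.
- exact: wint1_bound f1 (wbound_steinD vb).
- exact: wint1_bound fs vb.
- exact: wint1_bound (wint1_raise f1) vb.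
Qed.

Lemma wint1_fdiffn_descent k a i f :
  (forall l, (k <= l < k + i)%N -> 0 < 1 - (l + l)%:R * delta) ->
  wint1 (k + i) a (fdiffn i f) -> wint1 k (a + i) f.
Proof.
elim: i k f => [|i IH] k f r0; first by rewrite !addn0.
rewrite fdiffnS -addSnnS addnS => fs; apply: wint1_descent.
  by apply: r0; lia.
by apply: IH fs => l kl; apply: r0; lia.
Qed.

Lemma ibpn_wint k a i f v :
  (forall l, (k <= l < k + i)%N -> 0 < 1 - (l + l)%:R * delta) ->
  wint1 (k + i) a (fdiffn i f) -> wbound (k + i) a v ->
  ip k f (Dn k i v) = ip (k + i) (fdiffn i f) v.
Proof.
elim: i k f => [|i IH] k f r0; first by rewrite !addn0.
rewrite -addSnnS fdiffnS => fs vb /=.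
rewrite -IH//; last by move=> l kl; apply: r0; lia.
apply: (@ibp_wint _ (a + i)); first by apply: r0; lia.
  by apply: wint1_fdiffn_descent fs => l kl; apply: r0; lia.
exact: wbound_steinDn vb.
Qed.

Lemma fin_supp_steinD k u : fin_supp u -> fin_supp (D k u).
Proof.
move=> us; apply: fin_suppD; first exact: fin_supp_mull (fin_supp_shift (-1) us).
have := fin_supp_mull (fun j => - q (j + k%:Z)) us.
by congr fin_supp; apply/funext => j; rewrite mulNr.
Qed.

Lemma fin_supp_steinDn k i u : fin_supp u -> fin_supp (Dn k i u).
Proof. by elim: i k => //= i IH k us; apply: fin_supp_steinD; apply: IH. Qed.

Lemma fin_supp_sops k s u : fin_supp u -> fin_supp (sops mu delta beta gamma k s u).
Proof.
move=> us; elim: s => [//|a s IH]; rewrite sops_cons; apply: fin_suppD.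
  by apply: fin_supp_steinD; apply: fin_supp_fdiff.
exact: fin_supp_mull IH.
Qed.

Lemma isummable_ip_fin k f v : fin_supp v -> isummable (fun j => W k j * (f j * v j)).
Proof.
move=> vs; apply: isummable_fin_supp.
by apply: (fin_supp_mull (W k)); apply: fin_supp_mull.
Qed.

Lemma ibp_fin k f v : fin_supp v -> ip k f (D k v) = ip k.+1 (fdiff f) v.
Proof.
by move=> vs; apply: ibp; apply: isummable_ip_fin => //; apply: fin_supp_steinD.
Qed.

Lemma ibpn_fin k i f v : fin_supp v -> ip k f (Dn k i v) = ip (k + i) (fdiffn i f) v.
Proof.
elim: i k f => [|i IH] k f vs; first by rewrite addn0.
by rewrite /= ibp_fin ?IH -?fdiffnS ?addSnnS//; apply: fin_supp_steinDn.
Qed.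

Lemma ipC k f g : ip k f g = ip k g f.
Proof. by apply: eq_isum => j; rewrite (mulrC (f j)). Qed.

Lemma eq_ip k f f' g g' :
  (forall j, 0 < W k j -> f j = f' j /\ g j = g' j) -> ip k f g = ip k f' g'.
Proof.
move=> E; apply: eq_isum => j; have := W_ge0 k j; rewrite le_eqVlt => /predU1P[<-|w0].
  by rewrite !mul0r.
by have [-> ->] := E j w0.
Qed.

Lemma ip_ge0 k f : wint2 k f -> 0 <= ip k f f.
Proof.
move=> f2; apply: isum_ge0 => [|j]; last by rewrite -expr2 mulr_ge0 ?sqr_ge0.
by apply: eq_isummable f2 => j; rewrite expr2.
Qed.

Lemma ip_linear k c f g h : isummable (fun j => W k j * (f j * h j)) ->
  isummable (fun j => W k j * (g j * h j)) ->
  ip k (c *: f + g) h = c * ip k f h + ip k g h.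
Proof.
move=> fs gs; rewrite /ip -isumZ// -isumD//; last exact: isummableZ.
by apply: eq_isum => j; rewrite !fctE /GRing.scale /=; ring.
Qed.

End Integrability.

(** * Finitely supported functions *)

Section FiniteSupport.
Context (R : realType) (mu delta beta gamma : R) (p : int -> R).
Hypothesis hp : co_pmf mu delta beta gamma p.
Implicit Types (f g h u v z : int -> R).
Local Notation q := (quad delta beta gamma).
Local Notation W := (wgt delta beta gamma p).
Local Notation D := (steinD mu delta beta gamma).
Local Notation Dn := (steinDn mu delta beta gamma).
Local Notation sops := (sops mu delta beta gamma).
Local Notation phi := (phi mu delta beta gamma).
Local Notation ip := (ip delta beta gamma p).
Local Notation lam := (lam delta).
Local Notation lams := (lams delta).

Let W_ge0 k j : 0 <= W k j. Proof. exact: wgt_ge0 hp k j. Qed.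

(** Equality as far as <., .>_k can see it. The equation f = D_k v is solvable only in this sense,
    since W_k restricts it to an interval. *)
Definition eqw k f g := forall j, W k j != 0 -> f j = g j.

Lemma eqw_trans k f g h : eqw k f g -> eqw k g h -> eqw k f h.
Proof. by move=> fg gh j wj; rewrite fg// gh. Qed.

(** W_(k+1)(j) has both W_k(j) and W_k(j + 1) as factors, so both values entering the difference are
    covered. *)
Lemma eqw_fdiff k f g : eqw k f g -> eqw k.+1 (fdiff f) (fdiff g).
Proof.
move=> fg j wj; rewrite /fdiff !fg//; apply: contra wj => /eqP w0.
  by rewrite wgtS w0 mul0r.
by rewrite (wgt_succ hp) w0 mul0r.
Qed.

Lemma eqw_fdiffn i k f g : eqw k f g -> eqw (k + i) (fdiffn i f) (fdiffn i g).
Proof.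
elim: i k f g => [|i IH] k f g fg; first by rewrite addn0.
by rewrite !fdiffnS -addSnnS; apply: IH; apply: eqw_fdiff.
Qed.

Lemma eqw_steinD k u v : eqw k.+1 u v -> eqw k (D k u) (D k v).
Proof.
move=> uv j wj; apply: (mulfI wj); rewrite !(wgt_steinD hp).
have E i : W k.+1 i * u i = W k.+1 i * v i.
  by have [->|/uv ->//] := eqVneq (W k.+1 i) 0; rewrite !mul0r.
by rewrite !E.
Qed.

Lemma eqw_ip k f f' g g' : eqw k f f' -> eqw k g g' -> ip k f g = ip k f' g'.
Proof. by move=> E E'; apply: (eq_ip hp) => j w0; rewrite E ?E' ?gt_eqF. Qed.

Lemma ip0r k f : ip k f 0 = 0.
Proof.
rewrite -[RHS](isum0 R); apply: eq_isum => j.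
by have -> : (0 : int -> R) j = 0 by []; rewrite !mulr0.
Qed.

Lemma ip_linear_fin k z c f g : fin_supp z ->
  ip k z (c *: f + g) = c * ip k z f + ip k z g.
Proof.
move=> zs; rewrite !(ipC _ _ _ _ _ z) ip_linear//; exact: isummable_ip_fin.
Qed.

Lemma ip_sum_fin k z n (c : nat -> R) (F : nat -> int -> R) : fin_supp z ->
  ip k z (\sum_(i < n) c i *: F i) = \sum_(i < n) c i * ip k z (F i).
Proof.
move=> zs; elim: n => [|n IH]; first by rewrite !big_ord0 ip0r.
by rewrite !big_ord_recr /= addrC ip_linear_fin// IH addrC.
Qed.

Lemma ip_ge0_fin k z : fin_supp z -> 0 <= ip k z z.
Proof. by move=> zs; apply: (ip_ge0 hp); apply: wint2_fin. Qed.

Lemma ip_steinD_fdiff k f g : fin_supp f -> fin_supp g ->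
  ip k f (D k (fdiff g)) = ip k (D k (fdiff f)) g.
Proof.
move=> fs gs; rewrite (ibp_fin hp); last exact: fin_supp_fdiff.
rewrite (ipC _ _ _ _ _ _ g) (ibp_fin hp) 1?ipC//; exact: fin_supp_fdiff.
Qed.

Lemma sops_A k f : sops k [:: lam k] f = D k (fdiff f).
Proof. by rewrite sops_cons; apply/funext => j /=; rewrite subrr mul0r addr0. Qed.

(** A = D_k Delta is symmetric and nonnegative. The induction goes from i to i + 2 by moving one
    factor A to the other side, with i = 0 and i = 1 as base cases. *)
Lemma ip_A_ge0 k i z : fin_supp z -> 0 <= ip k z (sops k (nseq i (lam k)) z).
Proof.
have [n] := ubnP i; elim: n i z => // n IH [|[|i]] z ni zs.
- exact: ip_ge0_fin.
- rewrite [nseq _ _]/= sops_A (ibp_fin hp); last exact: fin_supp_fdiff.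
  by apply: ip_ge0_fin; apply: fin_supp_fdiff.
- have -> : nseq i.+2 (lam k) = [:: lam k] ++ nseq i (lam k) ++ [:: lam k].
    by rewrite -[[:: lam k]]/(nseq 1 (lam k)) -!nseqD addn1.
  rewrite !sops_cat !sops_A; set y := D k (fdiff z).
  have ys : fin_supp y by apply: fin_supp_steinD; apply: fin_supp_fdiff.
  rewrite ip_steinD_fdiff//; last exact: fin_supp_sops.
  by apply: IH => //; lia.
Qed.

(** The operator is a polynomial in A = D_k Delta with nonnegative coefficients; the exponent i
    allows the factors A + (lam_k - a) to be expanded one by one. *)
Lemma ip_sops_A_ge0 k s i z : fin_supp z -> (forall a, a \in s -> 0 <= lam k - a) ->
  0 <= ip k z (sops k (nseq i (lam k) ++ s) z).
Proof.
move=> zs; elim: s i => [|a s IH] i sa; first by rewrite cats0 ip_A_ge0.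
rewrite sops_cat sops_cons; set y := sops k s z.
have -> : (fun j => D k (fdiff y) j + (lam k - a) * y j) =
   (lam k - a) *: y + sops k [:: lam k] y.
  by rewrite sops_A; apply/funext => j; rewrite !fctE addrC.
rewrite sops_linear ip_linear_fin// addr_ge0//.
  rewrite mulr_ge0 ?sa ?mem_head// -sops_cat IH// => b bs.
  by apply: sa; rewrite in_cons bs orbT.
rewrite -sops_cat -(nseqD i 1) addn1 /y -sops_cat IH// => b bs.
by apply: sa; rewrite in_cons bs orbT.
Qed.

(** Of that polynomial in A only the constant term is kept. Its strict positivity is what later
    decides the equality case. *)
Lemma ip_sops_ge k s z : fin_supp z -> (forall a, a \in s -> 0 <= lam k - a) ->
  (\prod_(a <- s) (lam k - a)) * ip k z z <= ip k z (sops k s z).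
Proof.
move=> zs; elim: s => [|a s IH] sa; first by rewrite big_nil mul1r.
have sa' b : b \in s -> 0 <= lam k - b.
  by move=> bs; apply: sa; rewrite in_cons bs orbT.
rewrite sops_cons big_cons; set y := sops k s z.
have -> : (fun j => D k (fdiff y) j + (lam k - a) * y j) =
   (lam k - a) *: y + sops k [:: lam k] y.
  by rewrite sops_A; apply/funext => j; rewrite !fctE addrC.
rewrite ip_linear_fin// -sops_cat -mulrA.
apply: le_trans (_ : (lam k - a) * ip k z y <= _).
  by rewrite ler_wpM2l ?IH// sa ?mem_head.
by rewrite lerDl (ip_sops_A_ge0 1).
Qed.

(** The form of Q(D_0 Delta), written with differences on both sides so that it makes sense for
    functions to which the operator itself cannot be applied within the norms. The term i = 0 is <f,
    g>_0, by [nu0]. *)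
Definition bform (m n : nat) f g : R :=
  \sum_(i < n.+1) (-1) ^+ i * nu delta m n i * ip i (fdiffn i f) (fdiffn i g).

(* sop 0 conjugated by D_0 ... D_m becomes sop m.+1, so that the product of
   the factors lam_(m+1), ..., lam_(m+n) becomes D ... D Delta^n, and what is
   left over is a product of nonnegative operators *)
Lemma bform_steinDn m n u : fin_supp u ->
  (forall j, (j < m + n)%N -> 1 - j%:R * delta != 0) ->
  (\prod_(s < n) - lam (m + s.+1)) * bform m n (Dn 0 m.+1 u) (Dn 0 m.+1 u) =
  ip (m.+1 + n) (fdiffn n u) (sops (m.+1 + n) (lams 0 m.+1) (fdiffn n u)).
Proof.
move=> us nz; set f := Dn 0 m.+1 u.
have fs : fin_supp f by apply: fin_supp_steinDn.
have zs : fin_supp (fdiffn n u) by apply: fin_supp_fdiffn.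
have -> : (\prod_(s < n) - lam (m + s.+1)) * bform m n f f =
    ip 0 f (sops 0 (lams m.+1 n) f).
  rewrite /sops popl_newton//; last by move=> *; apply: sop_linear.
  rewrite -[X in ip 0 f X]addr0 ip_linear_fin// ip0r addr0; congr (_ * _).
  rewrite (ip_sum_fin 0 n.+1 (fun i => (-1) ^+ i * nu delta m n i)
    (fun i => popl (sop mu delta beta gamma 0) (lams 0 i) f) fs).
  apply: eq_bigr => i _; congr (_ * _).
  rewrite -!/(sops 0 _ _) sops_lams (ibpn_fin hp) ?add0n//.
  exact: fin_supp_fdiffn.
(* All D's pass to the left factor as differences: Delta^(m+1) D_0 ... D_m leaves the roots lam_0,
   ..., lam_m at level m + 1, and Delta^n lifts them to level m + 1 + n. *)
rewrite sops_steinDn add0n sops_lams (ibpn_fin hp); last exact: fin_supp_steinDn.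
by rewrite add0n fdiffn_steinDn (ibpn_fin hp)// fdiffn_sops add0n ipC.
Qed.

Lemma isum_fin_supp h N : (forall j, (N <= `|j|)%N -> h j = 0) ->
  isum h = winsum h N.
Proof.
move=> hN; apply: isum_unique; apply: cvg_near_cst.
near=> M; have NM : (N <= M)%N by near: M; exists N.
rewrite -(subnK NM); elim: (M - N)%N => [//|k IH].
rewrite addSn winsumS !hN ?addr0 ?IH//; lia.
Unshelve. all: by end_near. Qed.

(** F(j) sums h up to j. Total sum zero makes it vanish on the far right too, and by the last clause
    it vanishes outside the hull of the support of h, as the division by W_(k+1) in [steinD_solve]
    requires. *)
Lemma fin_supp_primitive h : fin_supp h -> isum h = 0 ->
  exists F, [/\ fin_supp F, forall j, F j - F (j - 1) = h j &
    forall j, (forall x, x <= j -> h x = 0) \/ (forall x, j < x -> h x = 0) ->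
      F j = 0].
Proof.
move=> [N hN] h0; pose G := asum h.
have GS j : G (j + 1) = G j + h j.
  by have := congr1 (@^~ j) (fdiff_asum h) => /= <-; rewrite /fdiff -/G; ring.
have Gup (t : nat) : G (N%:Z + t%:Z) = G N.
  elim: t => [|t IH]; first by rewrite addr0.
  rewrite -addn1 PoszD addrA GS IH hN ?addr0//; lia.
have Gdn (t : nat) : G (- N%:Z - t%:Z) = G (- N%:Z).
  elim: t => [|t IH]; first by rewrite subr0.
  have := GS (- N%:Z - t.+1%:Z); rewrite (_ : _ + 1 = - N%:Z - t%:Z); last by lia.
  by rewrite IH hN ?addr0//; lia.
have GN : G N = G (- N%:Z).
  apply/eqP; rewrite -subr_eq0 -h0 (isum_fin_supp hN) /winsum big_split /=.
  rewrite /G; case: (N) => [|n] /=; first by rewrite !big_ord0 subrr addr0.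
  by rewrite opprK.
pose F j := G (j + 1) - G (- N%:Z).
have Fs j : (N < `|j|)%N -> F j = 0.
  move=> Nj; apply/eqP; rewrite subr_eq0; apply/eqP.
  have [j0|j0] := leP 0 j.
    by rewrite (_ : j + 1 = N%:Z + `|(j + 1 - N%:Z)%R|%N%:Z) ?Gup ?GN//; lia.
  by rewrite (_ : j + 1 = - N%:Z - `|(- N%:Z - (j + 1))%R|%N%:Z) ?Gdn//; lia.
have FS j : F j - F (j - 1) = h j by rewrite /F subrK GS; ring.
exists F; split; [by exists N.+1|exact: FS|].
move=> j [hj|hj].
  have FE (t : nat) : F (j - t%:Z) = F j.
    elim: t => [|t IH]; first by rewrite subr0.
    have := FS (j - t%:Z); rewrite hj; last by lia.
    move/eqP; rewrite subr_eq0 => /eqP; rewrite IH => ->; congr F; lia.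
  by rewrite -(FE (N + `|j|).+1) Fs//; lia.
have FE (t : nat) : F (j + t%:Z) = F j.
  elim: t => [|t IH]; first by rewrite addr0.
  have := FS (j + t.+1%:Z); rewrite hj; last by lia.
  move/eqP; rewrite subr_eq0 => /eqP ->; rewrite -IH; congr F; lia.
by rewrite -(FE (N + `|j|).+1) Fs//; lia.
Qed.

(** By [wgt_steinD] the equation says that F = - W_(k+1) v is a primitive of W_k f. Where W_(k+1)
    vanishes so does F: otherwise W_k would be positive on both sides of that point, contradicting
    [wgt_gt0_between]. *)
Lemma steinD_solve k f : fin_supp f -> ip k f (fun=> 1) = 0 ->
  exists2 v, fin_supp v & eqw k f (D k v).
Proof.
move=> fs f1; pose h j := W k j * f j.
have hs : fin_supp h by exact: fin_supp_mull.
have h0 : isum h = 0 by rewrite -f1; apply: eq_isum => j; rewrite mulr1.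
have [F [Fs FS F0]] := fin_supp_primitive hs h0.
pose v j := - (W k.+1 j)^-1 * F j.
have vE j : W k.+1 j * v j = - F j.
  have [w0|w0] := eqVneq (W k.+1 j) 0; last by rewrite /v mulNr mulrN mulVKf.
  rewrite w0 mul0r F0 ?oppr0//; apply: contrapT => /not_orP[/existsNP[x] /not_implyP[xj hx]].
  move=> /existsNP[y] /not_implyP[jy hy].
  have pos i : h i <> 0 -> 0 < W k i.
    move=> hi; rewrite lt_def W_ge0 andbT; apply/eqP => wi; apply: hi.
    by rewrite /h wi mul0r.
  by have := wgt_gt0_between hp (pos _ hx) (pos _ hy) xj jy; rewrite w0 ltxx.
exists v; first exact: fin_supp_mull.
move=> j wj; apply: (mulfI wj).
by rewrite (wgt_steinD hp) !vE -/(h j) -FS; ring.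
Qed.

(** Delta maps D_k ... D_(k+i) 1 to a multiple of D_(k+1) ... D_(k+i) 1, so the remaining
    orthogonality relations of f = D_k v descend to v one level up, provided the eigenvalues
    differ. *)
Lemma ip_steinDn1_step k i v : fin_supp v ->
  ip k (D k v) (Dn k i.+1 (fun=> 1)) =
  (lam (k + i.+1) - lam k) * ip k.+1 v (Dn k.+1 i (fun=> 1)).
Proof.
move=> vs; rewrite ipC (ibp_fin hp)// fdiff_steinDn1 ipC.
by rewrite -[X in ip _ _ X]addr0 ip_linear_fin// ip0r addr0.
Qed.

Lemma steinDn_solve l k f : fin_supp f ->
  (forall i j, (k <= i < j)%N -> (j < k + l)%N -> lam j - lam i != 0) ->
  (forall i, (i < l)%N -> ip k f (Dn k i (fun=> 1)) = 0) ->
  exists2 u, fin_supp u & eqw k f (Dn k l u).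
Proof.
elim: l k f => [|l IH] k f fs lamN orth; first by exists f.
have [v vs fv] := steinD_solve fs (orth 0%N isT).
have [|i il|u us vu] := IH k.+1 v vs.
- by move=> i j ij jl; apply: lamN; lia.
- have /eqP := orth i.+1 il.
  rewrite (eqw_ip fv (fun j _ => erefl)) ip_steinDn1_step// mulf_eq0.
  have /negbTE -> /= : lam (k + i.+1) - lam k != 0 by apply: lamN; lia.
  by move/eqP.
- exists u => //=; apply: eqw_trans fv _; exact: eqw_steinD.
Qed.

End FiniteSupport.

(** * Density of finitely supported functions *)

Section Density.
Context (R : realType) (mu delta beta gamma : R) (p : int -> R).
Hypothesis hp : co_pmf mu delta beta gamma p.
Implicit Types (f g h u v z : int -> R).
Local Notation W := (wgt delta beta gamma p).
Local Notation ip := (ip delta beta gamma p).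
Local Notation wint2 := (wint2 delta beta gamma p).

Let W_ge0 k j : 0 <= W k j. Proof. exact: wgt_ge0 hp k j. Qed.

Definition in_window (N : nat) (j : int) : bool :=
  match j with Posz a => (a < N)%N | Negz a => (a < N)%N end.

Definition cut N f (j : int) : R := if in_window N j then f j else 0.

Lemma fin_supp_cut N f : fin_supp (cut N f).
Proof.
by exists N.+1 => -[] a /= aN; rewrite /cut /=; case: ifPn => //; lia.
Qed.

Lemma winsum_cut N f M : winsum (cut N f) M = winsum f (minn M N).
Proof.
elim: M => [|M IH]; first by rewrite min0n !winsum0.
rewrite winsumS IH /cut /=; case: ifPn => MN.
  by rewrite (minn_idPl MN) (minn_idPl (ltnW MN)) winsumS.
rewrite -leqNgt in MN.
by rewrite !addr0 (minn_idPr MN) (minn_idPr (leqW MN)).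
Qed.

Lemma isum_cut N f : isum (cut N f) = winsum f N.
Proof.
apply: isum_unique; apply: cvg_near_cst; near=> M.
have NM : (N <= M)%N by near: M; exists N.
by rewrite winsum_cut (minn_idPr NM).
Unshelve. all: by end_near. Qed.

Lemma isum_sub_cut N f : isummable f ->
  isum (fun j => f j - cut N f j) = isum f - winsum f N.
Proof.
move=> fs; rewrite isumB ?isum_cut//.
by apply: isummable_fin_supp; exact: fin_supp_cut.
Qed.

Lemma tail_small f : (forall j, 0 <= f j) -> isummable f ->
  forall e, 0 < e -> exists N, forall M, (N <= M)%N -> isum f - winsum f M <= e.
Proof.
move=> f0 fs e e0.
have /cvgr0Pnorm_le /(_ _ e0)[N _ HN] := isum_tail fs f0.
exists N => M NM; apply: le_trans (HN M NM); exact: ler_norm.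
Qed.

Lemma fdiff_fin_supp_bounded f : fin_supp (fdiff f) ->
  exists2 C, 0 <= C & forall j, `|f j| <= C.
Proof.
move=> fs; have ds := isummable_abs (isummable_fin_supp fs).
pose C := isum (fun j => `|fdiff f j|).
have win N : winsum (fun j => `|fdiff f j|) N <= C by apply: winsum_le_isum.
have H N : `|f (Posz N) - f 0| <= winsum (fun j => `|fdiff f j|) N /\
  `|f (- N%:Z) - f 0| <= winsum (fun j => `|fdiff f j|) N.
  elim: N => [|N [IH1 IH2]]; first by rewrite oppr0 subrr normr0 winsum0.
  rewrite winsumS; split.
    apply: le_trans (ler_distD (f (Posz N)) _ _) _; rewrite addrC lerD//.
    rewrite (_ : f (Posz N.+1) - f (Posz N) = fdiff f (Posz N)) ?lerDl//.
    by rewrite /fdiff -PoszD addn1.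
  apply: le_trans (ler_distD (f (- N%:Z)) _ _) _; rewrite addrC lerD//.
  rewrite distrC (_ : f (- N%:Z) - f (- N.+1%:Z) = fdiff f (Negz N)) ?lerDr//.
  by rewrite /fdiff; congr (f _ - f _); lia.
have C0 : 0 <= C by apply: isum_ge0.
exists (C + `|f 0|) => [|j]; first by rewrite addr_ge0.
rewrite -[f j](subrK (f 0)); apply: le_trans (ler_normD _ _) _; rewrite lerD2r.
have [jE|jE] : j = `|j|%N%:Z \/ j = - `|j|%N%:Z by lia.
  by rewrite jE; apply: le_trans (win `|j|%N); case: (H `|j|%N).
by rewrite jE; apply: le_trans (win `|j|%N); case: (H `|j|%N).
Qed.

Lemma fdiffn_bounded f C N i :
  (forall j, `|f j| <= C) -> (forall j, in_window (N + i) j -> f j = 0) ->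
  (forall j, `|fdiffn i f j| <= 2 ^+ i * C) /\
  (forall j, in_window N j -> fdiffn i f j = 0).
Proof.
elim: i N => [|i IH] N fC fN.
  by split=> j; rewrite ?expr0 ?mul1r// => jN; apply: fN; rewrite addn0.
have [IH1 IH2] := IH N.+1 fC (fun j jN => fN j ltac:(by rewrite -addSnnS)).
split=> j; rewrite [fdiffn i.+1 f]/= -/(fdiffn i f) /fdiff.
  apply: le_trans (ler_normB _ _) _.
  have -> : 2 ^+ i.+1 * C = 2 ^+ i * C + 2 ^+ i * C by rewrite exprS; ring.
  by rewrite lerD.
move=> jN; rewrite !IH2 ?subrr//; first by case: j jN => /= *; lia.
case: j jN => [a|[|a]] jN //.
- by have -> : Posz a + 1 = Posz a.+1 by lia.
- have -> : Negz a.+1 + 1 = Negz a by lia.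
  by move: jN => /= aN; lia.
Qed.

(** Here f is constant near each infinity, hence bounded, and truncation works: the i-th difference
    of the error is at most 2^i C and vanishes on a slightly smaller window, so the tail of W_(k+i)
    controls it. *)
Lemma cut_approx k n f : fin_supp (fdiff f) -> forall e, 0 < e ->
  exists2 h, fin_supp h & forall i, (i <= n)%N ->
    wint2 (k + i) (fdiffn i (f - h)) /\
    ip (k + i) (fdiffn i (f - h)) (fdiffn i (f - h)) <= e.
Proof.
move=> /fdiff_fin_supp_bounded[C C0 fC] e e0.
pose B i := (2 ^+ i * C) ^+ 2.
have B0 i : 0 <= B i by exact: sqr_ge0.
have [N HN] : exists N, forall i, (i <= n)%N -> forall M, (N <= M)%N ->
    B i * (isum (W (k + i)) - winsum (W (k + i)) M) <= e.
  elim: n => [|n [N HN]].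
    have := tail_small (W_ge0 (k + 0)) (wgt_summable hp (k + 0)).
    move=> /(_ (e / (B 0%N + 1))) []; first by rewrite divr_gt0// ltr_wpDl.
    move=> N HN; exists N => i; rewrite leqn0 => /eqP -> M /HN.
    rewrite ler_pdivlMr ?ltr_wpDl// => /(le_trans _); apply.
    rewrite [leRHS]mulrC ler_wpM2r ?lerDl// subr_ge0.
    by apply: winsum_le_isum; [exact: wgt_summable hp _|exact: W_ge0].
  have := tail_small (W_ge0 (k + n.+1)) (wgt_summable hp (k + n.+1)).
  move=> /(_ (e / (B n.+1 + 1))) []; first by rewrite divr_gt0// ltr_wpDl.
  move=> N' HN'; exists (maxn N N') => i; rewrite leq_eqVlt => /predU1P[->|il] M.
    rewrite geq_max => /andP[_ /HN'].
    rewrite ler_pdivlMr ?ltr_wpDl// => /(le_trans _); apply.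
    rewrite [leRHS]mulrC ler_wpM2r ?lerDl// subr_ge0.
    by apply: winsum_le_isum; [exact: wgt_summable hp _|exact: W_ge0].
  by rewrite geq_max => /andP[NM _]; apply: HN.
exists (cut (N + n) f); first exact: fin_supp_cut.
move=> i il; set d := f - _.
have dE j : d j = f j - cut (N + n) f j by [].
have dC j : `|d j| <= C.
  rewrite dE /cut; case: ifPn => _; last by rewrite subr0.
  by rewrite subrr normr0.
have dN j : in_window (N + n) j -> d j = 0.
  by move=> jN; rewrite dE /cut jN subrr.
have dN' j : in_window (N + n - i + i) j -> d j = 0.
  by rewrite subnK ?(leq_trans il (leq_addl _ _))//; apply: dN.
have [D1 D2] := fdiffn_bounded dC dN'.
set M := (N + n - i)%N in D2.
have le j : W (k + i) j * fdiffn i d j ^+ 2 <=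
    B i * (W (k + i) j - cut M (W (k + i)) j).
  rewrite /cut; case: ifPn => jM; first by rewrite D2// expr0n mulr0 subrr mulr0.
  rewrite subr0 mulrC ler_wpM2r// /B -[leLHS]real_normK ?num_real//.
  by rewrite lerXn2r ?nnegrE// mulr_ge0// exprn_ge0.
have s1 : isummable (fun j => W (k + i) j - cut M (W (k + i)) j).
  apply: isummableB; first exact: wgt_summable hp _.
  by apply: isummable_fin_supp; exact: fin_supp_cut.
have s2 : wint2 (k + i) (fdiffn i d).
  apply: (isummable_ler _ le (isummableZ _ s1)) => j.
  by rewrite mulr_ge0 ?sqr_ge0.
split=> //; apply: le_trans (HN i il M _); last by rewrite /M; lia.
rewrite -(isum_sub_cut _ (wgt_summable hp _)) -isumZ//; apply: ler_isum.
- by apply: eq_isummable s2 => j; rewrite expr2.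
- exact: isummableZ.
- by move=> j; rewrite -expr2.
Qed.

Lemma ip_sum2 k f g : wint2 k f -> wint2 k g ->
  ip k (f + g) (f + g) <= 2 * ip k f f + 2 * ip k g g.
Proof.
move=> f2 g2.
have fs : isummable (fun j => W k j * (f j * f j)).
  by apply: eq_isummable f2 => j; rewrite expr2.
have gs : isummable (fun j => W k j * (g j * g j)).
  by apply: eq_isummable g2 => j; rewrite expr2.
rewrite -!isumZ// -isumD; [|exact: isummableZ|exact: isummableZ].
have le j : W k j * ((f + g) j * (f + g) j) <=
  2 * (W k j * (f j * f j)) + 2 * (W k j * (g j * g j)).
  rewrite !fctE; have := W_ge0 k j; have := sqr_ge0 (f j - g j); nra.
apply: (ler_isum _ _ le); last by apply: isummableD; apply: isummableZ.
apply: (isummable_ler _ le); last by apply: isummableD; apply: isummableZ.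
by move=> j; rewrite mulr_ge0// -expr2 sqr_ge0.
Qed.

Lemma fdiffn_sub n f g : fdiffn n (f - g) = fdiffn n f - fdiffn n g.
Proof. by rewrite addrC -scaleN1r fdiffn_linear scaleN1r addrC. Qed.

Lemma ip_sqr k f : ip k f f = isum (fun j => W k j * f j ^+ 2).
Proof. by apply: eq_isum => j; rewrite expr2. Qed.

(** Truncating g itself would create jumps of the size of g, which the norms of order at least 1
    need not control. Instead Delta g is approximated one level up by w, an antidifference f0 of w
    approximates g by the Hardy inequality, and f0, eventually constant, is truncated. *)
Lemma fin_supp_dense k n g :
  (forall l, (k <= l < k + n)%N -> 0 < 1 - (l + l)%:R * delta) ->
  (forall i, (i <= n)%N -> wint2 (k + i) (fdiffn i g)) ->
  forall e, 0 < e -> exists2 h, fin_supp h & forall i, (i <= n)%N ->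
    ip (k + i) (fdiffn i (g - h)) (fdiffn i (g - h)) <= e.
Proof.
elim: n k g => [|n IH] k g r0 gs e e0.
  have g0 := gs 0%N isT; rewrite addn0 /= in g0.
  have [|N HN] := tail_small _ g0 e0; first by move=> j; rewrite mulr_ge0 ?sqr_ge0.
  exists (cut N g); first exact: fin_supp_cut.
  move=> i; rewrite leqn0 => /eqP ->; rewrite addn0 /=.
  apply: le_trans (HN N (leqnn N)); rewrite -isum_sub_cut// ip_sqr.
  rewrite le_eqVlt; apply/orP; left; apply/eqP; apply: eq_isum => j.
  rewrite !fctE /cut; case: ifPn => _; first by rewrite !subrr expr0n mulr0.
  by rewrite !subr0.
have [|c [K [K0 HK]]] := level_hardy2 hp (k := k); first by apply: r0; lia.
(* 1 + K absorbs the Hardy constant; the 4 leaves two errors of size e / 4, each doubled by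
   [ip_sum2]. *)
pose e1 := e / (4 * (1 + K)).
have e10 : 0 < e1 by rewrite divr_gt0// mulr_gt0// ltr_wpDr.
have e14 : (1 + K) * e1 = e / 4.
  by rewrite /e1; field; rewrite gt_eqF// ltr_wpDr.
have [||w ws Hw] := IH k.+1 (fdiff g) _ _ e1 e10.
- by move=> l kl; apply: r0; lia.
- by move=> i il; rewrite -fdiffnS addSnnS; apply: gs.
(* The additive constant makes g - f0 vanish at the Hardy centre c. *)
pose f0 := asum w + cst (g c - asum w c).
have df0 : fdiff f0 = w.
  by rewrite -[RHS](fdiff_asum w); apply/funext => j; rewrite /fdiff /f0 !fctE; ring.
have f0c : g c - f0 c = 0 by rewrite /f0 !fctE; ring.
have ws2 i : wint2 (k + i.+1) (fdiffn i w).
  by apply: wint2_fin; apply: fin_supp_fdiffn.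
have dE i : fdiffn i.+1 (g - f0) = fdiffn i (fdiff g - w).
  by rewrite fdiffnS -[fdiff (g - f0)]/(fdiffn 1 (g - f0)) fdiffn_sub /= df0.
have d2 i : (i <= n.+1)%N -> wint2 (k + i) (fdiffn i (g - f0)) /\
    ip (k + i) (fdiffn i (g - f0)) (fdiffn i (g - f0)) <= e / 4.
  have pos i' : (i' <= n)%N -> wint2 (k + i'.+1) (fdiffn i'.+1 (g - f0)) /\
    ip (k + i'.+1) (fdiffn i'.+1 (g - f0)) (fdiffn i'.+1 (g - f0)) <= e1.
    move=> il; rewrite dE; split; last by rewrite -addSnnS; apply: Hw.
    rewrite fdiffn_sub addrC -scaleN1r; apply: (wint2_linear hp) => //.
    by rewrite -fdiffnS; apply: gs.
  case: i => [_|i il]; last first.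
    have [? le1] := pos i il; split=> //; apply: le_trans le1 _.
    by rewrite -e14 ler_peMl ?lerDl// ltW.
  have [p1 p2] := pos 0%N isT; rewrite addn1 in p1 p2.
  have [s le1] := HK (g - f0) p1.
  have E : (fun j => W k j * ((g - f0) j - (g - f0) c) ^+ 2) =
           (fun j => W k j * (g - f0) j ^+ 2).
    by apply/funext => j; have -> : (g - f0) c = 0 by []; rewrite subr0.
  rewrite addn0 /=; rewrite E in s le1; split=> //.
  rewrite ip_sqr; apply: le_trans le1 _; rewrite -ip_sqr -e14.
  apply: ler_pM => //; first exact: ip_ge0 hp _ _ p1.
  by rewrite lerDr.
have e40 : 0 < e / 4 by rewrite divr_gt0.
have [h hs Hh] := @cut_approx k n.+1 f0 ltac:(by rewrite df0) _ e40.
exists h => // i il.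
have -> : g - h = (g - f0) + (f0 - h) by rewrite addrA subrK.
have -> : fdiffn i (g - f0 + (f0 - h)) = fdiffn i (g - f0) + fdiffn i (f0 - h).
  by rewrite -[g - f0]scale1r fdiffn_linear !scale1r.
have [s1 l1] := d2 i il; have [s2 l2] := Hh i il.
apply: le_trans (ip_sum2 s1 s2) _; lra.
Qed.

End Density.

(** * Orthogonal polynomials *)

Section Projection.
Context (R : realType) (mu delta beta gamma : R) (p : int -> R).
Hypothesis hp : co_pmf mu delta beta gamma p.
Implicit Types (f g h u v z : int -> R).
Local Notation W := (wgt delta beta gamma p).
Local Notation D := (steinD mu delta beta gamma).
Local Notation Dn := (steinDn mu delta beta gamma).
Local Notation sops := (sops mu delta beta gamma).
Local Notation phi := (phi mu delta beta gamma).
Local Notation ip := (ip delta beta gamma p).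
Local Notation wint1 := (wint1 delta beta gamma p).
Local Notation wint2 := (wint2 delta beta gamma p).
Local Notation wbound := (wbound delta beta gamma p).
Local Notation bform := (bform delta beta gamma p).
Local Notation lam := (lam delta).
Local Notation lams := (lams delta).

Variables (m n : nat).
Hypothesis hW : exists x, 0 < W (m + n) x.
Hypothesis mn1 : (1 <= m + n)%N.

Let W_ge0 k j : 0 <= W k j. Proof. exact: wgt_ge0 hp k j. Qed.

Lemma onem_delta_gt0 l : (l.+2 <= (m + n).*2)%N -> 0 < 1 - l%:R * delta.
Proof. by move=> lmn; have [x Wx] := hW; apply: (delta_bound hp Wx). Qed.

Lemma rate_gt0 l : (l < m + n)%N -> 0 < 1 - (l + l)%:R * delta.
Proof. by move=> lmn; apply: onem_delta_gt0; lia. Qed.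

Lemma lamB_gt0 i j : (i < j <= m + n)%N -> 0 < lam j - lam i.
Proof.
move=> /andP[ij jmn]; rewrite lamB; last exact: ltnW.
have -> : (j + i)%:R - 1 = (j + i).-1%:R :> R by rewrite -subn1 natrB//; lia.
by rewrite mulr_gt0 ?ltr0n ?subn_gt0// onem_delta_gt0//; lia.
Qed.

Lemma lam_gt0 j : (0 < j <= m + n)%N -> 0 < lam j.
Proof. by move=> /lamB_gt0; rewrite lam0 subr0. Qed.

Lemma W_gt0_some k : (k <= m + n)%N -> exists x, 0 < W k x.
Proof.
move=> kmn; have [x Wx] := hW; exists x.
by apply: (wgt_gt0 hp (wgt_gt0_start hp Wx) (wgt_gt0_end hp Wx)); lia.
Qed.

Lemma isum_W_gt0 k : (k <= m + n)%N -> 0 < isum (W k).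
Proof.
move=> /W_gt0_some[x Wx]; apply: lt_le_trans Wx _.
by apply: ler_isum_term => //; exact: wgt_summable hp k.
Qed.

Lemma phi_wbound k : wbound 0 k (phi k).
Proof. by have := @wbound_steinDn _ _ _ _ _ _ hp 0 0 k _ (wbound1 _ _ _ _ _). Qed.

Lemma wbound_fdiff k a v : wbound k a v -> wbound k.+1 a (fdiff v).
Proof.
move=> [C C0 HC].
have rX0 i b : 0 <= rho R i ^+ b by rewrite exprn_ge0// rho_ge0.
have vC i : W k i != 0 -> `|v i| <= C * rho R i ^+ a.
  by move=> wi; have := HC i; rewrite mulrC ler_pM2r// lt_def wi W_ge0.
exists (C * 2 ^+ a + C) => [|j]; first by rewrite addr_ge0// mulr_ge0// exprn_ge0.
rewrite mulrC; have [->|wj] := eqVneq (W k.+1 j) 0; first by rewrite !mulr0.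
rewrite ler_wpM2r// /fdiff; apply: le_trans (ler_normB _ _) _; rewrite mulrDl.
apply: lerD; last first.
  by apply: vC; apply: contra wj => /eqP w0; rewrite wgtS w0 mul0r.
apply: le_trans (vC _ _) _.
  by apply: contra wj => /eqP w0; rewrite (wgt_succ hp) w0 mul0r.
rewrite -mulrA ler_wpM2l// -exprMn lerXn2r ?nnegrE ?mulr_ge0 ?rho_ge0//.
exact: rho_shift j 1.
Qed.

Lemma wbound_fdiffn i k a v : wbound k a v -> wbound (k + i) a (fdiffn i v).
Proof.
elim: i k v => [|i IH] k v vb; first by rewrite addn0.
by rewrite fdiffnS -addSnnS; apply: IH; apply: wbound_fdiff.
Qed.

Definition energy f := forall i, (i <= n)%N -> wint2 i (fdiffn i f).

Lemma energy_phi k : energy (phi k).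
Proof.
move=> i _; apply: (wbound_wint2 hp (a := k)).
by have := wbound_fdiffn i (phi_wbound k); rewrite add0n.
Qed.

Lemma energy_fin f : fin_supp f -> energy f.
Proof. by move=> fs i _; apply: wint2_fin; apply: fin_supp_fdiffn. Qed.

Lemma energy_linear c f g : energy f -> energy g -> energy (c *: f + g).
Proof.
by move=> fe ge i il; rewrite fdiffn_linear; apply: (wint2_linear hp); [apply: fe|apply: ge].
Qed.

Lemma energy0 : energy 0.
Proof. by apply: energy_fin; exists 0%N. Qed.

Lemma energy_sum N (c : nat -> R) : energy (\sum_(k < N) c k *: phi k).
Proof.
elim: N => [|N IH]; first by rewrite big_ord0; exact: energy0.
by rewrite big_ord_recr /= addrC; apply: energy_linear => //; exact: energy_phi.
Qed.

Lemma energyB f g : energy f -> energy g -> energy (f - g).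
Proof. by move=> fe ge; rewrite addrC -scaleN1r; apply: energy_linear. Qed.

(** [in_H] bounds only the top order n; the Hardy inequality supplies the lower orders. *)
Lemma energy_descent f : wint2 n (fdiffn n f) -> energy f.
Proof.
move=> fn i il; rewrite -(subKn il).
have: (n - i <= n)%N by lia.
elim: (n - i)%N => [|l IH] ln; first by rewrite subn0.
apply: (wint2_descent hp); first by apply: rate_gt0; lia.
rewrite (_ : (n - l.+1).+1 = n - l)%N; last by lia.
have := IH ltac:(lia); congr (wint2 _ _).
by rewrite (_ : n - l = (n - l.+1).+1)%N//; lia.
Qed.

Lemma wint1_all f : wint1 m 0 (fdiffn m f) ->
  forall i, (i <= m)%N -> wint1 i 0 (fdiffn i f).
Proof.
move=> fm i il; rewrite -(subKn il); have: (m - i <= m)%N by lia.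
elim: (m - i)%N => [|l IH] lm; first by rewrite subn0.
apply: (wint1_le _ (leqnSn 0)); first exact: hp.
apply: (wint1_descent hp); first by apply: rate_gt0; lia.
rewrite (_ : (m - l.+1).+1 = m - l)%N; last by lia.
have := IH ltac:(lia); congr (wint1 _ _ _).
by rewrite (_ : m - l = (m - l.+1).+1)%N//; lia.
Qed.

Lemma energy_ip_summable i f g : (i <= n)%N -> energy f -> energy g ->
  isummable (fun j => W i j * (fdiffn i f j * fdiffn i g j)).
Proof. by move=> il fe ge; apply: (wint2_mul hp); [apply: fe|apply: ge]. Qed.

Lemma bformC f g : bform m n f g = bform m n g f.
Proof. by apply: eq_bigr => i _; rewrite ipC. Qed.

Lemma bform_linear c f g h : energy f -> energy g -> energy h ->
  bform m n (c *: f + g) h = c * bform m n f h + bform m n g h.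
Proof.
move=> fe ge he; rewrite /bform mulr_sumr -big_split /=; apply: eq_bigr => i _.
have il : (i <= n)%N by rewrite -ltnS.
by rewrite fdiffn_linear ip_linear; [ring|apply: energy_ip_summable..].
Qed.

Lemma bformB f g h : energy f -> energy g -> energy h ->
  bform m n (f - g) h = bform m n f h - bform m n g h.
Proof.
move=> fe ge he; rewrite addrC -scaleN1r bform_linear// mulN1r addrC; by [].
Qed.

Lemma bform_sum N (c : nat -> R) h : energy h ->
  bform m n (\sum_(k < N) c k *: phi k) h = \sum_(k < N) c k * bform m n (phi k) h.
Proof.
move=> he; elim: N => [|N IH].
  rewrite !big_ord0 -[0]addr0 -[X in bform m n (X + _)](scale0r h).
  rewrite bform_linear//; last exact: energy0.
  have := bform_linear (-1) energy0 energy0 he.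
  rewrite scaler0 addr0 mulN1r addNr => ->; by rewrite mul0r addr0.
rewrite !big_ord_recr /= addrC bform_linear// ?IH; first by rewrite addrC.
  exact: energy_phi.
exact: energy_sum.
Qed.

Definition newton (i : nat) (x : R) : R := \prod_(j < i) (x - lam j).

(** The polynomial Q in Newton form; [spectralE] identifies it with the product. *)
Definition spectral (x : R) : R :=
  \sum_(i < n.+1) (-1) ^+ i * nu delta m n i * newton i x.

(** Multiplication by x on R, taken as the operator A, turns [popl_newton] into an identity between
    functions of x. *)
Lemma popl_mul (x : R) (s : seq R) (y : R^o) :
  popl (fun y : R^o => (x * y : R^o)) s y = (\prod_(a <- s) (x - a)) * y.
Proof.
elim: s => [|a s IH]; first by rewrite big_nil mul1r.
by rewrite /= -/(popl _ _ _) IH big_cons /GRing.scale /=; ring.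
Qed.

Lemma prod_lams (x : R) k i :
  \prod_(a <- lams k i) (x - a) = \prod_(j < i) (x - lam (k + j)).
Proof.
rewrite /lams big_map.
elim: i k => [|i IH] k; first by rewrite big_nil big_ord0.
rewrite /= big_cons big_ord_recl addn0; congr (_ * _).
by rewrite IH; apply: eq_bigr => j _; rewrite addSnnS.
Qed.

Lemma spectralE x : \prod_(s < n) (x - lam (m + s.+1)) =
  (\prod_(s < n) - lam (m + s.+1)) * spectral x.
Proof.
have nz j : (j < m + n)%N -> 1 - j%:R * delta != 0.
  by move=> jmn; rewrite gt_eqF// onem_delta_gt0//; lia.
have := @popl_newton R delta R^o (fun y : R^o => (x * y : R^o)) _ m n 1 nz.
rewrite popl_mul prod_lams mulr1 => E.
transitivity (\prod_(j < n) (x - lam (m.+1 + j))).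
  by apply: eq_bigr => j _; rewrite addSnnS.
rewrite E; last by move=> c y z; rewrite /GRing.scale /=; ring.
congr (_ * _); apply: eq_bigr => i _; rewrite popl_mul prod_lams mulr1.
by congr (_ * _).
Qed.

Lemma lam_prod_neq0 : \prod_(s < n) - lam (m + s.+1) != 0.
Proof.
apply/prodf_neq0 => s _; rewrite oppr_eq0 gt_eqF//.
by apply: lam_gt0; have := ltn_ord s; lia.
Qed.

Lemma spectral_lam0 k : (m < k <= m + n)%N -> spectral (lam k) = 0.
Proof.
move=> /andP[mk kmn]; have := spectralE (lam k).
have kn : (k - m.+1 < n)%N by lia.
rewrite (bigD1 (Ordinal kn)) //= (_ : (m + (k - m.+1).+1 = k)%N); last by lia.
rewrite subrr mul0r => /esym/eqP; rewrite mulf_eq0 (negbTE lam_prod_neq0).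
by move/eqP.
Qed.

Lemma fdiffn_phi0 i k : (k < i)%N -> fdiffn i (phi k) = 0.
Proof.
move=> ki; rewrite -(subnK ki) /fdiffn iterD.
have -> : iter k.+1 (@fdiff R) (phi k) = 0.
  by rewrite -[LHS]/(fdiff (fdiffn k (phi k))) fdiffn_phi; apply/funext => j; rewrite /fdiff subrr.
elim: (i - k.+1)%N => [//|l IH]; rewrite iterS IH.
by apply/funext => j; rewrite /fdiff subrr.
Qed.

(** All operators are put on phi_k, an eigenfunction with polynomial bounds, so that finite energy
    of f is enough. *)
Lemma ip_phi_energy i k f : (i <= n)%N -> energy f ->
  ip i (fdiffn i f) (fdiffn i (phi k)) = newton i (lam k) * ip 0 f (phi k).
Proof.
move=> il fe.
have := @ibpn_wint _ _ _ _ _ _ hp 0 k i f (fdiffn i (phi k)).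
rewrite !add0n => <-.
- rewrite -sops_lams {2}/phi sops_steinDn1 add0n prod_lams.
  rewrite -/(newton i (lam k)) -[X in ip 0 f X]addr0 ipC ip_linear.
  + by rewrite (ipC _ _ _ _ _ 0) ip0r addr0 ipC.
  + apply: (wint2_mul hp); first by have := energy_phi k; move/(_ 0%N isT).
    by have := fe 0%N isT.
  + apply: eq_isummable (isummable0 R) => j.
    by have -> : (0 : int -> R) j = 0 by []; rewrite mul0r mulr0.
- by move=> l li; apply: rate_gt0; lia.
- by apply: (wint2_int1 hp); apply: fe.
- by have := wbound_fdiffn i (phi_wbound k); rewrite add0n.
Qed.

Lemma bform_phi k f : energy f -> bform m n f (phi k) = spectral (lam k) * ip 0 f (phi k).
Proof.
move=> fe; rewrite /bform /spectral mulr_suml; apply: eq_bigr => i _.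
by rewrite ip_phi_energy ?mulrA// -ltnS.
Qed.

Lemma ip_phi f k : (k <= m + n)%N -> wint1 k 0 (fdiffn k f) ->
  ip 0 f (phi k) = ip k (fdiffn k f) (fun=> 1).
Proof.
move=> kmn fs; have := @ibpn_wint _ _ _ _ _ _ hp 0 0 k f (fun=> 1).
rewrite add0n; apply => //; last exact: wbound1.
by move=> l lk; apply: rate_gt0; lia.
Qed.

Lemma ip_phi_orth a b : (a <= m + n)%N -> (b <= m + n)%N -> a != b ->
  ip 0 (phi a) (phi b) = 0.
Proof.
have H x y : (x < y <= m + n)%N -> ip 0 (phi x) (phi y) = 0.
  move=> /andP[xy ymn]; rewrite ip_phi// fdiffn_phi0//.
    by rewrite ipC ip0r.
  by apply: wint1_fin; exists 0%N.
move=> an bn; rewrite neq_ltn => /orP[ab|ba]; first by rewrite H ?ab.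
by rewrite ipC H ?ba.
Qed.

(** The squared norm of phi_k ([ip_phi_norm]), in the closed form that exposes the factor E q^[k]
    found in [kappa]. *)
Definition normphi k := newton k (lam k) * isum (W k).

Lemma ip_phi_norm k : (k <= m + n)%N -> ip 0 (phi k) (phi k) = normphi k.
Proof.
move=> kmn; rewrite ip_phi// fdiffn_phi.
  rewrite -/(newton _ _) /normphi -isumZ; last exact: wgt_summable hp k.
  by apply: eq_isum => j; rewrite mulr1 mulrC.
apply: eq_isummable (isummableZ `|\prod_(j < k) (lam k - lam j)| (wgt_summable hp k)) => j.
by rewrite expr0 mulr1 mulrC.
Qed.

Lemma newton_gt0 k : (k <= m + n)%N -> 0 < newton k (lam k).
Proof. by move=> kmn; apply: prodr_gt0 => j _; apply: lamB_gt0; rewrite ltn_ord. Qed.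

Lemma normphi_gt0 k : (k <= m + n)%N -> 0 < normphi k.
Proof. by move=> kmn; rewrite mulr_gt0 ?newton_gt0 ?isum_W_gt0. Qed.

Definition polproj g : int -> R :=
  \sum_(k < m.+1) (ip 0 g (phi k) / normphi k) *: phi k.

Lemma energy_polproj g : energy (polproj g).
Proof. exact: (energy_sum m.+1 (fun k => ip 0 g (phi k) / normphi k)). Qed.

Lemma energy_residual g : energy g -> energy (g - polproj g).
Proof. by move=> ge; apply: energyB => //; exact: energy_polproj. Qed.

Lemma ip0_summable f g : energy f -> energy g ->
  isummable (fun j => W 0 j * (f j * g j)).
Proof. by move=> fe ge; have := energy_ip_summable (leq0n n) fe ge. Qed.

Lemma residual_orth g k : energy g -> (k <= m)%N -> ip 0 (g - polproj g) (phi k) = 0.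
Proof.
move=> ge km.
have sumE N : ip 0 (\sum_(i < N) (ip 0 g (phi i) / normphi i) *: phi i) (phi k) =
    \sum_(i < N) ip 0 g (phi i) / normphi i * ip 0 (phi i) (phi k).
  elim: N => [|N IH]; first by rewrite !big_ord0 ipC ip0r.
  rewrite !big_ord_recr /= addrC ip_linear ?IH 1?addrC//.
    by apply: ip0_summable; exact: energy_phi.
  apply: ip0_summable; last exact: energy_phi.
  exact: (energy_sum N (fun i => ip 0 g (phi i) / normphi i)).
have kn : (k < m.+1)%N by [].
rewrite addrC -scaleN1r ip_linear; last 2 first.
- by apply: ip0_summable; [exact: energy_polproj|exact: energy_phi].
- by apply: ip0_summable => //; exact: energy_phi.
rewrite sumE (bigD1 (Ordinal kn))//= big1 => [|i /eqP ik].
  rewrite addr0 ip_phi_norm; last by lia.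
  rewrite divfK ?mulN1r ?addNr//; rewrite gt_eqF// normphi_gt0//; lia.
rewrite ip_phi_orth ?mulr0//; [have := ltn_ord i; lia|lia|].
by apply/eqP => ikE; apply: ik; apply: val_inj.
Qed.

(** Pythagoras for [bform]: by [bform_phi] its values against phi_k are multiples of <., phi_k>_0,
    so the residual has no cross terms with its projection. *)
Lemma bform_residual g : energy g ->
  bform m n (g - polproj g) (g - polproj g) =
  bform m n g g - \sum_(k < m.+1) spectral (lam k) / normphi k * ip 0 g (phi k) ^+ 2.
Proof.
move=> ge; have re := energy_residual ge; have pe := energy_polproj g.
rewrite bformB//.
have -> : bform m n (polproj g) (g - polproj g) = 0.
  rewrite (bform_sum m.+1 (fun k => ip 0 g (phi k) / normphi k))// big1// => k _.
  by rewrite bformC bform_phi// residual_orth ?mulr0// -ltnS.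
rewrite subr0 bformC bformB//; congr (_ - _).
rewrite (bform_sum m.+1 (fun k => ip 0 g (phi k) / normphi k))//.
by apply: eq_bigr => k _; rewrite bformC bform_phi//; ring.
Qed.

End Projection.

(** * The quadratic form of the residual *)

Section SignAndEquality.
Context (R : realType) (mu delta beta gamma : R) (p : int -> R).
Hypothesis hp : co_pmf mu delta beta gamma p.
Implicit Types (f g h u v z : int -> R) (F : nat -> int -> R).
Local Notation W := (wgt delta beta gamma p).
Local Notation D := (steinD mu delta beta gamma).
Local Notation Dn := (steinDn mu delta beta gamma).
Local Notation sops := (sops mu delta beta gamma).
Local Notation phi := (phi mu delta beta gamma).
Local Notation ip := (ip delta beta gamma p).
Local Notation wint2 := (wint2 delta beta gamma p).
Local Notation bform := (bform delta beta gamma p).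
Local Notation lam := (lam delta).
Local Notation lams := (lams delta).

Let W_ge0 k j : 0 <= W k j. Proof. exact: wgt_ge0 hp k j. Qed.

Lemma ip_cauchy k f g : wint2 k f -> wint2 k g ->
  ip k f g ^+ 2 <= ip k f f * ip k g g.
Proof.
move=> f2 g2; set A := ip k f f; set B := ip k f g; set C := ip k g g.
have A0 : 0 <= A by apply: (ip_ge0 hp).
have C0 : 0 <= C by apply: (ip_ge0 hp).
have H x : 0 <= A + 2 * x * B + x ^+ 2 * C.
  have xs : wint2 k (x *: g + f) by apply: (wint2_linear hp).
  have := ip_ge0 hp xs.
  rewrite ip_linear; [|exact: (wint2_mul hp)..].
  rewrite (ipC _ _ _ _ _ g) ip_linear; [|exact: (wint2_mul hp)..].
  rewrite (ipC _ _ _ _ _ f (_ + _)) ip_linear; [|exact: (wint2_mul hp)..].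
  rewrite (ipC _ _ _ _ _ g f) -/A -/B -/C; congr (0 <= _); ring.
have [C00|Cn0] := eqVneq C 0.
  rewrite C00 mulr0; have [->|Bn0] := eqVneq B 0; first by rewrite expr0n.
  (* With C = 0 the quadratic is affine in x, and at this x it equals -1. *)
  have := H (- (A + 1) / (2 * B)); rewrite C00 mulr0 addr0.
  have -> : 2 * (- (A + 1) / (2 * B)) * B = - (A + 1) by field.
  by rewrite opprD addrA subrr add0r ler0N1.
have Cp : 0 < C by rewrite lt_def Cn0.
have := H (- B / C).
have -> : A + 2 * (- B / C) * B + (- B / C) ^+ 2 * C = (A * C - B ^+ 2) / C by field.
by rewrite pmulr_lge0 ?invr_gt0// subr_ge0.
Qed.

Lemma sqr_cvg0 (u : nat -> R) : (fun t => u t ^+ 2) @ \oo --> (0 : R) -> u @ \oo --> (0 : R).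
Proof.
move=> u2; apply/norm_cvg0P.
rewrite (_ : (fun t => _) = (fun t => Num.sqrt (u t ^+ 2))); last first.
  by apply/funext => t; rewrite sqrtr_sqr.
rewrite -[0 in X in _ --> X](sqrtr0 R).
by apply: continuous_cvg => //; exact: sqrt_continuous.
Qed.

Lemma cvg0_le (u v : nat -> R) : (forall t, 0 <= u t) -> (forall t, u t <= v t) ->
  v @ \oo --> (0 : R) -> u @ \oo --> (0 : R).
Proof.
move=> u0 uv v0; apply: (squeeze_cvgr _ (cvg_cst (0 : R)) v0).
by apply: nearW => t; rewrite u0 uv.
Qed.

Lemma cvgM0 (c : R) (u : nat -> R) : u @ \oo --> (0 : R) ->
  (fun t => c * u t) @ \oo --> (0 : R).
Proof. by move=> u0; rewrite -(mulr0 c); apply: cvgM => //; apply: cvg_cst. Qed.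

Lemma cvgD0 (u v : nat -> R) : u @ \oo --> (0 : R) -> v @ \oo --> (0 : R) ->
  (fun t => u t + v t) @ \oo --> (0 : R).
Proof. by move=> u0 v0; rewrite -[0](addr0 0); apply: cvgD. Qed.

Lemma fdiffnZ i c f : fdiffn i (c *: f) = c *: fdiffn i f.
Proof.
have E0 : fdiffn i 0 = 0 :> (int -> R).
  have := fdiffn_linear i (-1) (0 : int -> R) 0.
  by rewrite scaler0 addr0 scaleN1r addNr.
by rewrite -[c *: f]addr0 fdiffn_linear E0 addr0.
Qed.

Lemma ip_scale k c f : wint2 k f -> ip k (c *: f) (c *: f) = c ^+ 2 * ip k f f.
Proof.
move=> f2; rewrite /ip -isumZ; last by apply: eq_isummable f2 => j; rewrite expr2.
by apply: eq_isum => j; rewrite !fctE /GRing.scale /=; ring.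
Qed.

Definition dirac_at (x j : int) : R := (j == x)%:R.

Lemma fin_supp_dirac x : fin_supp (dirac_at x).
Proof.
exists `|x|%N.+1 => j; rewrite /dirac_at; case: eqP => // ->; lia.
Qed.

Lemma ip_dirac k f x : ip k f (dirac_at x) = W k x * f x.
Proof.
rewrite /ip; pose h j := W k j * (f j * dirac_at x j).
have hE j : j != x -> h j = 0 by rewrite /h /dirac_at => /negbTE ->; rewrite !mulr0.
have hx : h x = W k x * f x by rewrite /h /dirac_at eqxx mulr1.
have hs : forall j, (`|x|.+1 <= `|j|)%N -> h j = 0 by move=> j jx; apply: hE; lia.
rewrite -[LHS]/(isum h) (isum_fin_supp hs) -hx winsumS.
have w0 (N : nat) : (N <= `|x|)%N -> winsum h N = if in_window N x then h x else 0.
  elim: N => [|N IH] Nx; first by rewrite winsum0; case: (x).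
  rewrite winsumS IH; last by exact: ltnW.
  case: (x) Nx hE => a /= Nx hE.
    rewrite (hE (Posz N)) ?(hE (Negz N)) ?addr0; [|lia..].
    by do 2 case: ifPn => //; lia.
  rewrite (hE (Posz N)); last by lia.
  have [->|Na] := eqVneq N a.
    by rewrite ltnn ltnSn !add0r.
  rewrite (hE (Negz N)) ?addr0; last by lia.
  by do 2 case: ifPn => //; lia.
rewrite w0//; case: (x) hE => a /= hE.
  by rewrite ltnn add0r (hE (Negz a)) ?addr0//; lia.
by rewrite leqnn (hE (Posz _)) ?(hE (Negz a.+1)) ?addr0//; lia.
Qed.

Variables (m n : nat).
Hypothesis hW : exists x, 0 < W (m + n) x.
Hypothesis mn1 : (1 <= m + n)%N.
Local Notation energy := (energy delta beta gamma p n).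

Definition approximates F f := forall i, (i <= n)%N ->
  (fun t => ip i (fdiffn i (f - F t)) (fdiffn i (f - F t))) @ \oo --> (0 : R).

Lemma approximates_ip F f i g : (i <= n)%N -> energy f -> (forall t, fin_supp (F t)) ->
  wint2 i g -> approximates F f ->
  (fun t => ip i (fdiffn i (f - F t)) g) @ \oo --> (0 : R).
Proof.
move=> il fe Fs g2 Ff; apply: sqr_cvg0.
apply: (@cvg0_le _ (fun t => ip i g g * ip i (fdiffn i (f - F t)) (fdiffn i (f - F t)))).
- by move=> t; apply: sqr_ge0.
- move=> t; rewrite mulrC; apply: ip_cauchy => //.
  exact: (energyB hp fe (energy_fin delta beta gamma p (Fs t)) il).
- exact: cvgM0 (Ff i il).
Qed.

Lemma exists_approx f : energy f ->
  exists2 F, (forall t, fin_supp (F t)) & approximates F f.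
Proof.
move=> fe.
have H t : exists h, fin_supp h /\ forall i, (i <= n)%N ->
    ip i (fdiffn i (f - h)) (fdiffn i (f - h)) <= t.+1%:R^-1.
  have r0 l : (0 <= l < 0 + n)%N -> 0 < 1 - (l + l)%:R * delta.
    by move=> ln; apply: (rate_gt0 hp hW mn1); lia.
  have t0 : 0 < t.+1%:R^-1 :> R by rewrite invr_gt0.
  by have [h hs Hh] := fin_supp_dense hp r0 fe t0; exists h.
have [F HF] := choice H; exists F => [t|i il]; first by case: (HF t).
apply: (@cvg0_le _ (fun t => t.+1%:R^-1)).
- move=> t; apply: (ip_ge0 hp); case: (HF t) => Fs _.
  exact: (energyB hp fe (energy_fin delta beta gamma p Fs) il).
- by move=> t; case: (HF t) => _; apply.
- exact: cvg_harmonic.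
Qed.

(* e = D_0 ... D_(b-1) dirac is orthogonal to phi 0, ..., phi (b - 1) but not to phi b,
   so subtracting multiples of it restores the next orthogonality relation. *)
Lemma approximates_orth f b : energy f ->
  (forall k, (k < b)%N -> ip 0 f (phi k) = 0) -> (b <= (m + n).+1)%N ->
  exists F, [/\ forall t, fin_supp (F t), approximates F f &
    forall t k, (k < b)%N -> ip 0 (F t) (phi k) = 0].
Proof.
move=> fe; elim: b => [|b IH] orth bmn.
  by have [F Fs Ff] := exists_approx fe; exists F; split.
have [|F [Fs Ff Fo]] := IH _ (ltnW bmn); first by move=> k kb; apply: orth; exact: ltnW.
have [x Wx] := W_gt0_some hp hW mn1 (bmn : (b <= m + n)%N).
pose e := Dn 0 b (dirac_at x).
have es : fin_supp e by apply: fin_supp_steinDn; exact: fin_supp_dirac.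
have eE k : ip 0 e (phi k) = W b x * fdiffn b (phi k) x.
  by rewrite ipC (ibpn_fin hp) ?add0n ?ip_dirac//; exact: fin_supp_dirac.
have ek k : (k < b)%N -> ip 0 e (phi k) = 0.
  by move=> kb; rewrite eE fdiffn_phi0// mulr0.
have eb : ip 0 e (phi b) != 0.
  rewrite eE fdiffn_phi mulf_neq0 ?gt_eqF//.
  exact: (newton_gt0 hp hW mn1).
pose c t := ip 0 (F t) (phi b) / ip 0 e (phi b).
pose F' t := (- c t) *: e + F t.
have F's t : fin_supp (F' t) by apply: fin_suppD => //; exact: fin_supp_mull.
have sb h k : fin_supp h -> isummable (fun j => W 0 j * (h j * phi k j)).
  move=> hs; apply: eq_isummable (isummable_ip_fin delta beta gamma p 0 (phi k) hs) => j.
  by rewrite (mulrC (h j)).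
(* <F t, phi b> tends to <f, phi b> = 0, so the correction disappears in the limit and F' still
   approximates f. *)
have c0 : c @ \oo --> (0 : R).
  have pw := energy_phi hp (n := n) b (leq0n n).
  have := approximates_ip (leq0n n) fe Fs pw Ff.
  move=> /(cvgM0 (- (ip 0 e (phi b))^-1)).
  set u := (X in X @ _ --> _); rewrite (_ : c = u)//.
  apply/funext => t; rewrite /c /u /=.
  have -> : ip 0 (f - F t) (phi b) = - ip 0 (F t) (phi b).
    rewrite addrC -scaleN1r ip_linear ?orth ?addr0 ?mulN1r//; first exact: sb.
    exact: (ip0_summable hp fe (energy_phi hp (n := n) b)).
  by ring.
exists F'; split=> //.
- move=> i il.
  have ee := energy_fin delta beta gamma p (n := n) es.
  apply: (@cvg0_le _ (fun t => 2 * (ip i (fdiffn i e) (fdiffn i e) * c t ^+ 2) +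
      2 * ip i (fdiffn i (f - F t)) (fdiffn i (f - F t)))).
  + move=> t; apply: (ip_ge0 hp).
    exact: (energyB hp fe (energy_fin delta beta gamma p (F's t)) il).
  + move=> t.
    have -> : f - F' t = c t *: e + (f - F t).
      by rewrite /F' opprD scaleNr opprK addrCA.
    have ce : wint2 i (fdiffn i (c t *: e)).
      by apply: wint2_fin; apply: fin_supp_fdiffn; exact: fin_supp_mull.
    have de := energyB hp fe (energy_fin delta beta gamma p (n := n) (Fs t)) il.
    have -> : fdiffn i (c t *: e + (f - F t)) =
        fdiffn i (c t *: e) + fdiffn i (f - F t).
      by rewrite -[c t *: e]scale1r fdiffn_linear !scale1r.
    apply: le_trans (ip_sum2 hp ce de) _; rewrite lerD2r ler_wpM2l//.
    rewrite fdiffnZ ip_scale; last exact: ee _ il.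
    by rewrite [leRHS]mulrC.
  + apply: cvgD0; apply: cvgM0; last exact: Ff.
    apply: cvgM0; rewrite -(mulr0 0); under eq_fun do rewrite expr2.
    exact: cvgM.
- move=> t k; rewrite ltnS leq_eqVlt /F' => /predU1P[->|kb].
    rewrite ip_linear; [|exact: sb..].
    by rewrite /c mulNr divfK// addNr.
  rewrite ip_linear; [|exact: sb..].
  by rewrite ek// Fo// mulr0 addr0.
Qed.

End SignAndEquality.

(** * Polynomials as functions with vanishing higher differences *)

Section Polynomials.
Context (R : realType).
Implicit Types (f g h : int -> R) (H : {poly R}).

Lemma fdiff0_const h : fdiff h = 0 -> forall j, h j = h 0.
Proof.
move=> dh; have E j : h (j + 1) = h j.
  by apply/eqP; rewrite -subr_eq0; apply/eqP; have := congr1 (@^~ j) dh.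
by apply: (@int_ind_between _ 0) => [//|j _ <-|j _ <-]; rewrite E.
Qed.

Lemma fdiffn_horner K H : (size H <= K)%N ->
  fdiffn K (fun j : int => H.[j%:~R]) = 0.
Proof.
elim: K H => [|K IH] H sH.
  apply/funext => j /=; move: sH; rewrite leqn0 size_poly_eq0 => /eqP ->.
  by rewrite horner0.
rewrite fdiffnS; pose H' : {poly R} := \sum_(i < K) H^`N(i.+1).
rewrite (_ : fdiff _ = fun j : int => H'.[j%:~R]); last first.
  apply/funext => j; rewrite /fdiff rmorphD /=.
  rewrite (nderiv_taylor_wide (mulrC _ _) sH) big_ord_recl /= expr0 mulr1 nderivn0.
  rewrite addrAC subrr add0r /H' horner_sum; apply: eq_bigr => i _.
  by rewrite rmorph1 expr1n mulr1.
apply: IH; apply: leq_trans (size_sum _ _ _) _; apply/bigmax_leqP => i _.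
by apply: leq_trans (size_poly _ _) _; lia.
Qed.

(** Falling factorials, on which Delta acts as the derivative acts on powers. *)
Definition ffpoly (k : nat) : {poly R} := \prod_(i < k) ('X - i%:R%:P).

Lemma size_ffpoly k : size (ffpoly k) = k.+1.
Proof.
rewrite /ffpoly -(big_map (fun i : 'I_k => i%:R) xpredT (fun a => 'X - a%:P)).
by rewrite size_prod_XsubC size_map /index_enum -enumT size_enum_ord.
Qed.

Lemma fdiff_ffpoly k (j : int) :
  fdiff (fun j : int => (ffpoly k.+1).[j%:~R]) j = k.+1%:R * (ffpoly k).[j%:~R].
Proof.
rewrite /fdiff rmorphD /= rmorph1; set x := j%:~R.
have -> : (ffpoly k.+1).[x + 1] = (x + 1) * (ffpoly k).[x].
  rewrite /ffpoly !horner_prod big_ord_recl !hornerE subr0; congr (_ * _).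
  by apply: eq_bigr => i _; rewrite !hornerE -natr1 /=; ring.
rewrite {2}/ffpoly horner_prod big_ord_recr /= -horner_prod -/(ffpoly k) !hornerE.
by rewrite -natr1; ring.
Qed.

Lemma fdiffn0_poly K h : fdiffn K h = 0 ->
  exists2 H : {poly R}, (size H <= K)%N & forall j, h j = H.[j%:~R].
Proof.
suff hE : fdiffn K h = 0 -> exists c : nat -> R,
    forall j, h j = (\sum_(k < K) c k *: ffpoly k).[j%:~R].
  move=> /hE[c {}hE]; exists (\sum_(k < K) c k *: ffpoly k) => //.
  apply: leq_trans (size_sum _ _ _) _; apply/bigmax_leqP => k _.
  by apply: leq_trans (size_scale_leq _ _) _; rewrite size_ffpoly.
elim: K h => [|K IH] h.
  by move=> h0; exists (fun=> 0) => j; rewrite big_ord0 horner0; move: h0 => /= ->.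
rewrite fdiffnS => /IH[c cE].
pose Q : {poly R} := \sum_(k < K) (c k / k.+1%:R) *: ffpoly k.+1.
pose d j := h j - Q.[j%:~R].
have d0 : fdiff d = 0.
  apply/funext => j; rewrite /fdiff /d.
  have -> : h (j + 1) - Q.[(j + 1)%:~R] - (h j - Q.[j%:~R]) =
     fdiff h j - fdiff (fun j : int => Q.[j%:~R]) j by rewrite /fdiff; ring.
  rewrite cE /Q /fdiff !horner_sum -!sumrB big1// => k _.
  rewrite !hornerZ -mulrBr.
  pose fk (i : int) := (ffpoly k.+1).[i%:~R].
  rewrite -[(ffpoly k.+1).[(j + 1)%:~R] - _]/(fdiff fk j).
  by rewrite fdiff_ffpoly mulrA divfK ?subrr// pnatr_eq0.
exists (fun k => if k is k'.+1 then c k' / k'.+1%:R else d 0) => j.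
rewrite big_ord_recl hornerD hornerZ {1}/ffpoly big_ord0 hornerE mulr1.
by rewrite -(fdiff0_const d0 j) /d /Q subrK.
Qed.

End Polynomials.

(** * Passing to the limit: sign and equality case for the residual *)

Section Residual.
Context (R : realType) (mu delta beta gamma : R) (p : int -> R).
Hypothesis hp : co_pmf mu delta beta gamma p.
Implicit Types (f g h u v z : int -> R) (F G : nat -> int -> R).
Local Notation W := (wgt delta beta gamma p).
Local Notation D := (steinD mu delta beta gamma).
Local Notation Dn := (steinDn mu delta beta gamma).
Local Notation sops := (sops mu delta beta gamma).
Local Notation phi := (phi mu delta beta gamma).
Local Notation ip := (ip delta beta gamma p).
Local Notation wint2 := (wint2 delta beta gamma p).
Local Notation eqw := (eqw delta beta gamma p).
Local Notation lam := (lam delta).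
Local Notation lams := (lams delta).

Let W_ge0 k j : 0 <= W k j. Proof. exact: wgt_ge0 hp k j. Qed.

(** Weaker than convergence in norm, but stable under Delta and D_k: these involve finitely many
    neighbouring points, whereas they need not be bounded in the norms. *)
Definition pointwise0 k G := forall j, W k j != 0 -> G^~ j @ \oo --> (0 : R).

Lemma pointwise0_ip k G : (forall t, wint2 k (G t)) ->
  (fun t => ip k (G t) (G t)) @ \oo --> (0 : R) -> pointwise0 k G.
Proof.
move=> G2 G0 j wj; apply: sqr_cvg0.
apply: (@cvg0_le _ _ (fun t => (W k j)^-1 * ip k (G t) (G t))).
- by move=> t; exact: sqr_ge0.
- move=> t; have w0 : 0 < W k j by rewrite lt_def wj W_ge0.
  rewrite -(ler_pM2l w0) (mulVKf wj) ip_sqr.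
  apply: (@ler_isum_term _ (fun j => W k j * G t j ^+ 2) j (G2 t)) => i.
  by rewrite mulr_ge0 ?sqr_ge0.
- exact: cvgM0.
Qed.

Lemma pointwise0_fdiff k G : pointwise0 k G -> pointwise0 k.+1 (fun t => fdiff (G t)).
Proof.
move=> G0 j wj; rewrite -(subrr 0); apply: cvgB; apply: G0; apply: contra wj => /eqP w0.
  by rewrite (wgt_succ hp) w0 mul0r.
by rewrite wgtS w0 mul0r.
Qed.

Lemma pointwise0_fdiffn i k G : pointwise0 k G ->
  pointwise0 (k + i) (fun t => fdiffn i (G t)).
Proof.
elim: i k G => [|i IH] k G G0; first by rewrite addn0.
have := IH _ _ (pointwise0_fdiff G0); rewrite addSnnS.
by congr pointwise0; apply/funext => t; rewrite fdiffnS.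
Qed.

Lemma pointwise0_steinD k G : pointwise0 k.+1 G -> pointwise0 k (fun t => D k (G t)).
Proof.
move=> G0 j wj.
have G1 i : (fun t => W k.+1 i * G t i) @ \oo --> (0 : R).
  have [->|wi] := eqVneq (W k.+1 i) 0.
    by under eq_fun do rewrite mul0r; exact: cvg_cst.
  exact: cvgM0 (G0 i wi).
have := cvgM0 (W k j)^-1 (cvgD0 (G1 (j - 1)) (cvgM0 (-1) (G1 j))).
set u := (X in X @ _ --> _); rewrite (_ : (fun t => _) = u)//; apply/funext => t.
rewrite /u mulN1r -(wgt_steinD hp) mulrA mulVf// mul1r; by [].
Qed.

Lemma pointwise0_sops k s G : pointwise0 k G -> pointwise0 k (fun t => sops k s (G t)).
Proof.
move=> G0; elim: s => [//|a s IH] j wj.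
under eq_fun do rewrite sops_cons.
apply: cvgD0; first exact: (pointwise0_steinD (pointwise0_fdiff IH)).
exact: cvgM0 (IH j wj).
Qed.

(** The differences vanish only where they see the support of W_k. An extension of Delta f is summed
    up; f minus that sum is constant along the support because the support is an interval. *)
Lemma polynomial_extension K k f : (forall j, W (k + K) j != 0 -> fdiffn K f j = 0) ->
  exists2 h, fdiffn K h = 0 & eqw k f h.
Proof.
elim: K k f => [|K IH] k f fK.
  by exists 0 => // j wj; have := fK j; rewrite addn0 => /(_ wj).
have [j|h' h'0 h'E] := IH k.+1 (fdiff f).
  by rewrite -fdiffnS addSnnS; exact: fK.
pose d := f - asum h'.
have d0 j : W k.+1 j != 0 -> d (j + 1) = d j.
  move=> wj; apply/eqP; rewrite -subr_eq0; apply/eqP.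
  have -> : d (j + 1) - d j = fdiff f j - fdiff (asum h') j.
    by rewrite /d /fdiff !fctE; ring.
  by rewrite fdiff_asum h'E// subrr.
have [[x wx]|wn] := pselect (exists x, W k x != 0); last first.
  exists 0; first by elim: K.+1 => //= i ->; apply/funext => j; rewrite /fdiff subrr.
  by move=> j wj; exfalso; apply: wn; exists j.
have pos i : W k i != 0 -> 0 < W k i by move=> wi; rewrite lt_def wi W_ge0.
have dE (y : int) (t : nat) : W k y != 0 -> W k (y + t%:Z) != 0 -> d (y + t%:Z) = d y.
  move=> wy wt; suff H (s : nat) : (s <= t)%N -> d (y + s%:Z) = d y by exact: H.
  elim: s => [|s IHs] st; first by rewrite addr0.
  rewrite -addn1 PoszD addrA d0 ?IHs//; first exact: ltnW.
  by rewrite gt_eqF// (wgt_gt0_between hp (pos _ wy) (pos _ wt))//; lia.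
exists (asum h' + cst (d x)).
  rewrite fdiffnS (_ : fdiff _ = h')//.
  by rewrite -[RHS](fdiff_asum h'); apply/funext => j; rewrite /fdiff !fctE; ring.
move=> j wj; suff <- : d j = d x by rewrite /d !fctE; ring.
have [xj|jx] := leP x j.
  by have := dE x `|(j - x)%R|%N wx; rewrite (_ : x + _ = j) => [/(_ wj)|]//; lia.
have := dE j `|(x - j)%R|%N wj; rewrite (_ : j + _ = x) => [/(_ wx)|]//; lia.
Qed.

Lemma cvg_ord_sum N (u : nat -> nat -> R) (l : nat -> R) :
  (forall i, (i < N)%N -> u i @ \oo --> l i) ->
  (fun t => \sum_(i < N) u i t) @ \oo --> \sum_(i < N) l i.
Proof.
elim: N => [|N IH] H.
  by rewrite big_ord0; under eq_fun do rewrite big_ord0; exact: cvg_cst.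
rewrite big_ord_recr; under eq_fun do rewrite big_ord_recr.
by apply: cvgD; [apply: IH => i iN; apply: H; exact: ltnW|exact: H].
Qed.

Variables (m n : nat).
Hypothesis hW : exists x, 0 < W (m + n) x.
Hypothesis mn1 : (1 <= m + n)%N.
Local Notation energy := (energy delta beta gamma p n).
Local Notation bform := (bform delta beta gamma p m n).
Local Notation polproj := (polproj mu delta beta gamma p m).

Lemma ip_approx F f i : (i <= n)%N -> energy f -> (forall t, fin_supp (F t)) ->
  approximates delta beta gamma p n F f ->
  (fun t => ip i (fdiffn i (F t)) (fdiffn i (F t))) @ \oo -->
    ip i (fdiffn i f) (fdiffn i f).
Proof.
move=> il fe Fs Ff.
have E t : ip i (fdiffn i (F t)) (fdiffn i (F t)) = ip i (fdiffn i f) (fdiffn i f) +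
  (-2 * ip i (fdiffn i (f - F t)) (fdiffn i f) +
   ip i (fdiffn i (f - F t)) (fdiffn i (f - F t))).
  have de : energy (f - F t) := energyB hp fe (energy_fin delta beta gamma p (Fs t)).
  have -> : fdiffn i (F t) = -1 *: fdiffn i (f - F t) + fdiffn i f.
    by rewrite -fdiffn_linear scaleN1r opprB subrK.
  have s1 := energy_ip_summable hp il de de.
  have s2 := energy_ip_summable hp il de fe.
  have s3 := energy_ip_summable hp il fe fe.
  have s4 := energy_ip_summable hp il fe de.
  have s5 : wint2 i (-1 *: fdiffn i (f - F t) + fdiffn i f).
    by apply: (wint2_linear hp); [exact: de _ il|exact: fe _ il].
  rewrite ip_linear; [|exact: (wint2_mul hp (de _ il) s5)|exact: (wint2_mul hp (fe _ il) s5)].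
  rewrite !(ipC _ _ _ _ i _ (_ *: _ + _)) !ip_linear//.
  by rewrite (ipC _ _ _ _ i (fdiffn i f) (fdiffn i (f - F t))); ring.
rewrite (funext E).
set l := ip i (fdiffn i f) (fdiffn i f); rewrite -[l in X in _ --> X](addr0 l).
apply: cvgD; first exact: cvg_cst.
apply: cvgD0; last exact: Ff.
exact: cvgM0 (approximates_ip hp il fe Fs (fe _ il) Ff).
Qed.

Lemma bform_approx F f : energy f -> (forall t, fin_supp (F t)) ->
  approximates delta beta gamma p n F f ->
  (fun t => bform (F t) (F t)) @ \oo --> bform f f.
Proof.
move=> fe Fs Ff.
apply: (@cvg_ord_sum n.+1
  (fun i t => (-1) ^+ i * nu delta m n i * ip i (fdiffn i (F t)) (fdiffn i (F t)))
  (fun i => (-1) ^+ i * nu delta m n i * ip i (fdiffn i f) (fdiffn i f))) => i il.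
by apply: cvgM; [exact: cvg_cst|exact: ip_approx].
Qed.

Lemma eqw_bform f f' g g' : eqw 0 f f' -> eqw 0 g g' -> bform f g = bform f' g'.
Proof.
move=> ff gg; apply: eq_bigr => i _; congr (_ * _).
have := eqw_fdiffn hp (i := i) ff; have := eqw_fdiffn hp (i := i) gg; rewrite !add0n.
by move=> gg' ff'; exact: (eqw_ip hp ff' gg').
Qed.

(** One level beyond [lamB_gt0]: [hW] covers the eigenvalues up to index m + n, so the gaps below
    lam_(m+n+1) require W_(m+n+1) to be nonzero somewhere. *)
Lemma lams_le i : (exists x, W (m.+1 + n) x != 0) ->
  i \in lams 0 m.+1 -> 0 < lam (m.+1 + n) - i.
Proof.
move=> [x wx] /mapP[j]; rewrite mem_iota add0n => /andP[_ jm] ->.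
rewrite lamB; last by lia.
have -> : (m.+1 + n + j)%:R - 1 = (m + n + j)%:R :> R by rewrite !addSn -natr1 addrK.
rewrite mulr_gt0 ?ltr0n ?subn_gt0//; first by lia.
by apply: (@delta_bound _ _ _ _ _ _ hp (m.+1 + n) x); [rewrite lt_def wx W_ge0|lia].
Qed.

Lemma ip_level0 k f g : (forall x, W k x = 0) -> ip k f g = 0.
Proof.
by move=> w0; rewrite -[RHS](isum0 R); apply: eq_isum => j; rewrite w0 mul0r.
Qed.

(* f is a limit of finitely supported f_t = D_0 ... D_m u_t in the norms of order
   at most n. In the equality case Delta^n u_t tends to 0 pointwise, hence so does
   Delta^(m+n+1) f_t. *)
Lemma bform_orth f : energy f -> (forall k, (k <= m)%N -> ip 0 f (phi k) = 0) ->
  0 <= (\prod_(s < n) - lam (m + s.+1)) * bform f f /\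
  (bform f f = 0 -> forall j, W (m.+1 + n) j != 0 -> fdiffn (m.+1 + n) f j = 0).
Proof.
move=> fe fo; set c := \prod_(s < n) _.
have mmn : (m.+1 <= (m + n).+1)%N by lia.
have [F [Fs Ff Fo]] := approximates_orth hp hW mn1 (b := m.+1) fe fo mmn.
have solve t : exists v, fin_supp v /\ eqw 0 (F t) (Dn 0 m.+1 v).
  have [||v vs vE] := steinDn_solve hp (l := m.+1) (k := 0) (Fs t).
  - by move=> i j ij jm; rewrite gt_eqF// (lamB_gt0 hp hW mn1)//; lia.
  - by move=> i im; exact: Fo.
  - by exists v.
have [u Hu] := choice solve.
pose z t := fdiffn n (u t).
have zs t : fin_supp (z t) by apply: fin_supp_fdiffn; case: (Hu t).
have cE t : c * bform (F t) (F t) =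
    ip (m.+1 + n) (z t) (sops (m.+1 + n) (lams 0 m.+1) (z t)).
  have [us uE] := Hu t; rewrite (eqw_bform uE uE) (bform_steinDn hp)// => j jmn.
  by rewrite gt_eqF// (onem_delta_gt0 hp hW)//; lia.
have cc : (fun t => c * bform (F t) (F t)) @ \oo --> c * bform f f.
  by apply: cvgM; [exact: cvg_cst|exact: bform_approx].
(* If W_(m+n+1) vanishes identically, the support has exactly m + n + 1 points: the form is zero and
   the second claim is void. *)
have [[x wx]|wn] := pselect (exists x, W (m.+1 + n) x != 0); last first.
  have w0 x : W (m.+1 + n) x = 0.
    by apply/eqP; apply: contrapT => /negP wx; apply: wn; exists x.
  split; last by move=> _ j; rewrite w0 eqxx.
  rewrite le_eqVlt; apply/orP; left; apply/eqP.
  rewrite -(cvg_lim _ cc)// (_ : (fun t => _) = (fun=> 0)) ?lim_cst//.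
  by apply/funext => t; rewrite cE ip_level0.
have lp a : a \in lams 0 m.+1 -> 0 < lam (m.+1 + n) - a.
  by apply: lams_le; exists x.
pose e := \prod_(a <- lams 0 m.+1) (lam (m.+1 + n) - a).
have e0 : 0 < e by rewrite /e big_seq; apply: prodr_gt0 => a; exact: lp.
have ge t : e * ip (m.+1 + n) (z t) (z t) <= c * bform (F t) (F t).
  by rewrite cE; apply: (ip_sops_ge hp (zs t)) => a /lp/ltW.
have zz t : 0 <= ip (m.+1 + n) (z t) (z t) := ip_ge0_fin hp (m.+1 + n) (zs t).
split.
  rewrite -(cvg_lim _ cc)//; apply: limr_ge; first exact: cvgP cc.
  by apply: nearW => t /=; apply: le_trans (ge t); rewrite mulr_ge0// ltW.
move=> b0 j wj; rewrite b0 mulr0 in cc.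
have z0 : (fun t => ip (m.+1 + n) (z t) (z t)) @ \oo --> (0 : R).
  apply: (cvg0_le zz _ (cvgM0 e^-1 cc)) => t /=.
  by rewrite -(ler_pM2l e0) mulVKf ?gt_eqF.
have pz := pointwise0_ip (fun t => wint2_fin _ _ _ _ (m.+1 + n) (zs t)) z0.
have ps := pointwise0_sops (lams 0 m.+1) pz wj.
have pd : pointwise0 (m.+1 + n) (fun t => fdiffn (m.+1 + n) (f - F t)).
  rewrite -[X in pointwise0 X]add0n; apply: pointwise0_fdiffn.
  apply: pointwise0_ip; last exact: (Ff 0%N).
  move=> t; have := energyB hp fe (energy_fin delta beta gamma p (Fs t)) (leq0n n).
  by [].
(* The differences of D_0 ... D_m u_t are one fixed local operator applied to z t, so pointwise
   convergence of z t is enough. *)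
have FE t : fdiffn (m.+1 + n) (F t) j = sops (m.+1 + n) (lams 0 m.+1) (z t) j.
  have [us uE] := Hu t; have := eqw_fdiffn hp (i := m.+1 + n) uE.
  rewrite add0n => /(_ j wj) ->; rewrite addnC /fdiffn iterD -!/(fdiffn _ _).
  by rewrite fdiffn_steinDn add0n fdiffn_sops addnC.
have := cvgD0 (pd j wj) ps.
rewrite (_ : (fun t => _) = fun=> fdiffn (m.+1 + n) f j) => [H|].
  by rewrite -(cvg_lim _ H)// lim_cst.
by apply/funext => t; rewrite -FE fdiffn_sub !fctE subrK.
Qed.

(** Triangular elimination: the K-th difference of phi_K is a constant, nonzero for K <= m + n. *)
Lemma phi_span K h : (K <= (m + n).+1)%N -> fdiffn K h = 0 ->
  exists c : nat -> R, h = \sum_(k < K) c k *: phi k.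
Proof.
elim: K h => [|K IH] h Kmn hK; first by exists (fun=> 0); rewrite big_ord0.
pose a := fdiffn K h 0.
have hKE : fdiffn K h = fun=> a by apply/funext => j; exact: (fdiff0_const (h := fdiffn K h) hK j).
pose b := a / newton delta K (lam K).
have [|c cE] := IH (- b *: phi K + h) (ltnW Kmn).
  rewrite fdiffn_linear hKE fdiffn_phi; apply/funext => j.
  rewrite !fctE /GRing.scale /= -/(newton delta K (lam K)) mulNr divfK ?addNr//.
  by rewrite gt_eqF// (newton_gt0 hp hW mn1).
exists (fun k => if k == K then b else c k).
rewrite big_ord_recr /= eqxx.
rewrite (eq_bigr (fun k : 'I_K => c k *: phi k)) => [|k _]; last first.
  by rewrite ltn_eqF.
by rewrite -cE scaleNr addrAC addNr add0r.
Qed.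

(** On the support g is a combination of phi_0, ..., phi_(m+n). Those with k <= m are orthogonal to
    the residual, and those with m < k <= m + n are annihilated because Q(lam_k) = 0. *)
Lemma bform_polynomial g h : energy g -> eqw 0 g h -> fdiffn (m + n).+1 h = 0 ->
  bform (g - polproj g) (g - polproj g) = 0.
Proof.
move=> ge gh hK; have re := energy_residual hp m ge.
have [c cE] := phi_span (leqnn _) hK.
have E : eqw 0 (g - polproj g) (h - polproj g) by move=> j wj; rewrite !fctE gh.
rewrite (eqw_bform (fun j _ => erefl) E) bformC (bformB hp)//; last 2 first.
- by rewrite cE; exact: (energy_sum hp (n := n) (m + n).+1 c).
- exact: energy_polproj.
have pz k : (k <= m + n)%N -> bform (phi k) (g - polproj g) = 0.
  move=> kmn; rewrite bformC (bform_phi hp hW mn1)//.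
  have [km|mk] := leqP k m; first by rewrite (residual_orth hp hW mn1)// mulr0.
  by rewrite (spectral_lam0 hp hW mn1) ?mul0r// mk.
rewrite cE (bform_sum hp m (m + n).+1 c)// big1 => [|k _]; last first.
  by rewrite pz ?mulr0// -ltnS.
rewrite (bform_sum hp m m.+1 (fun k => ip 0 g (phi k) / normphi delta beta gamma p k))//.
rewrite big1 ?subrr// => k _; rewrite pz ?mulr0//.
by have := ltn_ord k; lia.
Qed.

End Residual.

(** * Closed forms and positivity of the constants *)

Section KappaFormula.
Context (R : realType) (mu delta beta gamma : R) (p : int -> R).
Hypothesis hp : co_pmf mu delta beta gamma p.
Local Notation W := (wgt delta beta gamma p).
Local Notation lam := (lam delta).

Variables (m n : nat).
Hypothesis hW : exists x, 0 < W (m + n) x.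
Hypothesis mn1 : (1 <= m + n)%N.

Lemma prod_lam k l : \prod_(s < k) lam (l + s.+1) =
  ((l + k) ^_ k)%:R * PiDelta delta k l.
Proof.
elim: k => [|k IH]; first by rewrite big_ord0 ffactn0 PiDelta0 mulr1.
rewrite big_ord_recr /= IH PiDeltaS addnS ffactSS natrM lamS addnC.
by rewrite (addnC k l); ring.
Qed.

Lemma prod_lamB k l i : (i <= l)%N -> \prod_(s < k) (lam (l + s.+1) - lam i) =
  ((l + k - i) ^_ k)%:R * PiDelta delta k (l + i).
Proof.
move=> il; elim: k => [|k IH]; first by rewrite big_ord0 ffactn0 PiDelta0 mulr1.
rewrite big_ord_recr /= IH PiDeltaS lamB; last by lia.
have -> : (l + k.+1 - i = (l + k - i).+1)%N by lia.
rewrite ffactSS natrM.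
have -> : (l + k.+1 + i)%:R - 1 = (k + (l + i))%:R :> R.
  by rewrite (_ : (l + k.+1 + i = (k + (l + i)).+1)%N) -?natr1 ?addrK//; lia.
ring.
Qed.

Lemma newton_lamE k : (0 < k)%N ->
  newton delta k (lam k) = k`!%:R * PiDelta delta k k.-1.
Proof.
move=> k0; have PE i l : PiDelta delta i l = \prod_(j < i) (1 - (j + l)%:R * delta).
  elim: i => [|i IH]; first by rewrite PiDelta0 big_ord0.
  by rewrite PiDeltaS IH big_ord_recr.
rewrite PE -ffactnn ffact_prod natr_prod -big_split; apply: eq_bigr => j _ /=.
have jk := ltn_ord j.
rewrite lamB; last exact: ltnW.
have -> : (k + j)%:R - 1 = (j + k.-1)%:R :> R; last by [].
by rewrite (_ : (k + j = (j + k.-1).+1)%N) -?natr1 ?addrK//; lia.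
Qed.

Lemma PiDelta_gt0 k l : (forall j, (l <= j < k + l)%N -> 0 < 1 - j%:R * delta) ->
  0 < PiDelta delta k l.
Proof. by move=> H; rewrite /PiDelta big_nat prodr_gt0. Qed.

Lemma spectral_lamE k :
  (\prod_(s < n) lam (m + s.+1)) * spectral delta m n (lam k) =
  \prod_(s < n) (lam (m + s.+1) - lam k).
Proof.
have := spectralE hp hW mn1 (lam k); rewrite prodrN.
rewrite -[X in X * _ * _]signr_odd -[RHS]mulrA => E.
rewrite -[LHS](signrMK (odd #|'I_n|)) -E -[in RHS](eq_bigr _ (fun s _ => opprB _ _)).
by rewrite prodrN signr_odd.
Qed.

Lemma spectral_gt0 k : (k <= m)%N -> 0 < spectral delta m n (lam k).
Proof.
move=> km; have P0 : 0 < \prod_(s < n) lam (m + s.+1).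
  apply: prodr_gt0 => s _; apply: (lam_gt0 hp hW mn1).
  by have := ltn_ord s; lia.
rewrite -(pmulr_rgt0 _ P0) spectral_lamE; apply: prodr_gt0 => s _.
by apply: (lamB_gt0 hp hW mn1); have := ltn_ord s; lia.
Qed.

(** Q(lam_k) is the product over s of (lam_(m+s) - lam_k) / lam_(m+s). Numerator and denominator are
    each a falling factorial times a [PiDelta], which leaves the identity [comb] between
    integers. *)
Lemma kappaE k : (1 <= k <= m)%N ->
  ('C(m, k)%:R * PiDelta delta n (m + k)) /
  (((m + n) ^_ k)%:R * PiDelta delta k k.-1 * PiDelta delta n m * isum (W k)) =
  spectral delta m n (lam k) / normphi delta beta gamma p k.
Proof.
move=> /andP[k1 km].
have P1 : PiDelta delta n m != 0.
  rewrite gt_eqF// PiDelta_gt0// => j jm; apply: (onem_delta_gt0 hp hW); lia.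
have N0 : newton delta k (lam k) != 0.
  by rewrite gt_eqF// (newton_gt0 hp hW mn1)//; lia.
have I0 : isum (W k) != 0 by rewrite gt_eqF// (isum_W_gt0 hp hW mn1)//; lia.
have f1 : ((m + n) ^_ k)%:R != 0 :> R by rewrite pnatr_eq0 -lt0n ffact_gt0; lia.
have f2 : ((m + n) ^_ n)%:R != 0 :> R by rewrite pnatr_eq0 -lt0n ffact_gt0; lia.
have f3 : k`!%:R != 0 :> R by rewrite pnatr_eq0 -lt0n fact_gt0.
have comb : 'C(m, k)%:R * k`!%:R * ((m + n) ^_ n)%:R =
    ((m + n - k) ^_ n)%:R * ((m + n) ^_ k)%:R :> R.
  rewrite -!natrM; congr (_%:R); apply/eqP.
  rewrite -(eqn_pmul2r (fact_gt0 (m - k))); apply/eqP.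
  (* Multiplied by (m - k)!, both sides become (m + n)!. *)
  transitivity ((m + n)`!)%N.
    rewrite -(@ffact_fact (m + n) n) ?leq_addl// addnK -(bin_fact km); lia.
  rewrite -(@ffact_fact (m + n) k); last by lia.
  rewrite -(@ffact_fact (m + n - k) n); last by lia.
  by rewrite (_ : (m + n - k - n = m - k)%N); lia.
have sE : spectral delta m n (lam k) =
   (((m + n - k) ^_ n)%:R * PiDelta delta n (m + k)) / (((m + n) ^_ n)%:R * PiDelta delta n m).
  have := spectral_lamE k; rewrite prod_lam prod_lamB// => <-.
  by rewrite mulrC mulKf// mulf_neq0.
move: N0; rewrite sE /normphi newton_lamE// mulf_eq0 negb_or => /andP[_ P2].
move: comb f1 f2 f3 P1 P2 I0.
move: ('C(m, k)%:R) (k`!%:R) ((m + n) ^_ n)%:R ((m + n - k) ^_ n)%:R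
  ((m + n) ^_ k)%:R (PiDelta delta n m) (PiDelta delta k k.-1) (isum (W k))
  (PiDelta delta n (m + k)) => a b c d e f g h i.
move=> comb e0 c0 b0 f0 g0 h0.
have -> : d = a * b * c / e by rewrite comb mulfK.
by field; rewrite e0 c0 b0 f0 g0 h0.
Qed.

Lemma kappa_factor_gt0 k : (k <= m)%N ->
  0 < spectral delta m n (lam k) / normphi delta beta gamma p k.
Proof.
by move=> km; rewrite divr_gt0 ?spectral_gt0// (normphi_gt0 hp hW mn1)//; lia.
Qed.

Lemma nu_gt0 k : (1 <= k <= n)%N -> 0 < nu delta m n k.
Proof.
move=> kn; rewrite /nu divr_gt0//; first by rewrite ltr0n bin_gt0; lia.
rewrite mulr_gt0//; first by rewrite ltr0n ffact_gt0; lia.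
by apply: PiDelta_gt0 => j jm; apply: (onem_delta_gt0 hp hW); lia.
Qed.

Lemma spectral0 : spectral delta m n (lam 0) = 1.
Proof.
rewrite /spectral big_ord_recl big1 => [|i _].
  by rewrite /newton big_ord0 nu0 expr0 !mulr1 addr0.
by rewrite /newton big_ord_recl subrr mul0r mulr0.
Qed.

End KappaFormula.

(** * Expectations of integer random variables *)

Section IntegerExpectation.
Context d (T : measurableType d) (R : realType) (P : probability T R).
Variable X : T -> int.
Hypothesis mX : integer_rv X.
Implicit Types (F : int -> R).
Local Notation p := (Defs.pmf P X).

Lemma int_pmfE j : P (X @^-1` [set j]) = (p j)%:E.
Proof. by rewrite /Defs.pmf fineK// fin_num_measure//; exact: mX. Qed.

Lemma int_pmf_ge0 j : 0 <= p j.
Proof. by rewrite /Defs.pmf fine_ge0. Qed.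

(** Fibres are grouped in pairs so that the partial sums of the integral are exactly the windows of
    [winsum]. *)
Definition pair_fiber (n : nat) : set T :=
  X @^-1` [set Posz n] `|` X @^-1` [set Negz n].

Lemma measurable_preimage (A : set int) : measurable (X @^-1` A).
Proof.
have -> : X @^-1` A = \bigcup_n ((if `[< A (Posz n) >] then X @^-1` [set Posz n] else set0) `|`
    (if `[< A (Negz n) >] then X @^-1` [set Negz n] else set0)).
  apply/seteqP; split=> [t At|t [n _]].
    case E : (X t) => [n|n]; exists n => //; [left|right]; rewrite asboolT//=.
      by rewrite -E.
    by rewrite -E.
  by case; case: asboolP => // ? E; rewrite /preimage /= E.
by apply: bigcup_measurable => n _; apply: measurableU; case: ifPn => // _; exact: mX.
Qed.

Lemma measurable_comp_rv F (D : set T) : measurable D ->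
  measurable_fun D (EFin \o (F \o X)).
Proof.
move=> mD _ Y mY; apply: measurableI => //.
exact: (measurable_preimage (fun j => Y (F j)%:E)).
Qed.

Lemma ge0_integral_rv F : (forall j, 0 <= F j) ->
  (\int[P]_t (F (X t))%:E =
   \sum_(n <oo) (F (Posz n) * p (Posz n) + F (Negz n) * p (Negz n))%:E)%E.
Proof.
move=> F0.
have mB n : measurable (pair_fiber n) by apply: measurableU; exact: mX.
have BT : \bigcup_n pair_fiber n = setT.
  apply/seteqP; split=> // t _.
  by case E : (X t) => [n|n]; exists n => //; [left|right].
rewrite -BT ge0_integral_bigcup//.
- apply: eq_eseriesr => n _.
  have fib j : (\int[P]_(t in X @^-1` [set j]) (F (X t))%:E = (F j * p j)%:E)%E.
    rewrite (eq_integral (cst (F j)%:E)).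
      rewrite integral_cst; last exact: mX.
      by rewrite EFinM; congr (_ * _)%E; exact: int_pmfE.
    by move=> t; rewrite inE /preimage /= => ->.
  rewrite ge0_integral_setU; [by rewrite !fib|exact: mX|exact: mX| | |].
  + by apply: measurable_comp_rv; exact: mB.
  + by move=> t _; rewrite lee_fin.
  + apply/disj_setPS => t [/= E1 E2]; by rewrite E1 in E2.
- by apply: measurable_comp_rv; rewrite BT.
- by move=> t _; rewrite lee_fin.
- apply/trivIsetP => i j _ _ ij; apply/seteqP; split=> // t /= [[]E []];
  by rewrite /= E => E'; move/eqP: ij; apply; lia.
Qed.

Lemma partial_sum_winsum F N :
  (\sum_(0 <= n < N) (F (Posz n) * p (Posz n) + F (Negz n) * p (Negz n))%:E =
   (winsum (fun j => F j * p j) N)%:E)%E.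
Proof. by rewrite big_mkord sumEFin. Qed.

Lemma integral_rv_ge0 F : (forall j, 0 <= F j) -> isummable (fun j => F j * p j) ->
  (\int[P]_t (F (X t))%:E = (isum (fun j => F j * p j))%:E)%E.
Proof.
move=> F0 Fs; rewrite ge0_integral_rv//; apply: cvg_lim => //.
under eq_fun do rewrite partial_sum_winsum.
by apply: cvg_EFin; [exact: nearW|exact: cvg_winsum].
Qed.

Lemma isummable_rv_ge0 F : (forall j, 0 <= F j) ->
  (\int[P]_t (F (X t))%:E < +oo)%E -> isummable (fun j => F j * p j).
Proof.
move=> F0 Foo; have Fp0 j : 0 <= F j * p j by rewrite mulr_ge0// int_pmf_ge0.
have E := ge0_integral_rv F0.
have I0 : (0 <= \int[P]_t (F (X t))%:E)%E.
  by apply: integral_ge0 => t _; rewrite lee_fin.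
apply: (@isummable_ge0 _ _ (fine (\int[P]_t (F (X t))%:E))) => // N.
rewrite -lee_fin fineK; last by rewrite ge0_fin_numE.
rewrite -partial_sum_winsum E; apply: nneseries_lim_ge => n _ _.
by rewrite lee_fin addr_ge0.
Qed.

Lemma integrable_rv F : isummable (fun j => F j * p j) ->
  P.-integrable setT (fun t => (F (X t))%:E).
Proof.
move=> Fs; apply/integrableP; split; first exact: measurable_comp_rv.
rewrite (_ : (fun t => _) = (fun t => (`|F (X t)|)%:E)) => [|]; last first.
  by apply/funext => t.
have -> := @integral_rv_ge0 (fun j => `|F j|).
- by rewrite ltry.
- by [].
- apply: eq_isummable (isummable_abs Fs) => j.
  by rewrite normrM (ger0_norm (int_pmf_ge0 j)).
Qed.

Lemma isummable_integrable F : P.-integrable setT (fun t => (F (X t))%:E) ->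
  isummable (fun j => F j * p j).
Proof.
move=> /integrableP[_ Foo].
have := @isummable_rv_ge0 (fun j => `|F j|) (fun j => normr_ge0 _) Foo.
apply: isummable_le => j.
by rewrite [leRHS]ger0_norm ?mulr_ge0 ?int_pmf_ge0// normrM (ger0_norm (int_pmf_ge0 j)).
Qed.

Lemma integral_rv F : isummable (fun j => F j * p j) ->
  (\int[P]_t (F (X t))%:E = (isum (fun j => F j * p j))%:E)%E.
Proof.
move=> Fs.
have s1 : isummable (fun j => `|F j| * p j).
  apply: eq_isummable (isummable_abs Fs) => j.
  by rewrite normrM (ger0_norm (int_pmf_ge0 j)).
have s2 : isummable (fun j => (`|F j| + F j) * p j).
  by apply: eq_isummable (isummableD s1 Fs) => j; rewrite mulrDl.
have := @integralB_EFin _ _ _ P setT (fun t => `|F (X t)| + F (X t)) (fun t => `|F (X t)|)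
  measurableT (integrable_rv s2) (integrable_rv s1).
rewrite (@integral_rv_ge0 (fun j => `|F j| + F j))//; last first.
  by move=> j; have := ler_norm (- F j); rewrite normrN; lra.
rewrite (@integral_rv_ge0 (fun j => `|F j|))// -EFinB -isumB// => E.
have FE : isum (fun j => F j * p j) =
    isum (fun j => (`|F j| + F j) * p j - `|F j| * p j).
  by apply: eq_isum => j; ring.
rewrite FE -E; apply: eq_integral => t _; rewrite -EFinB.
by rewrite addrAC subrr add0r.
Qed.

(** F may be negative off the support, as q^[k] can be. There p = 0, so the negative part integrates
    to zero and an upper bound on the integral does give summability. *)
Lemma isummable_rv_lty F : (forall j, 0 <= F j * p j) ->
  (\int[P]_t (F (X t))%:E < +oo)%E -> isummable (fun j => F j * p j).
Proof.
move=> F0 Foo; pose Fp j := Num.max (F j) 0; pose Fm j := Num.max (- F j) 0.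
have Fm0 j : Fm j * p j = 0.
  have := F0 j; have := int_pmf_ge0 j; rewrite le_eqVlt => /predU1P[<-|pj].
    by rewrite !mulr0.
  by rewrite pmulr_lge0// => Fj; rewrite /Fm max_r ?mul0r// oppr_le0.
have FpE j : Fp j * p j = F j * p j.
  have -> : Fp j = F j + Fm j.
    by rewrite /Fp /Fm; case: (leP (F j) 0); case: (leP (- F j) 0); lra.
  by rewrite mulrDl Fm0 addr0.
suff: isummable (fun j => Fp j * p j) by apply: eq_isummable FpE.
have Fp0 j : 0 <= Fp j by rewrite /Fp le_max lexx orbT.
apply: isummable_rv_ge0 Fp0 _.
move: Foo; rewrite integralE.
have -> : (\int[P]_t (fun t => (F (X t))%:E)^\- t = 0)%E.
  have -> : ((fun t => (F (X t))%:E)^\- = fun t => (Fm (X t))%:E)%E.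
    by apply/funext => t; rewrite funenegE /Fm EFin_max EFinN.
  rewrite integral_rv_ge0 ?(eq_isum Fm0) ?isum0//.
    by move=> j; rewrite /Fm le_max lexx orbT.
  by apply: eq_isummable (isummable0 R) => j.
rewrite sube0; congr (_ < _)%E; apply: eq_integral => t _.
by rewrite funeposE /Fp EFin_max.
Qed.

Lemma int_pmf_total : isummable p /\ isum p = 1.
Proof.
have I1 : (\int[P]_t (1 : R)%:E = 1)%E.
  by rewrite integral_cst// mul1e; exact: probability_setT.
have s : isummable (fun j => 1 * p j).
  by apply: (@isummable_rv_ge0 (fun=> 1)) => //; rewrite I1 ltry.
split; first by apply: eq_isummable s => j; rewrite mul1r.
apply: EFin_inj; rewrite -I1 (@integral_rv (fun=> 1))//.
by congr EFin; apply: eq_isum => j; rewrite mul1r.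
Qed.

Lemma probability_rv (A : set int) :
  P (X @^-1` A) = 1%E <-> (forall j, p j != 0 -> A j).
Proof.
pose F j : R := (`[< A j >])%:R.
have [ps p1] := int_pmf_total.
have Fs : isummable (fun j => F j * p j).
  apply: isummable_ler _ _ ps => j; rewrite /F; first by rewrite mulr_ge0// int_pmf_ge0.
  by case: asboolP => _; rewrite ?mul1r// mul0r int_pmf_ge0.
have PE : P (X @^-1` A) = (isum (fun j => F j * p j))%:E.
  have := integral_indic P measurableT (measurable_preimage A).
  rewrite setIT => PA; rewrite -(integral_rv Fs); apply: etrans (esym PA) _.
  apply: eq_integral => t _; rewrite /F indicE.
  suff -> : (t \in X @^-1` A) = `[< A (X t) >] by [].
  by apply/idP/asboolP; rewrite inE.
have Gs : isummable (fun j => p j - F j * p j) by exact: isummableB.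
have GE : isum (fun j => p j - F j * p j) = 1 - isum (fun j => F j * p j).
  by rewrite isumB// p1.
rewrite PE; split=> [[FE] j pj|AE].
  apply: contrapT => Aj; move/eqP: pj; apply.
  have := isum_eq0 Gs _ _ j; rewrite /F asboolF// mul0r subr0; apply.
    move=> i; rewrite subr_ge0; case: asboolP => _; rewrite ?mul1r// mul0r; exact: int_pmf_ge0.
  by rewrite GE FE subrr.
congr EFin; rewrite -p1; apply: eq_isum => j; rewrite /F.
have [->|/AE Aj] := eqVneq (p j) 0; first by rewrite mulr0.
by rewrite asboolT// mul1r.
Qed.

Lemma variance_rv F : isummable (fun j => F j * p j) -> isummable (fun j => F j ^+ 2 * p j) ->
  'V_P[fun t => F (X t)]%E =
  (isum (fun j => F j ^+ 2 * p j) - isum (fun j => F j * p j) ^+ 2)%:E.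
Proof.
move=> F1 F2; have [ps p1] := int_pmf_total; set e := isum (fun j => F j * p j).
rewrite /variance covariance.unlock unlock.
rewrite (_ : fine _ = e); last by rewrite integral_rv.
have GE j : (F j - e) ^+ 2 * p j = F j ^+ 2 * p j - (2 * e * (F j * p j) - e ^+ 2 * p j).
  by ring.
have s1 := isummableZ (2 * e) F1; have s2 := isummableZ (e ^+ 2) ps.
have s3 := isummableB s1 s2.
have Gs : isummable (fun j => (F j - e) ^+ 2 * p j).
  by apply: eq_isummable (isummableB F2 s3) => j; rewrite GE.
transitivity (\int[P]_t ((F (X t) - e) ^+ 2)%:E)%E.
  by apply: eq_integral => t _; rewrite expr2.
rewrite (@integral_rv (fun j => (F j - e) ^+ 2))//; congr EFin.
by rewrite (eq_isum GE) isumB// isumB// !isumZ// p1 -/e; ring.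
Qed.

End IntegerExpectation.

(** * From the cumulative identity to the recursion and the weights *)

Section CumulativeOrd.
Context d (T : measurableType d) (R : realType) (P : probability T R).
Variables (X : T -> int) (mu delta beta gamma : R).
Hypothesis hCO : cumulative_ord P X mu delta beta gamma.
Hypothesis hX : delta <= 0 \/ finite_set (supp P X).
Local Notation p := (Defs.pmf P X).
Local Notation q := (quad delta beta gamma).

Let mX : integer_rv X. Proof. by case: hCO. Qed.
Let p0 j : 0 <= p j. Proof. exact: int_pmf_ge0. Qed.
Let w j : R := q j * p j.
Let u (j : int) (i : nat) : R := (mu - (j - i%:Z)%:~R) * p (j - i%:Z).
Let h (j : int) : R := (mu - j%:~R) * p j.

Let series_w j : series (u j) @ \oo --> w j. Proof. by case: hCO => _ _ _; apply. Qed.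

Let h_pmf j : h j = mu * p j - j%:~R * p j. Proof. by rewrite /h mulrBl. Qed.

Let mean_summable : isummable (fun j : int => j%:~R * p j).
Proof. by case: hCO => _ iX _ _; apply: isummable_integrable iX. Qed.

Let h_sum : isummable h /\ isum h = 0.
Proof.
have [ps p1] := int_pmf_total P mX.
have hs : isummable (fun j : int => mu * p j - j%:~R * p j).
  by apply: isummableB => //; exact: isummableZ.
split; first by apply: eq_isummable hs => j; rewrite h_pmf.
rewrite (eq_isum h_pmf) isumB//; last exact: isummableZ.
rewrite isumZ// p1 mulr1.
suff -> : isum (fun j : int => j%:~R * p j) = mu by rewrite subrr.
case: hCO => _ _ EX _; apply: EFin_inj; rewrite -EX unlock.
by rewrite (@integral_rv _ _ _ P X mX (fun j => j%:~R)).
Qed.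

Let w_step j : w j = h j + w (j - 1).
Proof.
have s1 : (fun n => series (u j) n.+1) @ \oo --> w j.
  by rewrite (cvg_shiftS (series (u j))); exact: series_w.
have s2 : (fun n => series (u j) n.+1) @ \oo --> h j + w (j - 1).
  rewrite (_ : (fun n => _) = (fun n => h j + series (u (j - 1)) n)).
    by apply: cvgD; [exact: cvg_cst|exact: series_w].
  apply/funext => n; rewrite /series /= big_nat_recl//; congr (_ + _).
    by rewrite /u subr0.
  by apply: eq_bigr => i _; rewrite /u (_ : j - i.+1%:Z = j - 1 - i%:Z)//; lia.
by rewrite -(cvg_lim _ s1)// (cvg_lim _ s2).
Qed.

Let w_series j n : w j = series (u j) n + w (j - n%:Z).
Proof.
elim: n => [|n IH]; first by rewrite /series /= big_geq// add0r subr0.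
rewrite IH /series /= big_nat_recr//= -addrA; congr (_ + _).
rewrite w_step; congr (_ + w _); lia.
Qed.

Let w_left j : (fun n : nat => w (j - n%:Z)) @ \oo --> (0 : R).
Proof.
rewrite (_ : (fun n => _) = (fun n => w j - series (u j) n)); last first.
  by apply/funext => n; rewrite {1}(w_series j n) addrAC subrr add0r.
by rewrite -(subrr (w j)); apply: cvgB; [exact: cvg_cst|exact: series_w].
Qed.

(** E(mu - X) = 0 says that the full sum of h is zero, so w, the sum of h from the left, tends to 0
    on the right as well. *)
Let w_right j : (fun n : nat => w (j + n%:Z)) @ \oo --> (0 : R).
Proof.
have [hs h0] := h_sum.
have H N : w (N%:Z - 1) = winsum h N + w (Negz N).
  have := winsum_telescope (fun j => - w j) N.
  rewrite (eq_winsum (g := h)) => [->|i]; first by ring.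
  by rewrite (w_step i); ring.
have wN : (fun N : nat => w (N%:Z - 1)) @ \oo --> (0 : R).
  rewrite (funext H) -[0](addr0 0) -{1}h0; apply: cvgD; first exact: cvg_winsum.
  rewrite (_ : (fun n => w (Negz n)) = (fun n => w (-1 - n%:Z))).
    exact: w_left.
  by apply/funext => n; congr w; lia.
have [N jN] : exists N : nat, forall n : nat, (N <= n)%N ->
    j + n%:Z = (`|(j + n%:Z + 1)%R|%N)%:Z - 1.
  by exists `|j|%N => n Nn; lia.
apply/cvgr0Pnorm_le => e e0.
have /cvgr0Pnorm_le /(_ _ e0)[M _ HM] := wN.
exists (N + `|j| + M)%N => // n /= Mn; rewrite jN; last by lia.
by apply: HM => /=; lia.
Qed.

(** w increases up to mu and decreases afterwards, with limit 0 at both ends. *)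
Let w_ge0 j : 0 <= w j.
Proof.
have [jmu|muj] := leP j%:~R mu.
  rewrite -(cvg_lim _ (@series_w j))//; apply: limr_ge; first exact: cvgP (@series_w j).
  apply: nearW => n; apply: sumr_ge0 => i _; rewrite mulr_ge0// subr_ge0.
  by apply: le_trans jmu; rewrite ler_int; lia.
have ge (n : nat) : w (j + n%:Z) <= w j.
  elim: n => [|n IH]; first by rewrite addr0.
  apply: le_trans IH; rewrite w_step (_ : j + n.+1%:Z - 1 = j + n%:Z); last by lia.
  rewrite gerDr mulr_le0_ge0// subr_le0; apply: le_trans (ltW muj) _.
  by rewrite ler_int; lia.
rewrite -(cvg_lim _ (@w_right j))//; apply: limr_le; first exact: cvgP (@w_right j).
exact: nearW.
Qed.

(** The same monotonicity, anchored at x when j lies below mu and at y - 1 otherwise. *)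
Let w_gt0 x y j : 0 < p x -> 0 < p y -> x <= j -> j < y -> 0 < w j.
Proof.
move=> px py xj jy; have [jmu|muj] := ltP j%:~R mu.
  have xmu : x%:~R < mu by apply: le_lt_trans jmu; rewrite ler_int.
  have wx : 0 < w x by rewrite w_step ltr_wpDr// mulr_gt0// subr_gt0.
  have ge (n : nat) : x + n%:Z <= j -> w x <= w (x + n%:Z).
    elim: n => [|n IH] nj; first by rewrite addr0.
    apply: le_trans (IH _) _; first by lia.
    rewrite [leRHS]w_step (_ : x + n.+1%:Z - 1 = x + n%:Z); last by lia.
    rewrite lerDr mulr_ge0// subr_ge0 ltW//.
    by apply: le_lt_trans jmu; rewrite ler_int.
  apply: lt_le_trans wx _; have := ge `|(j - x)%R|%N.
  by rewrite (_ : x + _ = j); [apply|]; lia.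
have wy : 0 < w (y - 1).
  have -> : w (y - 1) = w y + (y%:~R - mu) * p y by rewrite [w y]w_step /h; ring.
  rewrite ltr_wpDl// mulr_gt0// subr_gt0; apply: le_lt_trans muj _.
  by rewrite ltr_int.
have ge (n : nat) : w (j + n%:Z) <= w j.
  elim: n => [|n IH]; first by rewrite addr0.
  apply: le_trans IH; rewrite w_step (_ : j + n.+1%:Z - 1 = j + n%:Z); last by lia.
  rewrite gerDr mulr_le0_ge0// subr_le0; apply: le_trans muj _.
  by rewrite ler_int; lia.
apply: lt_le_trans wy _; have := ge `|(y - 1 - j)%R|%N.
by rewrite (_ : j + _ = y - 1)//; lia.
Qed.

Lemma finite_int_bounded (A : set int) : finite_set A ->
  exists N : nat, forall j, A j -> (`|j| < N)%N.
Proof.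
move=> /finite_seqP[s ->]; exists (\max_(x <- s) `|x|).+1 => j /= js.
by rewrite ltnS; apply: (@leq_bigmax_seq _ s xpredT (fun x : int => `|x|%N)).
Qed.

Lemma cumulative_ord_co_pmf : co_pmf mu delta beta gamma p.
Proof.
have [ps p1] := int_pmf_total P mX.
split.
- exact: p0.
- by move=> j; rewrite -/(w (j - 1)) -[RHS](addKr (h j)) -w_step /w /h; ring.
- exact: w_ge0.
- exact: w_gt0.
- apply: isummable_ler (isummableD ps (isummable_abs mean_summable)) => j.
    by rewrite mulr_ge0// ler0n.
  rewrite normrM (ger0_norm (p0 j)).
  have -> : p j + `|j%:~R| * p j = (1 + `|j%:~R|) * p j by ring.
  by rewrite ler_wpM2r// /rho -natr1 addrC lerD2l -intr_norm -abszE -pmulrn.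
- case: hX => [d0|/finite_int_bounded[N HN]]; first by left.
  right; exists N => j Nj; apply/eqP; rewrite eq_le p0 andbT leNgt.
  by apply/negP => /HN; rewrite ltnNge Nj.
Qed.

(** If W_N vanished identically, all distances in the support would be below N. Its points would
    then have distinct residues modulo N, so there would be at most N of them instead of N + 1. *)
Lemma supp_length_wgt N : (0 < N)%N -> (N%:R%:E <= supp_length P X)%E ->
  exists x, 0 < wgt delta beta gamma p N x.
Proof.
move=> N0 HN; apply: contrapT => nW.
have hp := cumulative_ord_co_pmf.
have close x y : 0 < p x -> 0 < p y -> (`|(x - y)%R| < N)%N.
  wlog xy : x y / x <= y => [H px py|px py].
    have [xy|/ltW yx] := leP x y; first exact: H.
    by rewrite distnC; apply: H.
  rewrite ltnNge; apply/negP => Nxy; apply: nW; exists x.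
  by apply: (wgt_gt0 hp px py) => //; lia.
have Sfin : finite_set (supp P X).
  have [ps p1] := int_pmf_total P mX.
  have [[x0 px]|n0] := pselect (exists x, 0 < p x); last first.
    by rewrite (_ : supp P X = set0)//; apply/seteqP; split=> // x px; apply: n0; exists x.
  apply: (@sub_finite_set _ _ [set` [seq x0 - N%:Z + k%:Z | k <- iota 0 (N + N)]]).
    move=> y py /=; apply/mapP; exists `|(y - (x0 - N%:Z))%R|%N.
      by have := close _ _ px py; rewrite mem_iota; lia.
    by have := close _ _ px py; lia.
  exact: finite_seq.
move: HN; rewrite /supp_length /counting asboolT// leeBrDr// -EFinD lee_fin.
rewrite natr1 ler_nat; apply/negP; rewrite -ltnNge ltnS.
set s := finmap.enum_fset _.
have sp x : x \in s -> 0 < p x.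
  by move=> xs; have : (supp P X) x by rewrite -(fset_setK Sfin).
rewrite -(size_map (fun x : int => `|(x %% N%:Z)%Z|%N)).
rewrite -[X in (_ <= X)%N](size_iota 0 N).
apply: uniq_leq_size.
  rewrite map_inj_in_uniq ?finmap.fset_uniq// => x y /sp px /sp py.
  have Nz : N%:Z != 0 by lia.
  have xN := modz_ge0 x Nz; have yN := modz_ge0 y Nz.
  move=> /= xyN; have /eqP : (x %% N%:Z)%Z = (y %% N%:Z)%Z.
    by rewrite -(gez0_abs xN) -(gez0_abs yN) xyN.
  rewrite eqz_mod_dvd dvdzE /= => /dvdn_leq H; have := close _ _ px py.
  by case: (posnP `|(x - y)%R|%N) => [?|/H]; lia.
move=> _ /mapP[x _ ->]; rewrite mem_iota /= add0n.
by have := @ltz_pmod x N; have := @modz_ge0 x N; lia.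
Qed.

End CumulativeOrd.

(** * Variance defect as the quadratic form of the residual *)

Section Assembly.
Context d (T : measurableType d) (R : realType) (P : probability T R).
Variables (X : T -> int) (mu delta beta gamma : R).
Hypothesis hCO : cumulative_ord P X mu delta beta gamma.
Hypothesis hX : delta <= 0 \/ finite_set (supp P X).
Variables (m n : nat).
Hypothesis mn1 : (1 <= m + n)%N.
Hypothesis hM : ((m + n)%:R%:E <= supp_length P X)%E.
Variable g : int -> R.
Hypothesis hg : in_H P X (quad delta beta gamma) m n g.
Local Notation p := (Defs.pmf P X).
Local Notation q := (quad delta beta gamma).
Local Notation W := (wgt delta beta gamma p).
Local Notation lam := (lam delta).
Local Notation phi := (phi mu delta beta gamma).
Local Notation ip := (ip delta beta gamma p).
Local Notation residual := (g - polproj mu delta beta gamma p m g).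

Let mX : integer_rv X. Proof. by case: hCO. Qed.
Let hp : co_pmf mu delta beta gamma p.
Proof. exact: cumulative_ord_co_pmf hCO hX. Qed.
Let hW : exists x, 0 < W (m + n) x.
Proof. exact (supp_length_wgt hCO hX mn1 hM). Qed.

Let W_rising k (F : int -> R) j : W k j * F j = rising q k j * F j * p j.
Proof. by rewrite wgtE; ring. Qed.

Lemma expectation_rising k (F : int -> R) : isummable (fun j => W k j * F j) ->
  fine 'E_P[fun t => (rising q k (X t) * F (X t))%R]%E = isum (fun j => W k j * F j).
Proof.
move=> Fs; rewrite unlock (@integral_rv _ _ _ P X mX (fun j => rising q k j * F j)).
  by apply: eq_isum => j; rewrite W_rising.
by apply: eq_isummable Fs => j; rewrite W_rising.
Qed.

Lemma integrable_rising k (F : int -> R) : isummable (fun j => W k j * F j) ->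
  P.-integrable setT (fun t => (rising q k (X t) * F (X t))%:E).
Proof.
move=> Fs; apply: (integrable_rv mX (F := fun j => rising q k j * F j)).
by apply: eq_isummable Fs => j; rewrite W_rising.
Qed.

Lemma summable_rising k (F : int -> R) : (forall j, 0 <= F j) ->
  ('E_P[fun t => (rising q k (X t) * F (X t))%R] < +oo)%E ->
  isummable (fun j => W k j * F j).
Proof.
move=> F0; rewrite unlock => Foo.
have := isummable_rv_lty mX (F := fun j => rising q k j * F j) _ Foo.
move=> H; apply: (eq_isummable (f := fun j => rising q k j * F j * p j)).
  by move=> j; rewrite W_rising.
by apply: H => j; rewrite -W_rising mulr_ge0// (wgt_ge0 hp).
Qed.

Lemma energy_g : energy delta beta gamma p n g.
Proof.
apply: (energy_descent hp hW mn1).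
by apply: summable_rising (proj1 hg) => j; exact: sqr_ge0.
Qed.

Lemma wint1_g i : (i <= m)%N -> isummable (fun j => W i j * fdiffn i g j).
Proof.
move=> im; have g1 : wint1 delta beta gamma p m 0 (fdiffn m g).
  have := summable_rising (fun j => normr_ge0 (fdiffn m g j)) (proj2 hg).
  by apply: eq_isummable => j; rewrite expr0 mulr1.
apply: isummable_le (wint1_all hp hW mn1 g1 im) => j.
by rewrite expr0 mulr1 !normrM normr_id.
Qed.

Lemma g_summable : isummable (fun j => g j * p j) /\ isummable (fun j => g j ^+ 2 * p j).
Proof.
have g2 := energy_g (leq0n n); have g1 := wint2_int1 hp 0 g2.
split; last by apply: eq_isummable g2 => j; rewrite wgt0 mulrC.
apply: isummable_le g1 => j.
by rewrite wgt0 expr0 mulr1 !normrM normr_id mulrC.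
Qed.

Lemma variance_g : 'V_P[fun t => g (X t)]%E =
  (isum (fun j => g j ^+ 2 * p j) - isum (fun j => g j * p j) ^+ 2)%:E.
Proof. by case: g_summable => g1 g2; exact: variance_rv. Qed.

Lemma ip_phi_g i : (i <= m)%N -> ip 0 g (phi i) = isum (fun j => W i j * fdiffn i g j).
Proof.
move=> im; rewrite (ip_phi hp hW mn1); last 2 first.
- by lia.
- apply: isummable_le (wint1_g im) => j.
  by rewrite expr0 mulr1 !normrM normr_id.
by apply: eq_isum => j; rewrite mulr1.
Qed.

Lemma kappa_spectral k : (1 <= k <= m)%N -> kappa P X delta beta gamma m n k =
  spectral delta m n (lam k) / normphi delta beta gamma p k.
Proof.
move=> km; rewrite -(kappaE hp hW mn1 km) /kappa; congr (_ / _); congr (_ * _).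
rewrite (_ : (fun t => rising q k (X t)) = (fun t => rising q k (X t) * 1)).
  rewrite (expectation_rising (F := fun=> 1)).
    by apply: eq_isum => j; rewrite mulr1.
  by apply: eq_isummable (wgt_summable hp k) => j; rewrite mulr1.
by apply/funext => t; rewrite mulr1.
Qed.

(** The index 0 terms of the two sums in [bform_residual] are E g^2 and (E g)^2, since nu_0,
    Q(lam_0) and |phi_0|^2 all equal 1; the remaining terms form S with the opposite sign. *)
Lemma variance_sub_Smn :
  ('V_P[fun t => g (X t)] - (Smn P X delta beta gamma m n g)%:E)%E =
  (bform delta beta gamma p m n residual residual)%:E.
Proof.
rewrite variance_g -EFinB (bform_residual hp hW mn1 energy_g); congr EFin.
rewrite /Smn !big_add1 !big_mkord /bform big_ord_recl.
rewrite [X in _ = _ - X]big_ord_recl spectral0 nu0 expr0 /=.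
have [ps p1] := int_pmf_total P mX.
have -> : normphi delta beta gamma p 0 = 1.
  rewrite /normphi /newton big_ord0 mul1r -p1; apply: eq_isum => j; exact: wgt0.
rewrite ip_phi_g//.
have -> : isum (fun j => W 0 j * fdiffn 0 g j) = isum (fun j => g j * p j).
  by apply: eq_isum => j; rewrite wgt0 mulrC.
have -> : ip 0 g g = isum (fun j => g j ^+ 2 * p j).
  by apply: eq_isum => j; rewrite wgt0 expr2 mulrC.
have -> : \sum_(i < m) kappa P X delta beta gamma m n i.+1 *
    fine 'E_P[fun t => (rising q i.+1 (X t) * fdiffn i.+1 g (X t))%R]%E ^+ 2 =
   \sum_(i < m) spectral delta m n (lam i.+1) / normphi delta beta gamma p i.+1 *
     ip 0 g (phi i.+1) ^+ 2.
  apply: eq_bigr => i _; have im : (i.+1 <= m)%N by [].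
  by rewrite kappa_spectral// expectation_rising ?ip_phi_g//; exact: wint1_g.
have -> : \sum_(i < n) (-1) ^+ i * nu delta m n i.+1 *
    fine 'E_P[fun t => (rising q i.+1 (X t) * fdiffn i.+1 g (X t) ^+ 2)%R]%E =
   - \sum_(i < n) (-1) ^+ i.+1 * nu delta m n i.+1 *
     ip i.+1 (fdiffn i.+1 g) (fdiffn i.+1 g).
  rewrite -sumrN; apply: eq_bigr => i _.
  rewrite (expectation_rising (F := fun j => fdiffn i.+1 g j ^+ 2)).
    by rewrite ip_sqr exprS; ring.
  exact: energy_g.
set A := \sum_(i < m) _; set B := \sum_(i < n) _.
set U := isum (fun j => g j ^+ 2 * p j); set V := isum (fun j => g j * p j).
rewrite -[RHS]/(1 * 1 * U + B - (1 / 1 * V ^+ 2 + A)) divr1; ring.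
Qed.

Lemma residual_form_sign :
  0 <= (-1) ^+ n * bform delta beta gamma p m n residual residual.
Proof.
have re := energy_residual hp m energy_g.
have ro k := @residual_orth _ _ _ _ _ _ hp _ _ hW mn1 g k energy_g.
have [+ _] := bform_orth hp hW mn1 re ro.
rewrite prodrN card_ord; set b := bform _ _ _ _ _ _ _ _.
have l0 : 0 < \prod_(s < n) lam (m + s.+1).
  apply: prodr_gt0 => s _; apply: (lam_gt0 hp hW mn1).
  by have := ltn_ord s; lia.
by rewrite mulrAC pmulr_lge0.
Qed.

Lemma residual_form_eq0 : bform delta beta gamma p m n residual residual = 0 <->
  exists H : {poly R}, (size H <= (m + n).+1)%N /\
    P [set t | g (X t) = H.[(X t)%:~R]] = 1%E.
Proof.
have PE (H : {poly R}) := probability_rv P mX [set j : int | g j = H.[j%:~R]].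
split=> [b0|[H [sH /PE gH]]].
  have re := energy_residual hp m energy_g.
  have ro k := @residual_orth _ _ _ _ _ _ hp _ _ hW mn1 g k energy_g.
  have [_ /(_ b0) r0] := bform_orth hp hW mn1 re ro.
  (* The projection has degree at most m, so m + n + 1 differences kill it and the conclusion for
     the residual passes to g. *)
  have gK j : W (0 + (m + n).+1) j != 0 -> fdiffn (m + n).+1 g j = 0.
    rewrite add0n -addSn => /r0 rj.
    have pK : fdiffn (m.+1 + n) (polproj mu delta beta gamma p m g) = 0.
      rewrite /polproj; pose c k := ip 0 g (phi k) / normphi delta beta gamma p k.
      rewrite -[\sum_(k < m.+1) _]/(\sum_(k < m.+1) c k *: phi k).
      have lin := fdiffn_linear (R := R) (m.+1 + n).
      have -> := @lin_sum R _ (fdiffn (m.+1 + n)) lin m.+1 c phi.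
      by rewrite big1// => k _; rewrite fdiffn_phi0 ?scaler0//; have := ltn_ord k; lia.
    by move: rj; rewrite fdiffn_sub pK subr0.
  have [h hK gh] := polynomial_extension hp gK.
  have [H sH hH] := fdiffn0_poly hK.
  exists H; split=> //; apply/PE => j pj /=; rewrite -hH; apply: gh.
  by rewrite wgt0.
apply: (bform_polynomial hp hW mn1 energy_g (h := fun j : int => H.[j%:~R])).
  by move=> j; rewrite wgt0 => /gH.
exact: fdiffn_horner.
Qed.

End Assembly.

Theorem theorem9p1 (R : realType) (d : measure_display) (T : measurableType d)
    (P : probability T R) (X : T -> int) (mu delta beta gamma : R)
    (hCO : cumulative_ord P X mu delta beta gamma)
    (hX : delta <= 0 \/ finite_set (supp P X))
    (m n : nat) (hmn1 : (1 <= m + n)%N)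
    (hmnM : ((m + n)%:R%:E <= supp_length P X)%E)
    (g : int -> R)
    (hg : in_H P X (quad delta beta gamma) m n g) :
  (forall i : nat, (1 <= i <= m)%N -> 0 < kappa P X delta beta gamma m n i) /\
  (forall i : nat, (1 <= i <= n)%N -> 0 < nu delta m n i) /\
  moments_finite P X (quad delta beta gamma) m n g /\
  (0 <= ((-1) ^+ n)%:E *
        ('V_P[fun t => g (X t)] - (Smn P X delta beta gamma m n g)%:E))%E /\
  ((Smn P X delta beta gamma m n g)%:E = 'V_P[fun t => g (X t)]%E <->
   exists H : {poly R}, (size H <= (m + n).+1)%N /\
     P [set t | g (X t) = H.[(X t)%:~R]] = 1%E).
Proof.
have mX : integer_rv X by case: hCO.
have hp := cumulative_ord_co_pmf hCO hX.
have hW := supp_length_wgt hCO hX hmn1 hmnM.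
have VS := variance_sub_Smn hCO hX hmn1 hmnM hg.
split; [|split; [|split; [|split]]].
- move=> i im; rewrite (kappa_spectral hCO hX hmn1 hmnM im).
  by apply: (kappa_factor_gt0 hp hW hmn1); case/andP: im.
- by move=> i; exact: (nu_gt0 hp hW hmn1).
- have [g1 g2] := g_summable hCO hX hmn1 hmnM hg; split.
  + exact: integrable_rv.
  + by rewrite (variance_g hCO hX hmn1 hmnM hg) ltry.
  + move=> i /andP[_ im]; apply: (integrable_rising hCO (F := fdiffn i g)).
    exact: (wint1_g hCO hX hmn1 hmnM hg).
  + move=> i /andP[_ iln].
    apply: (integrable_rising hCO (F := fun j => fdiffn i g j ^+ 2)).
    exact: (energy_g hCO hX hmn1 hmnM hg).
- by rewrite VS -EFinM lee_fin; exact: (residual_form_sign hCO hX hmn1 hmnM hg).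
- rewrite -(residual_form_eq0 hCO hX hmn1 hmnM hg).
  move: VS; rewrite (variance_g hCO hX hmn1 hmnM hg) -EFinB => -[<-].
  by split=> [[->]|/eqP]; rewrite ?subrr// subr_eq0 => /eqP ->.
Qed.
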